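(* Let $K$ be a field and let $\Lambda=K\mathcal{Q}/I$ be a $(D,A)$-stacked monomial algebra with $D\geqslant 2$, $A\geqslant 1$. Assume that $D\neq 2A$ when $A>1$. Then there is a regrading of the Ext algebra $E(\Lambda)=\bigoplus_{n\geqslant 0}\operatorname{Ext}^n_\Lambda(\Lambda_0,\Lambda_0)$ so that the regraded Ext algebra is a Koszul algebra.
   Context: $\mathcal{Q}$ is a finite quiver, $I$ is an admissible ideal of $K\mathcal{Q}$ generated by length homogeneous elements, and $\Lambda = K\mathcal{Q}/I$ is finite-dimensional with the length grading $\Lambda = \Lambda_0\oplus\Lambda_1\oplus\cdots$; $\mathfrak{r}=\Lambda_1\oplus\Lambda_2\oplus\cdots$ is the graded Jacobson radical and $\Lambda_0\cong\Lambda/\mathfrak{r}$ is a graded right $\Lambda$-module with minimal graded projective resolution $(P^n,d^n)$. Multiplication in $E(\Lambda)$ is the Yoneda product. Definition: $\Lambda$ is a $(D,A)$-stacked algebra ($D\geqslant 2$, $A\geqslant 1$ integers) if, for all $0\leqslant n\leqslant \operatorname{gldim}\Lambda$, $P^n$ is generated in degree $\delta(n)$, where $\delta(0)=0$, $\delta(1)=1$, $\delta(n)=\frac{n}{2}D$ for $n\geqslant 2$ even, and $\delta(n)=\frac{n-1}{2}D+A$ for $n\geqslant 3$ odd. It is a $(D,A)$-stacked monomial algebra if moreover $I$ is generated by paths. Regrading: an $\mathbb{N}$-grading $\hat{E}(\Lambda)=\bigoplus_{n\geqslant 0}\hat{E}(\Lambda)_n$ of the algebra $E(\Lambda)$ (so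 $\hat{E}(\Lambda)_m\hat{E}(\Lambda)_n\subseteq\hat{E}(\Lambda)_{m+n}$) in which each $\hat{E}(\Lambda)_n$ is a direct sum of some of the spaces $\operatorname{Ext}^i_\Lambda(\Lambda_0,\Lambda_0)$. A graded algebra $B=\bigoplus_{n\geqslant 0}B_n$ with $B_0$ a finite product of copies of $K$ is Koszul if $B_0$ has a linear resolution, i.e. the $n$th projective in a minimal graded projective resolution of $B_0$ over $B$ is generated in degree $n$ for all $n$. *)

(* Defs.v *)
From HB Require Import structures.
From mathcomp Require Import all_boot all_order all_algebra.
From mathcomp Require Import boolp classical_sets functions.

Set Implicit Arguments.
Unset Strict Implicit.
Unset Printing Implicit Defensive.

Import GRing.Theory.
Local Open Scope ring_scope.
Local Open Scope classical_set_scope.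

(* The vertex set is non-empty: [algType] excludes the zero algebra. *)
Record quiver := Quiver {
  vertex : finType;
  arrow : finType;
  src : arrow -> vertex;
  tgt : arrow -> vertex;
  vertex_gt0 : (0 < #|vertex|)%N }.

Fixpoint walk (Q : quiver) (v : vertex Q) (s : seq (arrow Q)) : bool :=
  if s is a :: s' then (src a == v) && walk (tgt a) s' else true.

Definition walk_end (Q : quiver) (v : vertex Q) (s : seq (arrow Q)) : vertex Q :=
  foldl (fun _ a => tgt a) v s.

(* A path is a start vertex together with its arrows in order of traversal;
   the trivial paths have no arrow. *)
Record qpath (Q : quiver) := QPath {
  path_val : vertex Q * seq (arrow Q);
  path_valP : walk path_val.1 path_val.2 }.

HB.instance Definition _ (Q : quiver) := [isSub for @path_val Q].
HB.instance Definition _ (Q : quiver) := [Countable of qpath Q by <:].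

Section Paths.
Variable Q : quiver.
Implicit Types (v : vertex Q) (s t : seq (arrow Q)) (p q : qpath Q).

Definition plen p : nat := size (path_val p).2.

Lemma walk_cat v s t : walk v (s ++ t) = walk v s && walk (walk_end v s) t.
Proof. by elim: s v => //= a s IHs v; rewrite IHs andbA. Qed.

Lemma walk_take v s i : walk v s -> walk v (take i s).
Proof. by rewrite -{1}(cat_take_drop i s) walk_cat => /andP[]. Qed.

Lemma walk_drop v s i : walk v s -> walk (walk_end v (take i s)) (drop i s).
Proof. by rewrite -{1}(cat_take_drop i s) walk_cat => /andP[]. Qed.

Definition ptake (i : nat) p : qpath Q :=
  @QPath Q ((path_val p).1, take i (path_val p).2) (walk_take i (path_valP p)).

Definition pdrop (i : nat) p : qpath Q :=
  @QPath Q (walk_end (path_val p).1 (take i (path_val p).2),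
            drop i (path_val p).2) (walk_drop i (path_valP p)).

Lemma plen_take i p : (i <= plen p)%N -> plen (ptake i p) = i.
Proof. by move=> le_ip; rewrite /plen /= size_takel. Qed.

Lemma plen_drop i p : plen (pdrop i p) = (plen p - i)%N.
Proof. by rewrite /plen /= size_drop. Qed.

Lemma ptake_take i j p : (i <= j)%N -> ptake i (ptake j p) = ptake i p.
Proof. by move=> le_ij; apply: val_inj; rewrite /= take_takel. Qed.

Lemma pdrop_drop i j p : pdrop i (pdrop j p) = pdrop (i + j) p.
Proof.
apply: val_inj; rewrite /= drop_drop; congr (_, _).
by rewrite [in RHS]addnC takeD /walk_end foldl_cat.
Qed.

Lemma ptake_drop i j p : ptake i (pdrop j p) = pdrop j (ptake (j + i) p).
Proof.
apply: val_inj; rewrite /= take_takel ?leq_addr //; congr (_, _).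
by rewrite addnC take_drop.
Qed.

Lemma ptake_size p : ptake (plen p) p = p.
Proof. by apply: val_inj; rewrite /= take_size -surjective_pairing. Qed.

Lemma pdrop0 p : pdrop 0 p = p.
Proof. by apply: val_inj; rewrite /= take0 drop0 -surjective_pairing. Qed.

End Paths.

Section PathAlgebra.
Variables (K : fieldType) (Q : quiver).

Definition finite_support : {pred qpath Q -> K^o} :=
  [pred f | `[< exists s : seq (qpath Q), forall p, p \notin s -> f p = 0 >]].

Lemma finite_supportP f :
  reflect (exists s : seq (qpath Q), forall p, p \notin s -> f p = 0)
          (f \in finite_support).
Proof. by rewrite inE; apply: asboolP. Qed.

Lemma finite_support_submod : submod_closed finite_support.
Proof.
split; first by apply/finite_supportP; exists [::].
move=> a f g /finite_supportP[s sP] /finite_supportP[t tP].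
apply/finite_supportP; exists (s ++ t) => p.
rewrite mem_cat negb_or => /andP[/sP fp /tP gp].
rewrite -[LHS]/(a * f p + g p) fp gp mulr0 addr0 //.
Qed.

HB.instance Definition _ :=
  GRing.isSubmodClosed.Build K (qpath Q -> K^o) finite_support
    finite_support_submod.


Record path_alg := PathAlg {
  pa_fun : qpath Q -> K^o;
  pa_funP : pa_fun \in finite_support }.

HB.instance Definition _ := [isSub for pa_fun].
HB.instance Definition _ := [Choice of path_alg by <:].
HB.instance Definition _ := [SubChoice_isSubLmodule of path_alg by <:].

Lemma path_algP (x y : path_alg) : (forall p, pa_fun x p = pa_fun y p) -> x = y.
Proof. by move=> eq_xy; apply: val_inj; apply: funext. Qed.

Lemma pa_funD (x y : path_alg) p : pa_fun (x + y) p = pa_fun x p + pa_fun y p.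
Proof. by []. Qed.

Lemma pa_funZ a (x : path_alg) p : pa_fun (a *: x) p = a * pa_fun x p.
Proof. by []. Qed.

(* The bilinear extension of concatenation: p * q is "p followed by q" when p
   ends where q starts, and 0 otherwise. *)
Definition conv (f g : qpath Q -> K^o) (p : qpath Q) : K^o :=
  \sum_(i < (plen p).+1) f (ptake i p) * g (pdrop i p).

Lemma conv_finite f g :
  f \in finite_support -> g \in finite_support -> conv f g \in finite_support.
Proof.
move=> /finite_supportP[s sP] /finite_supportP[t tP]; apply/finite_supportP.
exists (pmap insub [seq ((path_val p).1, (path_val p).2 ++ (path_val q).2)
                   | p <- s, q <- t]) => p pNst.
apply: big1 => i _; have [ps|/sP-> //] := boolP (ptake i p \in s); last first.
  by rewrite mul0r.
have [pt|/tP-> //] := boolP (pdrop i p \in t); last by rewrite mulr0.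
case/negP: pNst; rewrite mem_pmap_sub; apply/allpairsP.
exists (ptake i p, pdrop i p); split=> //=.
by rewrite cat_take_drop -surjective_pairing.
Qed.

Definition pa_mul (x y : path_alg) : path_alg :=
  PathAlg (conv_finite (pa_funP x) (pa_funP y)).

Definition unit_fun (p : qpath Q) : K^o := (plen p == 0%N)%:R.

Lemma unit_fun_finite : unit_fun \in finite_support.
Proof.
apply/finite_supportP.
exists (pmap insub [seq (v, [::]) | v <- enum (vertex Q)]) => p pNs.
rewrite /unit_fun; case: eqP => // /size0nil p0; case/negP: pNs.
rewrite mem_pmap_sub; apply/mapP; exists (path_val p).1; first by rewrite mem_enum.
by rewrite -p0 -surjective_pairing.
Qed.

Definition pa_one : path_alg := PathAlg unit_fun_finite.

Lemma pa_mulA : associative pa_mul.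
Proof.
move=> x y z; apply: path_algP => p /=; rewrite /conv.
set n := plen p.
pose F i k : K := pa_fun x (ptake i p) * pa_fun y (pdrop i (ptake k p))
                  * pa_fun z (pdrop k p).
transitivity (\sum_(i < n.+1) \sum_(k < n.+1 | (i <= k)%N) F i k).
  apply: eq_bigr => i _; rewrite /= /conv mulr_sumr plen_drop -/n.
  have le_in : (i <= n)%N by rewrite -ltnS.
  rewrite -(big_mkord (fun k => (i <= k)%N) (F i)).
  rewrite -(@big_nat_widenl _ _ _ i 0 n.+1 xpredT) //.
  have -> : \sum_(i <= k < n.+1) F i k = \sum_(0 <= k < (n - i).+1) F i (k + i)%N.
    by rewrite -subSn // -(big_addn 0 n.+1 i xpredT (F i)).
  rewrite big_mkord.
  apply: eq_bigr => j _.
  by rewrite mulrA ptake_drop pdrop_drop (addnC j).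
rewrite (exchange_big_dep xpredT) //=; apply: eq_bigr => k _.
rewrite /conv mulr_suml plen_take -1?ltnS //.
rewrite (big_ord_widen_cond n.+1 xpredT (fun i =>
  pa_fun x (ptake i (ptake k p)) * pa_fun y (pdrop i (ptake k p))
  * pa_fun z (pdrop k p))) //.
by apply: eq_big => [i|i le_ik]; rewrite /F ?ltnS // ptake_take.
Qed.

Lemma pa_mul1l : left_id pa_one pa_mul.
Proof.
move=> x; apply: path_algP => p /=; rewrite /conv big_ord_recl big1.
  by rewrite /unit_fun /= plen_take // eqxx mul1r pdrop0 addr0.
by move=> i _; rewrite /unit_fun plen_take /= ?mul0r // lift0.
Qed.

Lemma pa_mul1r : right_id pa_one pa_mul.
Proof.
move=> x; apply: path_algP => p /=; rewrite /conv big_ord_recr big1 /=.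
  by rewrite /unit_fun plen_drop subnn eqxx mulr1 ptake_size add0r.
by move=> i _; rewrite /unit_fun plen_drop subn_eq0 leqNgt ltn_ord /= mulr0.
Qed.

Lemma pa_mulDl : left_distributive pa_mul +%R.
Proof.
move=> x y z; apply: path_algP => p; rewrite pa_funD /= /conv -big_split /=.
by apply: eq_bigr => i _; rewrite -mulrDl.
Qed.

Lemma pa_mulDr : right_distributive pa_mul +%R.
Proof.
move=> x y z; apply: path_algP => p; rewrite pa_funD /= /conv -big_split /=.
by apply: eq_bigr => i _; rewrite -mulrDr.
Qed.

Lemma pa_one_neq0 : pa_one != 0.
Proof.
have /card_gt0P[v _] := vertex_gt0 Q.
apply/eqP => /(congr1 (fun x => pa_fun x (@QPath Q (v, [::]) isT))) /eqP.
by rewrite /= /unit_fun eqxx oner_eq0.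
Qed.

HB.instance Definition _ := GRing.Zmodule_isNzRing.Build path_alg
  pa_mulA pa_mul1l pa_mul1r pa_mulDl pa_mulDr pa_one_neq0.

Lemma pa_scalerAl (a : K) (x y : path_alg) : a *: (x * y) = (a *: x) * y.
Proof.
apply: path_algP => p; rewrite pa_funZ /= /conv mulr_sumr.
by apply: eq_bigr => i _; rewrite mulrA.
Qed.

HB.instance Definition _ :=
  GRing.Lmodule_isLalgebra.Build K path_alg pa_scalerAl.

Lemma pa_scalerAr (a : K) (x y : path_alg) : a *: (x * y) = x * (a *: y).
Proof.
apply: path_algP => p; rewrite pa_funZ /= /conv mulr_sumr.
by apply: eq_bigr => i _; rewrite mulrCA.
Qed.

HB.instance Definition _ :=
  GRing.Lalgebra_isAlgebra.Build K path_alg pa_scalerAr.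

Lemma pelt_finite (q : qpath Q) :
  (fun p => (p == q)%:R : K^o) \in finite_support.
Proof. by apply/finite_supportP; exists [:: q] => p; rewrite inE => /negPf->. Qed.

Definition pelt (q : qpath Q) : path_alg := PathAlg (pelt_finite q).

End PathAlgebra.

Definition sums_of (V : zmodType) (X : set V) : set V :=
  [set x | exists s : seq V, (forall y, y \in s -> X y) /\ x = \sum_(y <- s) y].

Section Ideals.
Variable R : nzRingType.

Definition ideal_gen (X : set R) : set R :=
  sums_of [set z | exists a x b, X x /\ z = a * x * b].

Fixpoint ideal_pow (J : set R) (n : nat) : set R :=
  if n is n'.+1 then
    sums_of [set z | exists x y, [/\ J x, ideal_pow J n' y & z = x * y]]
  else setT.

End Ideals.

Section Presentations.
Variables (K : fieldType) (Q : quiver).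
Local Notation KQ := (path_alg K Q).

Definition arrow_ideal : set KQ :=
  ideal_gen [set x | exists2 p : qpath Q, plen p = 1%N & x = pelt K p].

Definition admissible (I : set KQ) : Prop :=
  exists N, [/\ (2 <= N)%N, ideal_pow arrow_ideal N `<=` I
                          & I `<=` ideal_pow arrow_ideal 2].

Definition len_homogeneous (n : nat) : set KQ :=
  [set x | forall p, pa_fun x p != 0 -> plen p = n].

Definition len_homogeneous_ideal (I : set KQ) : Prop :=
  exists X : set KQ, (forall x, X x -> exists n, len_homogeneous n x)
                     /\ I = ideal_gen X.

Definition monomial_ideal (I : set KQ) : Prop :=
  exists X : set (qpath Q), I = ideal_gen (@pelt K Q @` X).

(* [L] stands for KQ/I, with [phi] the canonical projection. *)
Definition is_quotient (I : set KQ) (L : algType K) (phi : {lrmorphism KQ -> L}) :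
    Prop :=
  (forall y, exists x, phi x = y) /\ (forall x, phi x = 0 <-> I x).

Definition len_grading (L : algType K) (phi : {lrmorphism KQ -> L}) (n : nat) :
    set L :=
  phi @` len_homogeneous n.

End Presentations.

Definition direct_sum (T : eqType) (V : zmodType) (G : T -> set V) : Prop :=
  [/\ forall i, G i 0 /\ (forall x y, G i x -> G i y -> G i (x - y)),
      forall x, exists (s : seq T) (f : T -> V),
        [/\ uniq s, forall i, G i (f i) & x = \sum_(i <- s) f i]
    & forall (s : seq T) (f : T -> V), uniq s -> (forall i, G i (f i)) ->
        \sum_(i <- s) f i = 0 -> forall i, i \in s -> f i = 0].

Definition algebra_grading (K : fieldType) (B : algType K) (G : nat -> set B) :
    Prop :=
  [/\ direct_sum G,
      forall n (a : K) x, G n x -> G n (a *: x)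
    & forall m n x y, G m x -> G n y -> G (m + n)%N (x * y)].

(* The ideal of elements of positive degree; for the length grading of a
   quotient by an admissible homogeneous ideal it is the graded radical. *)
Definition pos_part (B : nzRingType) (G : nat -> set B) : set B :=
  sums_of [set x | exists2 n, (0 < n)%N & G n x].

(* Right B-modules are left modules over the converse ring [B^c]. *)
Definition ract (B : nzRingType) (M : lmodType B^c) (x : M) (b : B) : M :=
  (b : B^c) *: x.

Definition projective (R : nzRingType) (M : lmodType R) : Prop :=
  forall (X Y : lmodType R) (g : {linear X -> Y}) (f : {linear M -> Y}),
    (forall y, exists x, g x = y) ->
    exists h : {linear M -> X}, forall m, g (h m) = f m.

Record resolution (R : nzRingType) (M : lmodType R) := Resolution {
  res_obj :> nat -> lmodType R;
  res_d : forall n, {linear res_obj n.+1 -> res_obj n};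
  res_eps : {linear res_obj 0%N -> M};
  res_proj : forall n, projective (res_obj n);
  res_eps_surj : forall y, exists x, res_eps x = y;
  res_exact0 : forall x, res_eps x = 0 <-> exists z, x = res_d 0 z;
  res_exact : forall n x, res_d n x = 0 <-> exists z, x = res_d n.+1 z }.

Definition projdim_le (R : nzRingType) (M : lmodType R) (m : nat) : Prop :=
  exists P : resolution M, forall n, (m < n)%N -> forall x : P n, x = 0.

Definition gldim_le (R : nzRingType) (m : nat) : Prop :=
  forall M : lmodType R, projdim_le M m.

(* [n] is at most the (possibly infinite) global dimension of [R]. *)
Definition le_gldim (R : nzRingType) (n : nat) : Prop :=
  forall m, gldim_le R m -> (n <= m)%N.

Section GradedModules.
Variables (B : nzRingType) (G : nat -> set B).

Definition module_grading (M : lmodType B^c) (H : int -> set M) : Prop :=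
  direct_sum H /\
  (forall i n x b, H i x -> G n b -> H (i + n%:Z) (ract x b)).

Definition generated_in (M : lmodType B^c) (H : int -> set M) (k : int) : Prop :=
  forall x, sums_of [set y | exists u b, H k u /\ y = ract u b] x.

(* [S] is the right module B / B_+, i.e. the degree zero part of [B]. *)
Definition is_degree0_module (S : lmodType B^c) (pi : {linear (B^c)^o -> S}) :
    Prop :=
  (forall y, exists x, pi x = y) /\ (forall x, pi x = 0 <-> pos_part G x).

(* The gradings [H] make [P] a graded resolution of [S], with [S] placed in
   degree 0; minimality is im d contained in P B_+. *)
Definition minimal_graded (S : lmodType B^c) (P : resolution S)
    (H : forall n, int -> set (P n)) : Prop :=
  [/\ forall n, module_grading (H n),
      forall n i x, H n.+1 i x -> H n i (res_d P n x),
      forall i x, H 0%N i x -> i != 0 -> res_eps P x = 0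
    & forall n x, sums_of [set y | exists u b, pos_part G b /\ y = ract u b]
                    (res_d P n x)].

End GradedModules.

Definition delta (D A n : nat) : nat :=
  if n == 0%N then 0%N else if n == 1%N then 1%N
  else if odd n then ((n.-1)./2 * D + A)%N else (n./2 * D)%N.

(* The condition on the projectives in the definition of a (D,A)-stacked
   algebra, read on a minimal graded resolution [P] with gradings [H]. *)
Definition stacked (D A : nat) (B : nzRingType) (S : lmodType B^c)
    (P : resolution S) (H : forall n, int -> set (P n)) : Prop :=
  forall n, le_gldim B^c n -> generated_in (H n) (delta D A n)%:Z.

Section Koszul.
Variables (K : fieldType) (B : algType K) (G : nat -> set B).

Definition degree0_split : Prop :=
  exists (m : nat) (f : {rmorphism {ffun 'I_m -> K} -> B}),
    [/\ forall (a : K) (u : {ffun 'I_m -> K}), f [ffun i => a * u i] = a *: f u,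
        injective f & G 0%N = range f].

Definition koszul : Prop :=
  [/\ algebra_grading G, degree0_split
    & exists (S : lmodType B^c) (pi : {linear (B^c)^o -> S})
             (P : resolution S) (H : forall n, int -> set (P n)),
        [/\ is_degree0_module G pi, minimal_graded G H
          & forall n, generated_in (H n) n%:Z]].

End Koszul.

Section Ext.
Variables (K : fieldType) (B : algType K) (S : lmodType B^c) (P : resolution S).

Definition cocycle (n : nat) (f : {linear P n -> S}) : Prop :=
  forall x, f (res_d P n x) = 0.

Definition coboundary (n : nat) : {linear P n -> S} -> Prop :=
  if n is n'.+1 then
    fun f => exists g : {linear P n' -> S}, forall x, f x = g (res_d P n' x)
  else fun f => forall x, f x = 0.

(* A chain map of degree -n lifting [g] along the augmentation. *)
Definition lifting (n : nat) (g : {linear P n -> S})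
    (l : forall k, {linear P (k + n)%N -> P k}) : Prop :=
  (forall x, res_eps P (l 0%N x) = g x) /\
  (forall k x, res_d P k (l k.+1 x) = l k (res_d P (k + n)%N x)).

(* [E] is the direct sum of the H^n(Hom_B(P, S)) = Ext^n_B(S, S) with the
   Yoneda product; [cls n f] is the class of the cocycle [f], and its value on
   other maps is irrelevant. These conditions determine [E] up to a unique
   isomorphism compatible with [cls]. The field acts on S through K.1. *)
Record is_ext_algebra (E : algType K)
    (cls : forall n, {linear P n -> S} -> E) : Prop := IsExtAlgebra {
  ext_clsD : forall n (f g h : {linear P n -> S}), cocycle f -> cocycle g ->
    (forall x, h x = f x + g x) -> cls n h = cls n f + cls n g;
  ext_clsZ : forall n (a : K) (f h : {linear P n -> S}), cocycle f ->
    (forall x, h x = ract (f x) a%:A) -> cls n h = a *: cls n f;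
  ext_cls_eq0 : forall n (f : {linear P n -> S}), cocycle f ->
    (cls n f = 0 <-> coboundary f);
  ext_direct : direct_sum (fun n => cls n @` @cocycle n);
  ext_yoneda : forall m n (f : {linear P m -> S}) (g : {linear P n -> S})
      (l : forall k, {linear P (k + n)%N -> P k}) (h : {linear P (m + n)%N -> S}),
    cocycle f -> cocycle g -> lifting g l -> (forall x, h x = f (l m x)) ->
    cls (m + n)%N h = cls m f * cls n g }.

Definition ext_part (E : algType K) (cls : forall n, {linear P n -> S} -> E)
    (n : nat) : set E :=
  cls n @` @cocycle n.

(* Each piece of the new grading is a sum, automatically direct, of some of the
   spaces Ext^i. *)
Definition regrading (E : algType K) (cls : forall n, {linear P n -> S} -> E)
    (Ehat : nat -> set E) : Prop :=
  algebra_grading Ehat /\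
  (forall n, exists T : set nat,
     Ehat n = sums_of [set x | exists2 i, T i & ext_part cls i x]).

End Ext.

(* Main.v *)
(* Over a monomial algebra the minimal resolution of [L0] has a basis of chains,
   paths obtained by overlapping relations. In the stacked case two overlapping
   relations start at a distance divisible by [A], and the intermediate paths at
   multiples of [A] are relations too; hence the [n]-chains are exactly the paths
   of length [delta D A n] whose subpaths of length [D] at multiples of [A] are all
   zero. The classes of the chains form a basis of the Ext algebra, and the product
   of two of them is their concatenation, in the opposite order, if that is a chain
   and [0] otherwise. So the Ext algebra is generated over its degree [0] part by
   the chains of degree 2 (1 if [D = 2]) together with those of degree 1 and, if
   [A <> 1], of degree 3. All these generators get the new degree 1. A product of
   two odd generators has the wrong length to be a chain: for two of degree 3 the
   length [2 (D + A)] would have to be [3 D], i.e. [D = 2 A]. The remaining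
   relations are monomial, except that an odd generator is moved past an even one,
   so that words in the generators have a normal form.

   Both the resolution over the algebra and the linear one over its Ext algebra
   are instances of one construction: the generators in degree [n] are the
   admissible words of length [n] in a set of letters, and deleting the first
   letter of a coefficient gives a contracting homotopy. *)

Require Import Defs.
From HB Require Import structures.
From mathcomp Require Import all_boot all_order all_algebra.
From mathcomp Require Import boolp classical_sets functions.
From mathcomp Require Import zify.
Import GRing.Theory.
Local Open Scope ring_scope.

Set Implicit Arguments.
Unset Strict Implicit.
Unset Printing Implicit Defensive.

(** * Direct sums and bases *)

(** The hypotheses speak only of degrees in a given minimal resolution [P], and the Ext algebra is
    given by classes of maps out of that [P]. Chains enter through comparison maps between [P] and
    the chain resolution: minimality makes both composites the identity modulo the radical, so
    degrees of generators become lengths of paths, and maps to [L0], which do not see the radical,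
    carry the dual basis of chains to the Ext algebra. All knowledge about relations comes from
    these lengths: the length [D] of 2-chains says that every zero path contains a zero subpath of
    length [D], and the length [D + A] of 3-chains says that an overlap at distance [j] yields one
    at distance [A]. The Ext algebra is not monomial, because an odd generator passes an even one.
    Hence the differential of the word construction carries a correction [kap] besides the last
    letter; it is zero for the algebra itself. Two corrections multiply to 0 since each is an odd
    generator. Besides the additivity of the regrading, this is what [D <> 2 * A] is for. *)

Definition mklin (R : nzRingType) (U V : lmodType R) (f : U -> V)
    (lin_f : linear f) : {linear U -> V} :=
  HB.pack f (GRing.isLinear.Build R U V *:%R f lin_f).

Lemma sums_of_ind (V : zmodType) (X C : set V) x :
  C 0 -> (forall y z, C y -> C z -> C (y + z)) -> (forall y, X y -> C y) ->
  sums_of X x -> C x.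
Proof.
move=> C0 CD XC [s [sX ->]]; rewrite big_seq.
by apply: (big_ind C) => // y /sX /XC.
Qed.

Lemma sums_of_in (V : zmodType) (X : set V) x : X x -> sums_of X x.
Proof. by move=> Xx; exists [:: x]; rewrite big_seq1; split=> // y /[!inE] /eqP->. Qed.

Lemma sums_of0 (V : zmodType) (X : set V) : sums_of X 0.
Proof. by exists [::]; rewrite big_nil. Qed.

Lemma sums_ofD (V : zmodType) (X : set V) x y :
  sums_of X x -> sums_of X y -> sums_of X (x + y).
Proof.
move=> [s [sX ->]] [t [tX ->]]; exists (s ++ t); rewrite big_cat; split=> //.
by move=> z; rewrite mem_cat => /orP[/sX|/tX].
Qed.

Lemma sums_of_sum (V : zmodType) (X : set V) (I : Type) (r : seq I) (P : pred I) F :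
  (forall i, P i -> sums_of X (F i)) -> sums_of X (\sum_(i <- r | P i) F i).
Proof. by apply: big_ind => [|x y]; [apply: sums_of0|apply: sums_ofD]. Qed.

Lemma sums_ofZ (R : nzRingType) (V : lmodType R) (X : set V) (c : R) x :
  (forall y, X y -> X (c *: y)) -> sums_of X x -> sums_of X (c *: x).
Proof.
move=> XZ [s [sX ->]]; rewrite scaler_sumr big_seq; apply: sums_of_sum => y sy.
by apply/sums_of_in/XZ/sX.
Qed.

Section DirectSum.
Variables (T : eqType) (V : zmodType) (G : T -> set V).
Hypothesis dG : direct_sum G.

Lemma direct_sum0 i : G i 0. Proof. by case: dG => h _ _; case: (h i). Qed.

Lemma direct_sumB i x y : G i x -> G i y -> G i (x - y).
Proof. by case: dG => h _ _; case: (h i) => _; apply. Qed.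

Lemma direct_sumN i x : G i x -> G i (- x).
Proof. by move=> Gx; rewrite -sub0r; apply: direct_sumB => //; apply: direct_sum0. Qed.

Lemma direct_sumD i x y : G i x -> G i y -> G i (x + y).
Proof. by move=> Gx Gy; rewrite -[y]opprK; apply/direct_sumB/direct_sumN. Qed.

(** Subtracting [x] in degree [k] from the decomposition leaves a vanishing sum of homogeneous
    terms, and directness kills each of them. *)
Lemma direct_sum_component k x (s : seq T) (g : T -> V) :
  G k x -> uniq s -> (forall i, G i (g i)) -> x = \sum_(i <- s) g i ->
  x = if k \in s then g k else 0.
Proof.
move=> Gx us Gg def_x; case: dG => _ _ free.
pose f i := g i - (if i == k then x else 0).
have Gf i : G i (f i).
  apply: direct_sumB => //; case: eqP => [->//|_]; exact: direct_sum0.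
case: ifP => ks.
  have sf0 : \sum_(i <- s) f i = 0.
    rewrite sumrB -def_x -big_mkcond /= -big_filter.
    by rewrite filter_pred1_uniq // big_seq1 subrr.
  have /eqP := free s f us Gf sf0 k ks.
  by rewrite /f eqxx subr_eq0 => /eqP.
have usk : uniq (k :: s) by rewrite /= ks.
pose f' i := if i == k then - x else g i.
have Gf' i : G i (f' i).
  by rewrite /f'; case: eqP => [->|_ //]; apply: direct_sumN.
have sf0 : \sum_(i <- k :: s) f' i = 0.
  rewrite big_cons {1}/f' eqxx [X in _ + X](_ : _ = x) ?addNr //.
  rewrite [RHS]def_x; apply: eq_big_seq => i is_; rewrite /f'.
  by case: eqP => // ik; rewrite ik ks in is_.
have := free _ _ usk Gf' sf0 k (mem_head _ _).
by rewrite /f' eqxx => /eqP; rewrite oppr_eq0 => /eqP.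
Qed.

End DirectSum.

Section Bases.
Variables (K : fieldType) (B : lmodType K) (I : choiceType) (b : I -> B).

(** Stated with finite duplicate-free lists because the Ext algebra may have infinite dimension. *)
Definition is_basis : Prop :=
  (forall y, exists s (c : I -> K), uniq s /\ y = \sum_(i <- s) c i *: b i) /\
  (forall s (c : I -> K), uniq s -> \sum_(i <- s) c i *: b i = 0 ->
     forall i, i \in s -> c i = 0).

Hypothesis bP : is_basis.

(** An expansion of each vector is chosen. Uniqueness of coefficients over a list containing the
    supports of [x], [y] and [a *: x + y] makes the chosen coordinates linear. *)
Lemma basis_coord : exists c : I -> B -> K,
  [/\ forall i, linear (c i : B -> K^o), forall i j, c i (b j) = (i == j)%:R
    & forall y, exists s, [/\ uniq s, forall i, i \notin s -> c i y = 0
                             & y = \sum_(i <- s) c i y *: b i]].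
Proof.
case: bP => span free.
have /choice [S SP] : forall y, exists sc : seq I * (I -> K),
    uniq sc.1 /\ y = \sum_(i <- sc.1) sc.2 i *: b i.
  by move=> y; have [s [c h]] := span y; exists (s, c).
pose c i y := if i \in (S y).1 then (S y).2 i else 0.
have c_out i y : i \notin (S y).1 -> c i y = 0 by rewrite /c => /negPf->.
have cS y : y = \sum_(i <- (S y).1) c i y *: b i.
  have [_ {1}->] := SP y; apply: eq_big_seq => i is_; by rewrite /c is_.
have c_sub y t : uniq t -> {subset (S y).1 <= t} ->
    y = \sum_(i <- t) c i y *: b i.
  move=> ut st; rewrite {1}[y]cS.
  rewrite [RHS](bigID (fun i => i \in (S y).1) xpredT) /=.
  rewrite [X in _ = _ + X]big1 ?addr0; last first.
    by move=> i /c_out->; rewrite scale0r.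
  rewrite -[in RHS]big_filter; apply: perm_big; apply: uniq_perm.
  - by case: (SP y).
  - exact: filter_uniq.
  by move=> i; rewrite mem_filter; case: (boolP (i \in (S y).1)) => // /st.
have uniq_c t (f : I -> K) y : uniq t -> {subset (S y).1 <= t} ->
    y = \sum_(i <- t) f i *: b i -> forall i, i \in t -> c i y = f i.
  move=> ut st def_y i it; apply/eqP; rewrite -subr_eq0; apply/eqP.
  apply: (free t (fun j => c j y - f j)) => //.
  under eq_bigr do rewrite scalerBl.
  by rewrite sumrB -c_sub // -def_y subrr.
exists c; split=> [i a x y|i j|y].
- set z := a *: x + y.
  pose t := undup (i :: (S x).1 ++ (S y).1 ++ (S z).1).
  have ut : uniq t by rewrite undup_uniq.
  have tx : {subset (S x).1 <= t}.
    by move=> k kx; rewrite mem_undup inE !mem_cat kx orbT.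
  have ty : {subset (S y).1 <= t}.
    by move=> k kx; rewrite mem_undup inE !mem_cat kx !orbT.
  have tz : {subset (S z).1 <= t}.
    by move=> k kx; rewrite mem_undup inE !mem_cat kx !orbT.
  apply: (uniq_c t (fun i => a * c i x + c i y)) => //.
    rewrite /z {1}(c_sub x t ut tx) {1}(c_sub y t ut ty) scaler_sumr.
    by rewrite -big_split; apply: eq_bigr => k _; rewrite scalerDl scalerA.
  by rewrite mem_undup inE eqxx.
- pose t := undup (i :: j :: (S (b j)).1).
  have ut : uniq t by rewrite undup_uniq.
  apply: (uniq_c t (fun i => (i == j)%:R)) => //.
  + by move=> k kx; rewrite mem_undup !inE kx !orbT.
  + rewrite (bigD1_seq j) //=; last by rewrite mem_undup !inE eqxx orbT.
    rewrite eqxx scale1r big1 ?addr0 // => k /negPf->; by rewrite scale0r.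
  + by rewrite mem_undup inE eqxx.
- by exists (S y).1; split=> // [|i]; [case: (SP y)|exact: c_out].
Qed.

(** Deletions, projections to degrees and augmentations are all obtained by prescribing values on
    paths or chains through this extension. *)
Lemma basis_ext (V : lmodType K) (F : I -> V) :
  exists f : {linear B -> V}, forall i, f (b i) = F i.
Proof.
have [c [c_lin c_b cP]] := basis_coord.
have c_D i x y : c i (x + y) = c i x + c i y.
  by have := c_lin i 1 x y; rewrite !scale1r.
have /choice [S SP] := cP.
pose f y := \sum_(i <- S y) c i y *: F i.
have f_sub y t : uniq t -> {subset S y <= t} -> f y = \sum_(i <- t) c i y *: F i.
  have [us out _] := SP y; move=> ut st.
  rewrite [RHS](bigID (fun i => i \in S y) xpredT) /=.
  rewrite [X in _ = _ + X]big1 ?addr0; last first.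
    by move=> i /out->; rewrite scale0r.
  rewrite -[in RHS]big_filter; apply: perm_big; apply: uniq_perm => //.
    exact: filter_uniq.
  by move=> i; rewrite mem_filter; case: (boolP (i \in S y)) => // /st.
have f_lin : linear f.
  move=> a x y; set z := a *: x + y; pose t := undup (S x ++ S y ++ S z).
  have ut : uniq t by rewrite undup_uniq.
  rewrite (f_sub x t) // ?(f_sub y t) // ?(f_sub z t) //;
    try by move=> k kx; rewrite mem_undup !mem_cat kx ?orbT.
  rewrite scaler_sumr -big_split /=; apply: eq_bigr => i _.
  have -> : c i z = a * c i x + c i y by apply: c_lin.
  by rewrite scalerDl scalerA.
exists (mklin f_lin) => i /=.
rewrite (f_sub _ (undup (i :: S (b i)))) ?undup_uniq //; last first.
  by move=> k kx; rewrite mem_undup inE kx orbT.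
rewrite (bigD1_seq i) ?undup_uniq ?mem_undup ?mem_head //= c_b eqxx scale1r.
by rewrite big1 ?addr0 // => k /negPf ki; rewrite c_b ki scale0r.
Qed.

End Bases.

(** * Right modules of columns *)

Section Ract.
Variables (B : nzRingType) (M : lmodType B^c).
Implicit Types (x y : M) (a b : B).

Lemma scale_ract (a : B^c) x : a *: x = ract x a.
Proof. by []. Qed.

Lemma ractDl x y b : ract (x + y) b = ract x b + ract y b.
Proof. exact: scalerDr. Qed.

Lemma ractDr x a b : ract x (a + b) = ract x a + ract x b.
Proof. exact: scalerDl. Qed.

Lemma ractA x a b : ract (ract x a) b = ract x (a * b).
Proof. by rewrite /ract scalerA. Qed.

Lemma ract0l b : ract (0 : M) b = 0.
Proof. exact: scaler0. Qed.

Lemma ract0r x : ract x (0 : B) = 0.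
Proof. exact: scale0r. Qed.

Lemma ract_suml (I : Type) (r : seq I) (P : pred I) (F : I -> M) b :
  ract (\sum_(i <- r | P i) F i) b = \sum_(i <- r | P i) ract (F i) b.
Proof. exact: scaler_sumr. Qed.

Lemma ract_sumr (I : Type) (r : seq I) (P : pred I) (F : I -> B) x :
  ract x (\sum_(i <- r | P i) F i) = \sum_(i <- r | P i) ract x (F i).
Proof. exact: scaler_suml. Qed.

Lemma linear_ract (N : lmodType B^c) (f : {linear M -> N}) x b :
  f (ract x b) = ract (f x) b.
Proof. exact: linearZ. Qed.

End Ract.

Lemma ract_reg (B : nzRingType) (x y : B) : ract (x : (B^c)^o) y = x * y.
Proof. by rewrite /ract. Qed.

Section Columns.
Variables (B : nzRingType) (W : finType) (e : W -> B).

Definition col_pred : {pred {ffun W -> (B^c)^o}} :=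
  [pred f : {ffun W -> (B^c)^o} | [forall w, e w * (f w : B) == f w]].

Lemma col_predP (f : {ffun W -> (B^c)^o}) :
  reflect (forall w, e w * (f w : B) = f w) (f \in col_pred).
Proof. by rewrite inE; apply: (iffP forallP) => h w; apply/eqP/h. Qed.

Lemma col_submod : submod_closed col_pred.
Proof.
split; first by apply/col_predP => w; rewrite ffunE mulr0.
move=> a f g /col_predP hf /col_predP hg; apply/col_predP => w; rewrite !ffunE.
by rewrite mulrDr hg -[a *: f w]/((f w : B) * a) mulrA hf.
Qed.

HB.instance Definition _ :=
  GRing.isSubmodClosed.Build B^c {ffun W -> (B^c)^o} col_pred col_submod.

(* The projective right module [\bigoplus_w e_w B]. *)
Record column := Column {
  col_fun : {ffun W -> (B^c)^o};
  col_funP : col_fun \in col_pred }.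

HB.instance Definition _ := [isSub for col_fun].
HB.instance Definition _ := [Choice of column by <:].
HB.instance Definition _ := [SubChoice_isSubLmodule of column by <:].

Definition cev (f : column) (w : W) : B := col_fun f w.

Lemma columnP (f g : column) : cev f =1 cev g -> f = g.
Proof. by move=> fg; apply/val_inj/ffunP. Qed.

Lemma cevD f g w : cev (f + g) w = cev f w + cev g w.
Proof. by rewrite /cev -[col_fun (f + g)]/(col_fun f + col_fun g) ffunE. Qed.

Lemma cev0 w : cev 0 w = 0.
Proof. by rewrite /cev ffunE. Qed.

Lemma cevN f w : cev (- f) w = - cev f w.
Proof. by apply/eqP; rewrite -addr_eq0 -cevD addNr cev0. Qed.

Lemma cevB f g w : cev (f - g) w = cev f w - cev g w.
Proof. by rewrite cevD cevN. Qed.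

Lemma cev_sum (I : Type) (r : seq I) (P : pred I) (F : I -> column) w :
  cev (\sum_(i <- r | P i) F i) w = \sum_(i <- r | P i) cev (F i) w.
Proof. by apply: (big_morph (cev^~ w) (fun f g => cevD f g w) (cev0 w)). Qed.

Lemma cev_ract f b w : cev (ract f b) w = cev f w * b.
Proof. by rewrite /cev /ract /= ffunE. Qed.

Lemma cev_e f w : e w * cev f w = cev f w.
Proof. by have /col_predP := col_funP f; apply. Qed.

Lemma mkcol_subproof (f : W -> B) : (forall w, e w * f w = f w) ->
  [ffun w => f w : (B^c)^o] \in col_pred.
Proof. by move=> h; apply/col_predP => w; rewrite ffunE. Qed.

Definition mkcol f h : column := Column (@mkcol_subproof f h).

Lemma cev_mkcol f h w : cev (@mkcol f h) w = f w.
Proof. by rewrite /cev ffunE. Qed.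

Hypothesis e_idem : forall w, e w * e w = e w.

Definition cgen_fun w0 w : B := if w == w0 then e w0 else 0.

Lemma cgen_subproof w0 w : e w * cgen_fun w0 w = cgen_fun w0 w.
Proof. by rewrite /cgen_fun; case: eqP => [->|_]; rewrite ?mulr0 ?e_idem. Qed.

Definition cgen w : column := mkcol (cgen_subproof w).

Lemma cev_gen w0 w : cev (cgen w0) w = if w == w0 then e w0 else 0.
Proof. by rewrite cev_mkcol. Qed.

Lemma cgen_e w : ract (cgen w) (e w) = cgen w.
Proof.
apply: columnP => w'; rewrite cev_ract cev_gen.
by case: eqP; rewrite ?mul0r.
Qed.

Lemma column_sum f : f = \sum_w ract (cgen w) (cev f w).
Proof.
apply: columnP => w; rewrite cev_sum (bigD1 w) //= cev_ract cev_gen eqxx cev_e.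
rewrite big1 ?addr0 // => w' /negPf ww'.
by rewrite cev_ract cev_gen eq_sym ww' mul0r.
Qed.

Section Map.
Variables (M : lmodType B^c) (x : W -> M).

Definition colmap_fun (f : column) : M := \sum_w ract (x w) (cev f w).

Lemma colmap_linear : linear colmap_fun.
Proof.
move=> a f g; rewrite /colmap_fun -[a *: f]/(ract f a).
transitivity (ract (\sum_w ract (x w) (cev f w)) a
              + \sum_w ract (x w) (cev g w)); last by [].
rewrite ract_suml -big_split /=.
by apply: eq_bigr => w _; rewrite cevD ractDr cev_ract ractA.
Qed.

Definition colmap : {linear column -> M} := mklin colmap_linear.

Lemma colmapE f : colmap f = \sum_w ract (x w) (cev f w). Proof. by []. Qed.

Lemma colmap_gen w : ract (x w) (e w) = x w -> colmap (cgen w) = x w.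
Proof.
move=> xw; rewrite colmapE (bigD1 w) //= cev_gen eqxx xw big1 ?addr0 // => w'.
by rewrite cev_gen => /negPf->; rewrite ract0r.
Qed.

End Map.

Lemma column_linear_eq (M : lmodType B^c) (f g : {linear column -> M}) :
  (forall w, f (cgen w) = g (cgen w)) -> f =1 g.
Proof.
move=> fg x; rewrite [x]column_sum !linear_sum; apply: eq_bigr => w _.
by rewrite !linear_ract fg.
Qed.

Lemma column_projective : projective column.
Proof.
move=> X Y g f g_surj.
have /choice [y yP] : forall w, exists y, g y = f (cgen w) by move=> w; apply: g_surj.
exists (colmap (fun w => ract (y w) (e w))) => m.
rewrite colmapE linear_sum {2}[m]column_sum linear_sum; apply: eq_bigr => w _.
by rewrite !linear_ract yP ractA cev_e.
Qed.

End Columns.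

(** * Resolutions with a basis of words *)

Section Words.
Variables (V X : finType) (nxt : V + X -> X -> bool).

(* Words of length [n + 1] are words of length [n] with an admissible letter
   appended; admissibility depends on the last state only, so the type of words
   is built together with the map to the last state. *)
Fixpoint word_state (n : nat) : {T : finType & T -> V + X} :=
  if n is n'.+1 then
    existT (fun T : finType => T -> (V + X)%type)
      {p : projT1 (word_state n') * X | nxt (projT2 (word_state n') p.1) p.2}
      (fun p => inr (sval p).2)
  else existT (fun T : finType => T -> (V + X)%type) V (fun v => inl v).

Definition word n : finType := projT1 (word_state n).
Definition wlast n : word n -> V + X := projT2 (word_state n).
Definition wpre n (p : word n.+1) : word n := (sval p).1.
Definition wlet n (p : word n.+1) : X := (sval p).2.
Definition wsnoc n (w : word n) x (h : nxt (wlast w) x) : word n.+1 :=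
  exist _ (w, x) h.

Lemma wlastS n (p : word n.+1) : wlast p = inr (wlet p). Proof. by []. Qed.

Lemma wlet_nxt n (p : word n.+1) : nxt (wlast (wpre p)) (wlet p).
Proof. exact: (svalP p). Qed.

Lemma word_inj n (p q : word n.+1) : wpre p = wpre q -> wlet p = wlet q -> p = q.
Proof.
case: p q => [[w x] h] [[w' x'] h']; rewrite /wpre /wlet /= => ww xx.
by apply: val_inj; rewrite /= ww xx.
Qed.

Lemma sum_word (M : nmodType) n (w : word n) (F : X -> M) :
  \sum_(p : word n.+1 | wpre p == w) F (wlet p) = \sum_(x | nxt (wlast w) x) F x.
Proof.
rewrite (partition_big (@wlet n) (fun x => nxt (wlast w) x)) /=; last first.
  by move=> p /eqP <-; apply: wlet_nxt.
apply: eq_bigr => x wx; by rewrite (big_pred1 (wsnoc wx)).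
Qed.

End Words.

Section WordResolution.
Variables (B : nzRingType) (V X : finType) (e : V -> B) (b : X -> B).
Variables (src tgt : X -> V) (nxt : V + X -> X -> bool).
Variables (kap : X -> X -> X -> B) (D : X -> B -> B).
Variables (S : lmodType B^c) (pi : {linear (B^c)^o -> S}).

Definition send (s : V + X) : V := match s with inl v => v | inr x => tgt x end.

(* [D x] deletes the initial letter [x]; it gives the contracting homotopy
   [w]y |-> \sum_x [wx](D x y).  The coefficients [kap] express a product of
   letters [z x] that is not in normal form as a combination of the others. *)
Record word_axioms : Prop := WordAxioms {
  wx_orth : forall v v', e v * e v' = if v == v' then e v else 0;
  wx_sum : \sum_v e v = 1;
  wx_src : forall x, e (src x) * b x = b x;
  wx_tgt : forall x, b x * e (tgt x) = b x;
  wx_nxt : forall s x, nxt s x -> src x = send s;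
  wx_kap_src : forall z r x, e (tgt r) * kap z r x = kap z r x;
  wx_DD : forall x y y', D x (y + y') = D x y + D x y';
  wx_Dsrc : forall x y, e (tgt x) * D x y = D x y;
  wx_hom0 : forall v y, e v * y = y -> pi y = 0 ->
    \sum_(x | nxt (inl v) x) b x * D x y = y;
  wx_hom : forall s x z y, nxt s z -> nxt s x -> e (tgt z) * y = y ->
    D x (b z * y)
    + (if x == z then \sum_(x' | nxt (inr z) x') b x' * D x' y else 0)
    - \sum_(x' | nxt (inr z) x') kap z x x' * D x' y = if x == z then y else 0;
  wx_hom' : forall z r x x' y, nxt (inr z) x' -> nxt (inr r) x ->
    e (tgt x') * y = y -> D x (kap z r x' * y) = 0;
  wx_kap : forall s z x, nxt s z -> nxt (inr z) x ->
    b z * b x = \sum_(r | nxt s r) b r * kap z r x;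
  wx_kapb : forall z r x x', nxt (inr z) x -> nxt (inr x) x' ->
    kap z r x * b x' = 0;
  wx_kapk : forall z r x r' x', nxt (inr z) x -> nxt (inr z) r' ->
    nxt (inr x) x' -> kap z r r' * kap x r' x' = 0;
  wx_surj : forall y, exists x, pi x = y;
  wx_pib : forall x, pi (b x) = 0;
  wx_pie : forall v y, pi y = 0 -> pi (e v * y : B) = 0 }.

Hypothesis ax : word_axioms.

Local Notation word := (word nxt).
Definition we n (w : word n) : B := e (send (wlast w)).
Local Notation M := (fun n => column (@we n)).

(** The generator of a word ending in [z x] goes to the generator without [x], times [b x], minus
    the generators with [z x] replaced by the single letter [r], times [kap z r x]. One degree lower
    the subtracted part cancels [b z * b x]. A word of length 1 has no pair of letters, hence the
    value 0. *)
Definition wcorr n : (word n.+1 -> B) -> word n -> B :=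
  match n with
  | 0 => fun f w => 0
  | n'.+1 => fun f w => \sum_(p | wpre (wpre p) == wpre w)
                          kap (wlet (wpre p)) (wlet w) (wlet p) * f p
  end.

Lemma wcorrS n (f : word n.+2 -> B) (w : word n.+1) :
  wcorr f w = \sum_(p | wpre (wpre p) == wpre w)
                kap (wlet (wpre p)) (wlet w) (wlet p) * f p.
Proof. by []. Qed.

Definition wd_fun n (f : word n.+1 -> B) (w : word n) : B :=
  \sum_(p | wpre p == w) b (wlet p) * f p - wcorr f w.

Lemma we_idem n (w : word n) : we w * we w = we w.
Proof. by rewrite /we wx_orth // eqxx. Qed.

Lemma we_b n (p : word n.+1) : we (wpre p) * b (wlet p) = b (wlet p).
Proof. by rewrite /we -(wx_nxt ax (wlet_nxt p)) wx_src. Qed.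

Lemma b_we n (p : word n.+1) : b (wlet p) * we p = b (wlet p).
Proof. by rewrite /we wlastS /= wx_tgt. Qed.

Lemma wd_subproof n (f : word n.+1 -> B) w : we w * wd_fun f w = wd_fun f w.
Proof.
rewrite mulrBr mulr_sumr; congr (_ - _).
  by apply: eq_bigr => p /eqP <-; rewrite mulrA we_b.
case: n f w => [|n] f w; first by rewrite mulr0.
rewrite /= mulr_sumr; apply: eq_bigr => p _.
by rewrite mulrA /we wlastS wx_kap_src.
Qed.

Definition wd_raw n (f : M n.+1) : M n := mkcol (wd_subproof (cev f)).

Lemma wd_linear n : linear (@wd_raw n).
Proof.
move=> a f g; apply: columnP => w; rewrite !scale_ract.
rewrite cevD cev_ract !cev_mkcol /wd_fun mulrBl mulr_suml addrACA -opprD.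
rewrite -big_split /=; congr (_ - _).
  by apply: eq_bigr => p _; rewrite cevD cev_ract mulrDr mulrA.
case: n f g w => [|n] f g w /=; first by rewrite mul0r addr0.
rewrite mulr_suml -big_split /=; apply: eq_bigr => p _.
by rewrite cevD cev_ract mulrDr mulrA.
Qed.

Definition wd n : {linear M n.+1 -> M n} := mklin (@wd_linear n).

Lemma cev_wd n (f : M n.+1) w : cev (wd n f) w = wd_fun (cev f) w.
Proof. by rewrite cev_mkcol. Qed.

Lemma wh_subproof n (f : M n) (p : word n.+1) :
  we p * D (wlet p) (cev f (wpre p)) = D (wlet p) (cev f (wpre p)).
Proof. by rewrite /we wlastS wx_Dsrc. Qed.

Definition wh n (f : M n) : M n.+1 := mkcol (wh_subproof f).

Lemma Dzero x : D x 0 = 0.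
Proof. by apply: (addrI (D x 0)); rewrite -(wx_DD ax) !addr0. Qed.

Lemma D_sum (I : Type) (r : seq I) (P : pred I) x F :
  D x (\sum_(i <- r | P i) F i) = \sum_(i <- r | P i) D x (F i).
Proof. exact: (big_morph (D x) (wx_DD ax x) (Dzero x)). Qed.

Lemma DN x y : D x (- y) = - D x y.
Proof. by apply/eqP; rewrite -addr_eq0 -(wx_DD ax) addNr Dzero. Qed.

(** At [w] every term is a sum over the words that share the prefix of [w], and [wx_hom] settles
    each of them: only [w] itself contributes. The correction inside [wd n f] is killed by the
    deletions, by [wx_hom']. *)
Lemma wd_wh n (f : M n.+1) : wd n.+1 (wh f) + wh (wd n f) = f.
Proof.
apply: columnP => w; rewrite cevD cev_wd cev_mkcol cev_wd.
rewrite /wd_fun (wx_DD ax) DN D_sum.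
have -> : D (wlet w) (wcorr (cev f) (wpre w)) = 0.
  case: n f w => [|n] f w /=; first exact: Dzero.
  rewrite D_sum big1 // => p _; apply: (wx_hom' ax).
  - by rewrite -wlastS wlet_nxt.
  - by rewrite -wlastS wlet_nxt.
  - by have := cev_e f p; rewrite /we wlastS.
rewrite subr0.
have e1 : \sum_(q | wpre q == wpre w) (D (wlet w) (b (wlet q) * cev f q)
    + (if wlet w == wlet q then
         \sum_(x' | nxt (inr (wlet q)) x') b x' * D x' (cev f q) else 0)
    - \sum_(x' | nxt (inr (wlet q)) x') kap (wlet q) (wlet w) x' * D x' (cev f q))
  = cev f w.
  rewrite (bigD1 w) //= (wx_hom ax (s := wlast (wpre w))) ?wlet_nxt //; last first.
    by have := cev_e f w; rewrite /we wlastS.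
  rewrite eqxx big1 ?addr0 // => q /andP[/eqP qw nqw].
  rewrite (wx_hom ax (s := wlast (wpre w))) ?wlet_nxt //; first last.
  - by have := cev_e f q; rewrite /we wlastS.
  - by rewrite -qw wlet_nxt.
  by case: eqP => // wq; rewrite (word_inj qw (esym wq)) eqxx in nqw.
have e2 : \sum_(p | wpre p == w) b (wlet p) * cev (wh f) p =
  \sum_(q | wpre q == wpre w) (if wlet w == wlet q then
         \sum_(x' | nxt (inr (wlet q)) x') b x' * D x' (cev f q) else 0).
  rewrite [RHS](bigD1 w) //= eqxx [X in _ = _ + X]big1 ?addr0; last first.
    move=> q /andP[/eqP qw nqw].
    by case: eqP => // wq; rewrite (word_inj qw (esym wq)) eqxx in nqw.
  rewrite -wlastS -(sum_word w (fun x => b x * D x (cev f w))).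
  by apply: eq_bigr => p /eqP wp; rewrite cev_mkcol wp.
have e3 : wcorr (cev (wh f)) w = \sum_(q | wpre q == wpre w)
    \sum_(x' | nxt (inr (wlet q)) x') kap (wlet q) (wlet w) x' * D x' (cev f q).
  rewrite wcorrS.
  rewrite (partition_big (@wpre _ _ nxt n.+1) (fun q => wpre q == wpre w)) //.
  apply: eq_bigr => q qw; rewrite -wlastS.
  rewrite -(sum_word q (fun x => kap (wlet q) (wlet w) x * D x (cev f q))).
  apply: eq_big => [p|p /andP[_ /eqP pq]]; last by rewrite cev_mkcol pq.
  by apply/andP/eqP => [[_ /eqP]|->//].
rewrite e2 e3 -[RHS]e1 sumrB big_split /=.
by rewrite -[RHS]addrA [RHS]addrC.
Qed.

Definition weps : {linear M 0%N -> S} :=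
  @colmap B (word 0) (@we 0) S (fun v => pi (e v)).

Lemma pi_ract (y z : B) : pi (y * z : B) = ract (pi y) z.
Proof. by rewrite -ract_reg linear_ract. Qed.

Lemma weE v (f : M 0%N) : e v * cev f v = cev f v.
Proof. exact: (cev_e f). Qed.

Lemma wepsE f : weps f = pi (\sum_(v : V) cev f v).
Proof.
rewrite colmapE linear_sum; apply: eq_bigr => v _.
by rewrite -pi_ract weE.
Qed.

Lemma weps_wd f : weps (wd 0 f) = 0.
Proof.
rewrite wepsE linear_sum big1 // => v _.
rewrite cev_wd /wd_fun subr0 linear_sum big1 // => p _.
by rewrite pi_ract wx_pib // ract0l.
Qed.

Lemma wd_wh0 f : weps f = 0 -> wd 0 (wh f) = f.
Proof.
rewrite wepsE => f0; apply: columnP => v; rewrite cev_wd /wd_fun subr0.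
(* Multiplication by the idempotent [e v] isolates one component of the sum, and [wx_pie] keeps it
   in the kernel of [pi]. *)
have fv : pi (cev f v) = 0.
  have := wx_pie ax v f0; rewrite mulr_sumr (bigD1 v) //= weE big1 ?addr0 // => v'.
  by move/negPf => nv; rewrite -(weE v' f) mulrA wx_orth // eq_sym nv mul0r.
rewrite -[RHS](wx_hom0 ax (weE v f) fv).
rewrite -[inl v]/(wlast (v : word 0)).
rewrite -(sum_word (v : word 0) (fun x => b x * D x (cev f v))).
by apply: eq_bigr => p /eqP pv; rewrite cev_mkcol pv.
Qed.

Lemma weps_surj y : exists f, weps f = y.
Proof.
have [x <-] := wx_surj ax y.
have h v : e v * (e v * x) = e v * x by rewrite mulrA wx_orth // eqxx.
exists (mkcol (h : forall v : word 0, we v * (we v * x) = we v * x)).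
rewrite wepsE; congr (pi _).
transitivity (\sum_v e v * x); last by rewrite -mulr_suml (wx_sum ax) mul1r.
by apply: eq_bigr => v _; rewrite cev_mkcol.
Qed.

Lemma sum_word2 (R : nmodType) n (w : word n) (F : word n.+2 -> R) :
  \sum_(p | wpre p == w) \sum_(q | wpre q == p) F q
  = \sum_(q | wpre (wpre q) == w) F q.
Proof.
rewrite [RHS](partition_big (@wpre _ _ nxt n.+1) (fun p => wpre p == w)) //.
apply: eq_bigr => p /eqP pw; apply: eq_bigl => q.
by apply/eqP/andP => [->|[_ /eqP //]]; rewrite pw !eqxx.
Qed.

(** Corrections applied after [wd] give products [kap * b] and [kap * kap], which vanish by
    [wx_kapb] and [wx_kapk]. What remains at [w] is [b z * b x] minus its rewriting by [wx_kap]. *)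
Lemma wd_wd n (f : M n.+2) : wd n (wd n.+1 f) = 0.
Proof.
apply: columnP => w; rewrite cev0 cev_wd /wd_fun.
have -> : wcorr (cev (wd n.+1 f)) w = 0.
  case: n f w => [//|n] f w; rewrite wcorrS big1 // => p /eqP pw.
  have kp : nxt (inr (wlet (wpre p))) (wlet p) by rewrite -wlastS wlet_nxt.
  rewrite cev_wd /wd_fun mulrBr mulr_sumr wcorrS mulr_sumr.
  rewrite !big1 ?subr0 // => q /eqP qp.
    have h1 := wlet_nxt q; have h2 := wlet_nxt (wpre q); rewrite wlastS in h1.
    by rewrite mulrA (wx_kapk ax) ?mul0r // -wlastS -qp.
  by rewrite mulrA (wx_kapb ax) ?mul0r // -wlastS -qp wlet_nxt.
rewrite subr0.
have e1 p : wpre p == w -> b (wlet p) * cev (wd n.+1 f) p =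
    \sum_(q | wpre q == p) (b (wlet (wpre q)) * b (wlet q)) * cev f q
    - \sum_(q | wpre (wpre q) == w)
        (b (wlet p) * kap (wlet (wpre q)) (wlet p) (wlet q)) * cev f q.
  move=> /eqP pw; rewrite cev_wd /wd_fun wcorrS mulrBr !mulr_sumr pw.
  by congr (_ - _); apply: eq_bigr => q /eqP qp; rewrite mulrA // qp.
rewrite (eq_bigr _ e1) sumrB sum_word2 exchange_big -sumrB big1 // => q /eqP qw.
rewrite -mulr_suml -mulrBl.
have h1 := wlet_nxt q; rewrite wlastS in h1.
rewrite (wx_kap ax (wlet_nxt (wpre q)) h1) qw.
rewrite -(sum_word w (fun r => b r * kap (wlet (wpre q)) r (wlet q))).
by rewrite subrr mul0r.
Qed.

Lemma word_projective n : projective (column (@we n) : lmodType B^c).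
Proof. by apply: column_projective => w; apply: we_idem. Qed.

Lemma weps_exact f : weps f = 0 <-> exists z, f = wd 0 z.
Proof.
by split=> [/wd_wh0 <-|[z ->]]; [exists (wh f)|apply: weps_wd].
Qed.

Lemma wd_exact n (f : M n.+1) : wd n f = 0 <-> exists z, f = wd n.+1 z.
Proof.
split=> [f0|[z ->]]; last exact: wd_wd.
exists (wh f); rewrite -{1}(wd_wh f) f0; rewrite -[RHS]addr0; congr (_ + _).
by apply: columnP => w; rewrite cev_mkcol !cev0 Dzero.
Qed.

Definition word_resolution : resolution S :=
  @Resolution B^c S (fun n => column (@we n) : lmodType B^c) wd weps word_projective weps_surj weps_exact wd_exact.

End WordResolution.

(** * Comparison of resolutions *)

Section Kernel.
Variables (R : nzRingType) (X Y : lmodType R) (f : {linear X -> Y}).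

Definition ker_pred : {pred X} := [pred x | f x == 0].

Lemma ker_submod : submod_closed ker_pred.
Proof.
split=> [|a x y]; rewrite !inE ?linear0 // => /eqP fx /eqP fy.
by rewrite linearP fx fy scaler0 addr0.
Qed.

HB.instance Definition _ := GRing.isSubmodClosed.Build R X ker_pred ker_submod.

Record kernel := Kernel { ker_val : X; ker_valP : ker_val \in ker_pred }.

HB.instance Definition _ := [isSub for ker_val].
HB.instance Definition _ := [Choice of kernel by <:].
HB.instance Definition _ := [SubChoice_isSubLmodule of kernel by <:].

End Kernel.

(** Projectivity lifts along surjections, so both [f] and [g] are corestricted to the kernel of [k],
    onto which [g] is surjective by exactness. *)
Lemma lift_exact (R : nzRingType) (M X Y Z : lmodType R) (g : {linear X -> Y})
    (k : {linear Y -> Z}) (f : {linear M -> Y}) : projective M ->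
  (forall x, k (g x) = 0) -> (forall y, k y = 0 -> exists x, y = g x) ->
  (forall m, k (f m) = 0) -> exists h : {linear M -> X}, forall m, g (h m) = f m.
Proof.
move=> projM kg exact_g kf.
have gk x : g x \in ker_pred k by rewrite inE kg.
have fk m : f m \in ker_pred k by rewrite inE kf.
have lin_g : linear (fun x => Kernel (gk x)).
  by move=> a x y; apply: val_inj; rewrite /= linearP.
have lin_f : linear (fun m => Kernel (fk m)).
  by move=> a x y; apply: val_inj; rewrite /= linearP.
have [|h hP] := projM _ _ (mklin lin_g) (mklin lin_f).
  case=> y yk; have := yk; rewrite inE => /eqP /exact_g[x yx].
  by exists x; apply: val_inj; rewrite /= -yx.
by exists h => m; have /(congr1 (@ker_val _ _ _ _)) := hP m.
Qed.

Section Comparison.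
Variables (R : nzRingType) (S : lmodType R).

(** In degree 0 the augmentation plays the part of the differential, so that lifting reads the same
    in every degree. *)
Definition is_cycle (P : resolution S) n : P n -> Prop :=
  match n with
  | 0 => fun x => res_eps P x = 0
  | n'.+1 => fun x => res_d P n' x = 0
  end.

Lemma cycle_boundary (P : resolution S) n (x : P n) :
  is_cycle x <-> exists z, x = res_d P n z.
Proof. by case: n x => [|n] x; [apply: res_exact0|apply: res_exact]. Qed.

Lemma boundary_cycle (P : resolution S) n (z : P n.+1) : is_cycle (res_d P n z).
Proof. by apply/cycle_boundary; exists z. Qed.

Lemma lift_cycle (P : resolution S) (M : lmodType R) n (f : {linear M -> P n}) :
  projective M -> (forall m, is_cycle (f m)) ->
  exists h : {linear M -> P n.+1}, forall m, res_d P n (h m) = f m.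
Proof.
move=> pM; case: n f => [|n] f fc.
  apply: (lift_exact (k := res_eps P)) => // x; first by apply/res_exact0; exists x.
  by move/res_exact0.
apply: (lift_exact (k := res_d P n)) => // x; first by apply/res_exact; exists x.
by move/res_exact.
Qed.

Definition chain_map (P P' : resolution S) (F : forall n, {linear P n -> P' n}) :=
  (forall x, res_eps P' (F 0%N x) = res_eps P x) /\
  (forall n x, res_d P' n (F n.+1 x) = F n (res_d P n x)).

Lemma chain_map_comp (P P' P'' : resolution S)
    (F : forall n, {linear P n -> P' n}) (G : forall n, {linear P' n -> P'' n}) :
  chain_map F -> chain_map G ->
  chain_map (fun n => (G n \o F n)%FUN : {linear P n -> P'' n}).
Proof.
move=> [F0 FS] [G0 GS]; split=> [x|n x] /=; first by rewrite G0.
by rewrite GS FS.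
Qed.

Lemma chain_map_id (P : resolution S) :
  chain_map (fun n => idfun : {linear P n -> P n}).
Proof. by []. Qed.

(** The property [Q] lets one recursion produce both plain comparison maps and graded ones. The
    recursion carries only that [F] preserves cycles, which is all that the next lift needs. *)
Lemma chain_map_rec (P P' : resolution S)
    (Q : forall n, {linear P n -> P' n} -> Prop) :
  (exists2 F0 : {linear P 0%N -> P' 0%N}, Q 0%N F0
     & forall x, res_eps P' (F0 x) = res_eps P x) ->
  (forall n (F : {linear P n -> P' n}), Q n F ->
     (forall x, is_cycle x -> is_cycle (F x)) ->
     exists2 F' : {linear P n.+1 -> P' n.+1}, Q n.+1 F'
       & forall x, res_d P' n (F' x) = F (res_d P n x)) ->
  exists2 F : forall n, {linear P n -> P' n}, chain_map F & forall n, Q n (F n).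
Proof.
move=> [F0 QF0 F0P] step.
pose good n (F : {linear P n -> P' n}) :=
  Q n F /\ forall x, is_cycle x -> is_cycle (F x).
have step' n (F : {F | @good n F}) : {F' : {linear P n.+1 -> P' n.+1} |
    good n.+1 F' /\ forall x, res_d P' n (F' x) = sval F (res_d P n x)}.
  apply: cid; case: F => F [QF Fc] /=; have [F' QF' F'P] := step n F QF Fc.
  by exists F'; split=> //; split=> // x; rewrite /= F'P => ->; rewrite linear0.
have good0 : good 0%N F0 by split=> // x; rewrite /= F0P.
pose fix G n : {F | @good n F} := match n with
  | 0 => exist _ F0 good0
  | n'.+1 => exist _ (sval (step' n' (G n'))) (svalP (step' n' (G n'))).1
  end.
exists (fun n => sval (G n)); last by move=> n; case: (svalP (G n)).
by split=> // n x; have [_ ->] := svalP (step' n (G n)).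
Qed.

Lemma chain_map_exists (P P' : resolution S) :
  exists F : forall n, {linear P n -> P' n}, chain_map F.
Proof.
have [||F FP _] := @chain_map_rec P P' (fun _ _ => True); last by exists F.
  have [F0 F0P] := @res_proj _ _ P 0%N _ _ _ (res_eps P) (@res_eps_surj _ _ P').
  by exists F0.
move=> n F _ Fc.
have [|F' F'P] := @lift_cycle P' (P n.+1) n (F \o res_d P n)%FUN (@res_proj _ _ P _).
  by move=> x; apply/Fc/boundary_cycle.
by exists F'.
Qed.

(** Each degree gets its own pair of maps and no coherent family is built: membership in the radical
    is a question about one degree at a time. *)
Lemma chain_homotopy (P P' : resolution S) (F G : forall n, {linear P n -> P' n}) :
  chain_map F -> chain_map G ->
  forall n, exists (h : {linear P n -> P' n.+1}),
    match n return {linear P n -> P' n} -> {linear P n -> P' n} ->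
                   {linear P n -> P' n.+1} -> Prop with
    | 0 => fun f g h => forall x, f x - g x = res_d P' 0 (h x)
    | n'.+1 => fun f g h => exists h' : {linear P n' -> P' n'.+1},
        forall x, f x - g x = res_d P' n'.+1 (h x) + h' (res_d P n' x)
    end (F n) (G n) h.
Proof.
move=> [F0 FS] [G0 GS]; elim=> [|n [h hP]].
  have [|h hP] := @lift_cycle P' (P 0%N) 0 (F 0%N \- G 0%N)%R (@res_proj _ _ P _).
    by move=> x; rewrite /= linearB /= F0 G0 subrr.
  by exists h => x; rewrite hP.
have hc x : F n (res_d P n x) - G n (res_d P n x) = res_d P' n (h (res_d P n x)).
  case: n h hP x => [|n] h hP x; first exact: hP.
  case: hP => h' ->; have /(_ x) := @boundary_cycle P n.+1.
  by rewrite /= => ->; rewrite linear0 addr0.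
have [|k kP] := @lift_cycle P' (P n.+1) n.+1
    ((F n.+1 \- G n.+1) \- (h \o res_d P n)%FUN)%R (@res_proj _ _ P _).
  by move=> x; rewrite /= !linearB /= FS GS hc subrr.
by exists k, h => x; rewrite kP /= subrK.
Qed.

End Comparison.

Section Minimal.
Variables (B : nzRingType) (J : set B) (S : lmodType B^c).

Definition radical_of (M : lmodType B^c) : set M :=
  sums_of [set y | exists u b, J b /\ y = ract u b].

Definition minimal_resolution (P : resolution S) : Prop :=
  forall n x, radical_of (res_d P n x).

Lemma radical_linear (M N : lmodType B^c) (f : {linear M -> N}) x :
  radical_of x -> radical_of (f x).
Proof.
apply: (sums_of_ind (C := fun x => radical_of (f x))) => [|y z fy fz|y].
- by rewrite linear0; apply: sums_of0.
- by rewrite linearD; apply: sums_ofD.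
- by move=> [u [b [Jb ->]]]; rewrite linear_ract; apply: sums_of_in; exists (f u), b.
Qed.

Lemma radicalN (M : lmodType B^c) (x : M) : radical_of x -> radical_of (- x).
Proof.
apply: (sums_of_ind (C := fun x => radical_of (- x))) => [|y z ny nz|y].
- by rewrite oppr0; apply: sums_of0.
- by rewrite opprD; apply: sums_ofD.
- move=> [u [b [Jb ->]]]; apply: sums_of_in; exists (- u), b.
  by rewrite /ract scalerN.
Qed.

(** The difference is [d h + h' d], and minimality puts both terms in the radical. Applied to a
    composite and the identity, this stands in for the isomorphism of minimal resolutions. *)
Lemma chain_map_radical (P P' : resolution S)
    (F G : forall n, {linear P n -> P' n}) :
  minimal_resolution P -> minimal_resolution P' -> chain_map F -> chain_map G ->
  forall n x, radical_of (F n x - G n x).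
Proof.
move=> mP mP' cF cG [|n] x.
  by have [h ->] := chain_homotopy cF cG 0.
have [h [h' ->]] := chain_homotopy cF cG n.+1.
by apply: sums_ofD; [apply: mP'|apply/radical_linear/mP].
Qed.

End Minimal.

(** * Monomial algebras *)

Section Paths.
Variables (K : fieldType) (Q : quiver).
Local Notation KQ := (path_alg K Q).
Implicit Types (v : vertex Q) (s t : seq (arrow Q)).

(* The path [(v, s)], or [0] when the arrows [s] cannot be traversed from [v]. *)
Definition pe v s : KQ := if insub (v, s) is Some p then pelt K p else 0.

Lemma pe_fun v s p : pa_fun (pe v s) p = (path_val p == (v, s))%:R.
Proof.
rewrite /pe; case: insubP => [q _ <-|nw].
  by rewrite /= -val_eqE.
by case: eqP => // pvs; have := path_valP p; rewrite pvs (negPf nw).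
Qed.

Lemma pelt_pe p : pelt K p = pe (path_val p).1 (path_val p).2.
Proof. by apply: path_algP => q; rewrite pe_fun /= -surjective_pairing val_eqE. Qed.

Lemma pe_walk v s : ~~ walk v s -> pe v s = 0.
Proof. by move=> nw; rewrite /pe insubN. Qed.

Lemma walk_end_cat v s t : walk_end v (s ++ t) = walk_end (walk_end v s) t.
Proof. by rewrite /walk_end foldl_cat. Qed.

Lemma pe_mul v s v' t :
  pe v s * pe v' t = if walk_end v s == v' then pe v (s ++ t) else 0.
Proof.
apply: path_algP => p; rewrite /= /conv.
under eq_bigr do rewrite !pe_fun -natrM mulnb.
have [def_p|np] := boolP (path_val p == (v, s ++ t)).
  have st : (size s < (plen p).+1)%N.
    by rewrite /plen (eqP def_p) /= size_cat ltnS leq_addr.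
  rewrite (bigD1 (Ordinal st)) //= big1 ?addr0; last first.
    move=> i ni; case: eqP => //= -[_ /(congr1 size)].
    rewrite size_takel -1?ltnS // => def_i.
    by case/negP: ni; apply/eqP/val_inj.
  rewrite (eqP def_p) /= take_size_cat // drop_size_cat // !xpair_eqE !eqxx /=.
  by case: eqP => _; rewrite ?pe_fun ?andbT // (eqP def_p) eqxx.
rewrite big1 => [|i _].
  by case: ifP => // _; rewrite pe_fun (negPf np).
case: eqP => //= -[v1 s1]; case: eqP => //= -[v2 t1]; case/negP: np.
by rewrite -v1 -s1 -t1 cat_take_drop -surjective_pairing.
Qed.

Lemma pe_sum1 : \sum_v pe v [::] = 1.
Proof.
apply: path_algP => p; rewrite (big_morph (fun x => pa_fun x p) (id1 := 0) (op1 := +%R)) //.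
under eq_bigr do rewrite pe_fun.
rewrite /= /unit_fun /plen (bigD1 (path_val p).1) //= big1 ?addr0.
  by rewrite [path_val p]surjective_pairing /= xpair_eqE eqxx size_eq0.
by move=> v /negPf nv; rewrite [path_val p]surjective_pairing xpair_eqE eq_sym nv.
Qed.

Lemma path_alg_sum (x : KQ) : exists r : seq (qpath Q), uniq r /\
  x = \sum_(p <- r) (pa_fun x p : K) *: pelt K p.
Proof.
have /finite_supportP[s sP] := pa_funP x.
exists (undup s); split; first exact: undup_uniq.
apply: path_algP => q.
rewrite (big_morph (fun x => pa_fun x q) (id1 := 0) (op1 := +%R)) //.
under eq_bigr do rewrite pa_funZ /=.
have [qs|/sP qs] := boolP (q \in s).
  rewrite (bigD1_seq q) ?undup_uniq ?mem_undup //= eqxx mulr1 big1 ?addr0 // => p.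
  by rewrite eq_sym => /negPf->; rewrite mulr0.
rewrite qs big1 // => p _; case: eqP => [<-|_]; last by rewrite mulr0.
by rewrite qs mul0r.
Qed.

Lemma pa_fun_sum (J : Type) (r : seq J) (P : pred J) (F : J -> KQ) q :
  pa_fun (\sum_(i <- r | P i) F i) q = \sum_(i <- r | P i) pa_fun (F i) q.
Proof. exact: (big_morph (fun x => pa_fun x q)). Qed.

Lemma ideal_pow_arrow n p : (n <= plen p)%N -> ideal_pow (arrow_ideal (K := K) (Q := Q)) n (pelt K p).
Proof.
elim: n p => [//|n IHn] [[v [//|a s]] w] np /=.
have /andP[/eqP va ws] := w; apply: sums_of_in.
exists (pe v [:: a]), (pe (tgt a) s); split.
- apply: sums_of_in; exists 1, (pe v [:: a]), 1; rewrite mul1r mulr1; split=> //.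
  have wa : walk v [:: a] by rewrite /= va eqxx.
  by exists (@QPath Q (v, [:: a]) wa) => //; rewrite pelt_pe.
- have := IHn (@QPath Q (tgt a, s) ws) np; by rewrite pelt_pe.
- by rewrite pelt_pe pe_mul /= eqxx.
Qed.

Lemma arrow_ideal_supp (x : KQ) p : arrow_ideal x -> pa_fun x p != 0 -> (0 < plen p)%N.
Proof.
move=> xJ; apply: contraNT; rewrite -leqNgt leqn0 => p0; apply/eqP.
move: xJ; apply: (sums_of_ind (C := fun x => pa_fun x p = 0)) => //.
  by move=> y z yp zp; rewrite pa_funD yp zp addr0.
move=> _ [a [_ [b [[q q1 ->] ->]]]]; rewrite /= /conv big1 // => i _.
rewrite /conv big1 ?mul0r // => j _ /=; case: eqP => [def_q|]; last by rewrite mulr0.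
have le_p k l : (plen (pdrop k (ptake l p)) <= plen p)%N.
  rewrite plen_drop /plen /= size_take_min; lia.
by have := leq_trans (le_p j i) (eq_leq (eqP p0)); rewrite def_q q1.
Qed.

Lemma arrow_ideal2_supp (x : KQ) p :
  ideal_pow (arrow_ideal (K := K) (Q := Q)) 2 x -> pa_fun x p != 0 -> (1 < plen p)%N.
Proof.
move=> xJ; apply: contraNT; rewrite -leqNgt => p1; apply/eqP.
move: xJ; apply: (sums_of_ind (C := fun x => pa_fun x p = 0)) => //.
  by move=> y z yp zp; rewrite pa_funD yp zp addr0.
move=> _ [x1 [y [Jx Jy ->]]]; rewrite /= /conv big1 // => i _.
(* The power of exponent 1 consists of sums of products of an ideal element with an arbitrary one;
   it is folded back into the ideal. *)
have {}Jy : arrow_ideal y.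
  move: Jy; apply: (sums_of_ind (C := fun y => arrow_ideal y)).
  - exact: sums_of0.
  - by move=> ? ?; apply: sums_ofD.
  move=> _ [z [t [Jz _ ->]]]; move: Jz.
  apply: (sums_of_ind (C := fun z => arrow_ideal (z * t))).
  - by rewrite mul0r; apply: sums_of0.
  - by move=> ? ?; rewrite mulrDl; apply: sums_ofD.
  move=> _ [a [u [b [Xu ->]]]]; apply: sums_of_in.
  by exists a, u, (b * t); rewrite !mulrA.
have [->|h1] := eqVneq (pa_fun x1 (ptake i p)) 0; first by rewrite mul0r.
have [->|h2] := eqVneq (pa_fun y (pdrop i p)) 0; first by rewrite mulr0.
have := arrow_ideal_supp Jx h1; have := arrow_ideal_supp Jy h2.
rewrite plen_drop /plen /= size_take_min -/(plen p); lia.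
Qed.

End Paths.

(** The coefficient of [p] in [a * q * b] is non-zero only if [p] passes through the path [q], and
    then [p] lies in the ideal together with [q]. *)
Lemma monomial_ideal_supp (K : fieldType) (Q : quiver) (I : set (path_alg K Q)) x p :
  monomial_ideal I -> (forall a x b, I x -> I (a * x * b)) ->
  I x -> pa_fun x p != 0 -> I (pelt K p).
Proof.
move=> [X ->] mulI Ix xp; apply: contrapT => nIp; case/negP: xp; apply/eqP.
move: Ix; apply: (sums_of_ind (C := fun x => pa_fun x p = 0)) => //.
  by move=> y z yp zp; rewrite pa_funD yp zp addr0.
move=> _ [a [y [b [[q Xq <-] ->]]]]; rewrite /= /conv big1 // => i _.
rewrite /conv big1 ?mul0r // => j _ /=.
case: eqP => [def_q|]; last by rewrite mulr0.
case: nIp.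
have -> : pelt K p = pelt K (ptake j (ptake i p)) * pelt K q * pelt K (pdrop i p).
  rewrite -def_q !pelt_pe pe_mul /= eqxx pe_mul cat_take_drop /=.
  by rewrite eqxx cat_take_drop.
apply: mulI; apply: sums_of_in; exists 1, (pelt K q), 1.
by rewrite mul1r mulr1; split=> //; exists q.
Qed.

Section MonomialQuotient.
Variables (K : fieldType) (Q : quiver) (I : set (path_alg K Q)).
Variables (L : algType K) (phi : {lrmorphism path_alg K Q -> L}).
Hypotheses (admI : admissible I) (monI : monomial_ideal I) (quoI : is_quotient I phi).
Implicit Types (v : vertex Q) (s : seq (arrow Q)).

Definition bb v s : L := phi (pe K v s).

Lemma phiZ (c : K) x : phi (c *: x) = c *: phi x. Proof. exact: linearZ. Qed.

Lemma phi_lin_sum (J : Type) (r : seq J) (c : J -> K) F :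
  phi (\sum_(j <- r) c j *: F j) = \sum_(j <- r) c j *: phi (F j).
Proof. by rewrite raddf_sum; apply: eq_bigr => j _; apply: phiZ. Qed.

Lemma bb_mul v s v' t :
  bb v s * bb v' t = if walk_end v s == v' then bb v (s ++ t) else 0.
Proof. by rewrite -rmorphM pe_mul /bb; case: ifP => // _; rewrite raddf0. Qed.

Lemma bb_cat v s t : bb v (s ++ t) = bb v s * bb (walk_end v s) t.
Proof. by rewrite bb_mul eqxx. Qed.

Lemma bb_walk v s : bb v s != 0 -> walk v s.
Proof. by apply: contraNT => /pe_walk h; rewrite /bb h raddf0. Qed.

Lemma phi_supp x p : phi x = 0 -> pa_fun x p != 0 ->
  bb (path_val p).1 (path_val p).2 = 0.
Proof.
have [_ kerP] := quoI; move=> /kerP Ix xp; rewrite /bb -pelt_pe; apply/kerP.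
apply: monomial_ideal_supp xp => // a y b /kerP y0.
by apply/kerP; rewrite !rmorphM /= y0 mulr0 mul0r.
Qed.

Lemma bb_short v s : walk v s -> (size s <= 1)%N -> bb v s != 0.
Proof.
move=> ws s1; apply/eqP => /(proj2 quoI _) Ips.
have [n [_ _ IJ]] := admI; have := arrow_ideal2_supp (p := QPath (path_val := (v, s)) ws) (IJ _ Ips).
rewrite pe_fun eqxx oner_eq0 => /(_ isT); rewrite /plen /=; lia.
Qed.

Lemma bb_long : exists N, forall v s, (N <= size s)%N -> bb v s = 0.
Proof.
have [n [_ JI _]] := admI; exists n => v s ns.
have [ws|/pe_walk h] := boolP (walk v s); last by rewrite /bb h raddf0.
have /JI/(proj2 quoI _) : ideal_pow (arrow_ideal (K := K) (Q := Q)) n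
   (pelt K (QPath (path_val := (v, s)) ws)) by apply: ideal_pow_arrow.
by rewrite pelt_pe.
Qed.

(* The arrow sequence [s] is a path of [Q] lying in [I]. *)
Definition zs s : bool := [exists v, walk v s && (bb v s == 0)].

(** A non-empty sequence of arrows determines its start vertex, and trivial paths are never zero, so
    the vertex may be dropped from the notation. *)
Lemma zsP v s : walk v s -> (bb v s == 0) = zs s.
Proof.
move=> ws; apply/idP/existsP => [h|[v' /andP[ws' h]]]; first by exists v; rewrite ws.
case: s ws ws' h => [_ _ h|a s].
  by have := @bb_short v' [::] isT isT; rewrite h.
by rewrite /= => /andP[/eqP-> _] /andP[/eqP <- _].
Qed.

Lemma nz_zs v s : (bb v s != 0) = walk v s && ~~ zs s.
Proof.
apply/idP/andP => [h|[ws]]; last by rewrite -(zsP ws).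
by have ws := bb_walk h; rewrite -(zsP ws).
Qed.

Lemma zs_short s : (size s <= 1)%N -> ~~ zs s.
Proof.
move=> s1; apply/existsPn => v; rewrite negb_and.
by case: (boolP (walk v s)) => //= ws; apply: bb_short.
Qed.

Lemma zs_cat v s t u : walk v (s ++ t ++ u) -> zs t -> zs (s ++ t ++ u).
Proof.
move=> w zt; rewrite -(zsP w) !bb_cat.
move: w; rewrite !walk_cat => /and3P[ws wt wu].
by have := zt; rewrite -(zsP wt) => /eqP->; rewrite mul0r mulr0.
Qed.

Definition max_len : nat := sval (cid bb_long).

Definition nzs : seq (vertex Q * seq (arrow Q)) :=
  [seq x <- flatten [seq [seq (v, val w) | v <- enum (vertex Q),
                                            w <- enum {: k.-tuple (arrow Q)}]
                    | k <- iota 0 max_len] | bb x.1 x.2 != 0].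

Lemma mem_nzs v s : ((v, s) \in nzs) = (bb v s != 0).
Proof.
rewrite mem_filter /=; case: (boolP (bb v s == 0)) => //= nz.
apply/flattenP.
exists [seq (v, val w) | v <- enum (vertex Q), w <- enum {: (size s).-tuple (arrow Q)}].
  apply/mapP; exists (size s) => //; rewrite mem_iota /= add0n ltnNge.
  by apply: contraNN nz => /(svalP (cid bb_long) v) ->.
by apply/allpairsP; exists (v, in_tuple s); rewrite !mem_enum.
Qed.

Definition nzp : finType := seq_sub nzs.
Definition nzb (t : nzp) : L := bb (val t).1 (val t).2.

Lemma nzbP (t : nzp) : nzb t != 0.
Proof. by rewrite /nzb -mem_nzs -surjective_pairing; apply: valP. Qed.

Definition nzp_of v s (h : bb v s != 0) : nzp := SeqSub (etrans (mem_nzs v s) h).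

(** A vanishing combination lifts to an element of the ideal, which by monomiality contains every
    path in its support. *)
Lemma phi_sum_zero (J : eqType) (r : seq J) (F : J -> vertex Q * seq (arrow Q)) (c : J -> K) :
  uniq r -> {in r &, injective F} ->
  \sum_(j <- r) c j *: bb (F j).1 (F j).2 = 0 ->
  forall j, j \in r -> bb (F j).1 (F j).2 != 0 -> c j = 0.
Proof.
move=> ur injF sum0 j jr nzj; apply/eqP; apply: contraNT nzj => cj.
have wj := @bb_walk.
pose x := \sum_(j <- r) c j *: pe K (F j).1 (F j).2.
have x0 : phi x = 0.
  by rewrite phi_lin_sum.
apply/negPn/negP => nz; have {}wj := wj _ _ nz.
case/negP: nz; apply/eqP.
apply: (@phi_supp x (QPath (path_val := F j) wj)) => //.
rewrite pa_fun_sum (bigD1_seq j) // pa_funZ pe_fun -surjective_pairing eqxx mulr1.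
rewrite big1_seq => [|i /andP[ij ir]]; first by rewrite /= addr0.
rewrite pa_funZ pe_fun -surjective_pairing /=.
case: eqP => [/(injF _ _ jr ir) ji|_]; last by rewrite mulr0.
by rewrite ji eqxx in ij.
Qed.

Lemma nzb_span y : exists c : nzp -> K, y = \sum_t c t *: nzb t.
Proof.
have [x <-] := (proj1 quoI) y.
have [r [_ ->]] := path_alg_sum x; rewrite phi_lin_sum.
apply: (big_ind (fun y => exists c : nzp -> K, y = \sum_t c t *: nzb t)).
- by exists (fun=> 0); rewrite big1 // => t _; rewrite scale0r.
- move=> _ _ [c ->] [c' ->]; exists (fun t => c t + c' t).
  by rewrite -big_split; apply: eq_bigr => t _; rewrite scalerDl.
move=> p _; rewrite pelt_pe -/(bb _ _).
have [->|nz] := eqVneq (bb (path_val p).1 (path_val p).2) 0.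
  by exists (fun=> 0); rewrite scaler0 big1 // => t _; rewrite scale0r.
exists (fun t => if t == nzp_of nz then pa_fun x p : K else 0).
rewrite (bigD1 (nzp_of nz)) //= eqxx big1 ?addr0 // => t /negPf->.
by rewrite scale0r.
Qed.

Lemma nzb_basis : is_basis (nzb : nzp -> L).
Proof.
split=> [y|r c ur r0 t tr]; last first.
  apply: (phi_sum_zero ur _ r0 tr); last exact: nzbP.
  by move=> ? ? _ _ /val_inj.
have [c ->] := nzb_span y; exists (enum nzp), c; split; first exact: enum_uniq.
by rewrite big_enum.
Qed.

Lemma deletion_exists : exists D : vertex Q * seq (arrow Q) -> {linear L -> L},
  forall x v s, D x (bb v s) =
    if [&& bb v s != 0, v == x.1 & prefix x.2 s]
    then bb (walk_end x.1 x.2) (drop (size x.2) s) else 0.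
Proof.
pose F (x : vertex Q * seq (arrow Q)) (t : nzp) :=
  if (val t).1 == x.1 then
    if prefix x.2 (val t).2 then
      bb (walk_end x.1 x.2) (drop (size x.2) (val t).2) else 0
  else 0.
have /choice[D DP] : forall x, exists f : {linear L -> L}, forall t, f (nzb t) = F x t.
  by move=> x; apply: (basis_ext nzb_basis).
exists D => x v s; have [->|nz] /= := eqVneq (bb v s) 0; first by rewrite linear0.
have := DP x (nzp_of nz); rewrite /nzb /F /= => ->.
by case: eqP => //= _; case: ifP.
Qed.

Lemma bb_left_ind v (C : L -> Prop) : C 0 ->
  (forall c y y', C y -> C y' -> C (c *: y + y')) ->
  (forall s, bb v s != 0 -> C (bb v s)) -> forall y, bb v [::] * y = y -> C y.
Proof.
move=> C0 CD Cb y <-; have [c ->] := nzb_span y.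
rewrite mulr_sumr; apply: (big_ind C) => // [y1 y2 h1 h2|t _].
  by rewrite -[y1]scale1r; apply: CD.
rewrite -scalerAr -[_ *: _]addr0; apply: CD => //; rewrite /nzb bb_mul /=.
have := nzbP t; rewrite /nzb; case: t => [[v' s] /= _] nz.
by have [vv|//] := eqVneq v v'; apply: Cb; rewrite vv.
Qed.

End MonomialQuotient.

Section HomotopyLinear.
Variables (K : fieldType) (B : algType K) (X : finType) (b : X -> B).
Variables (kap : X -> X -> X -> B) (D : X -> {linear B -> B}) (P : pred X) (x z : X).

(** The left side of the axiom [wx_hom] as a function of [y]. Its linearity, proved once, reduces
    the axiom to basis elements both for the algebra and for its Ext algebra. *)
Definition hom_lhs (y : B) : B :=
  D x (b z * y) + (if x == z then \sum_(x' | P x') b x' * D x' y else 0)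
  - \sum_(x' | P x') kap z x x' * D x' y.

Lemma hom_lhs_linear c y y' : hom_lhs (c *: y + y') = c *: hom_lhs y + hom_lhs y'.
Proof.
have lin (g : X -> B) : \sum_(x' | P x') g x' * D x' (c *: y + y') =
    c *: (\sum_(x' | P x') g x' * D x' y) + \sum_(x' | P x') g x' * D x' y'.
  rewrite scaler_sumr -big_split; apply: eq_bigr => i _.
  by rewrite linearP mulrDr scalerAr.
rewrite /hom_lhs lin mulrDr -scalerAr linearP !scalerDr scalerN.
case: eqP => _; rewrite ?lin ?scaler0 ?addr0.
  by rewrite [X in X - _]addrACA opprD [LHS]addrACA.
by rewrite opprD [LHS]addrACA.
Qed.

End HomotopyLinear.

Section LenGrading.
Variables (K : fieldType) (Q : quiver) (L : algType K).
Variable phi : {lrmorphism path_alg K Q -> L}.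

Lemma len_homogeneousM m n (x y : path_alg K Q) :
  len_homogeneous m x -> len_homogeneous n y -> len_homogeneous (m + n) (x * y).
Proof.
move=> hx hy p; rewrite /= /conv => nz.
have : exists i : 'I_(plen p).+1, pa_fun x (ptake i p) * pa_fun y (pdrop i p) != 0.
  apply: contrapT => nex; case/negP: nz; apply/eqP/big1 => i _.
  by apply/eqP/negPn/negP => h; case: nex; exists i.
case=> i; rewrite mulf_eq0 negb_or => /andP[/hx + /hy].
by rewrite plen_drop plen_take -1?ltnS // => <- <-; rewrite subnKC // -ltnS.
Qed.

Lemma len_homogeneous_pe v s : len_homogeneous (size s) (pe K (Q := Q) v s).
Proof. by move=> p; rewrite pe_fun /plen; case: (eqVneq (path_val p)) => [->|]; rewrite ?eqxx. Qed.

Lemma len_grading_pe v s : len_grading phi (size s) (phi (pe K v s)).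
Proof. by exists (pe K v s) => //; apply: len_homogeneous_pe. Qed.

Lemma pos_part_mul n x y : len_grading phi n x -> pos_part (len_grading phi) y ->
  pos_part (len_grading phi) (x * y) /\ pos_part (len_grading phi) (y * x).
Proof.
move=> [a ha <-]; apply: (sums_of_ind (C := fun y => _ (_ * y) /\ _ (y * _))).
- by rewrite mulr0 mul0r; split; apply: sums_of0.
- by move=> u w [h1 h2] [h3 h4]; rewrite mulrDr mulrDl; split; apply: sums_ofD.
move=> _ [m m0 [b hb <-]]; rewrite -!rmorphM.
split; apply: sums_of_in; [exists (n + m)%N|exists (m + n)%N] => //; try lia.
- by exists (a * b) => //; apply: len_homogeneousM.
- by exists (b * a) => //; apply: len_homogeneousM.
Qed.

End LenGrading.

Section MonomialResolution.
Variables (K : fieldType) (Q : quiver) (I : set (path_alg K Q)).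
Variables (L : algType K) (phi : {lrmorphism path_alg K Q -> L}).
Hypotheses (admI : admissible I) (monI : monomial_ideal I) (quoI : is_quotient I phi).
Variables (L0 : lmodType L^c) (pi : {linear (L^c)^o -> L0}).
Hypothesis piP : is_degree0_module (len_grading phi) pi.

Local Notation bb := (bb phi).

Definition nzl : finType := seq_sub [seq x <- nzs admI quoI | x.2 != [::]].

Definition lsq (x : nzl) : seq (arrow Q) := (val x).2.

Lemma nzl_neq0 (x : nzl) : lsq x != [::].
Proof. by have := valP x; rewrite mem_filter => /andP[]. Qed.

Lemma nzl_bb (x : nzl) : bb (val x).1 (val x).2 != 0.
Proof.
by have := valP x; rewrite mem_filter {2}[val x]surjective_pairing mem_nzs => /andP[].
Qed.

Lemma nzl_exists v s : s != [::] -> bb v s != 0 -> exists x : nzl, val x = (v, s).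
Proof.
move=> s0 nz.
have h : (v, s) \in [seq x <- nzs admI quoI | x.2 != [::]].
  by rewrite mem_filter s0 mem_nzs.
by exists (SeqSub h).
Qed.

Definition lsrc (x : nzl) : vertex Q := (val x).1.
Definition ltgt (x : nzl) : vertex Q := walk_end (val x).1 (val x).2.
Definition lbb (x : nzl) : L := bb (val x).1 (val x).2.

(* After the tail [u], the next tails are the paths [x] minimal with [u x = 0]. *)
Definition lnxt (s : vertex Q + nzl) (x : nzl) : bool :=
  match s with
  | inl v => (lsrc x == v) && (size (lsq x) == 1)
  | inr u => [&& lsrc x == ltgt u, bb (lsrc u) (lsq u ++ lsq x) == 0
              & bb (lsrc u) (lsq u ++ take (size (lsq x)).-1 (lsq x)) != 0]
  end.

Lemma bb_cat0 v s t : bb v s = 0 -> bb v (s ++ t) = 0.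
Proof. by rewrite bb_cat => ->; rewrite mul0r. Qed.

(** After a vertex both letters are single arrows. After a tail, if [z] properly extended [x], then
    [z] without its last arrow would already be killed, against its minimality. So a path begins
    with at most one admissible letter. *)
Lemma lnxt_prefix s x z : lnxt s x -> lnxt s z ->
  prefix (lsq x) (lsq z) -> x = z.
Proof.
move=> sx sz xz.
have h1 : lsrc x = lsrc z.
  by case: s sx sz => [v|u] /= => [/andP[/eqP-> _] /andP[/eqP-> _]
                                  |/and3P[/eqP-> _ _] /and3P[/eqP-> _ _]].
suff h2 : lsq x = lsq z.
  by apply: val_inj; rewrite [val x]surjective_pairing -/(lsq x) h2 -/(lsrc x) h1 -surjective_pairing.
have [t def_z] : exists t, (lsq z) = lsq x ++ t by apply/prefixP.
case: s sx sz => [v|u] /= => [/andP[_ /eqP sx] /andP[_ /eqP]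
                             |/and3P[_ /eqP xu0 _] /and3P[_ _]].
  by rewrite def_z size_cat sx => /eqP; rewrite eqSS size_eq0 => /eqP->; rewrite cats0.
rewrite def_z; case/lastP: t {def_z} => [|t a]; first by rewrite cats0.
rewrite -rcons_cat size_rcons /= -cats1 take_size_cat // catA.
by rewrite bb_cat0 ?eqxx.
Qed.

Lemma lnxt_prefix2 s x z t : lnxt s x -> lnxt s z ->
  prefix (lsq x) t -> prefix (lsq z) t -> x = z.
Proof.
move=> sx sz; rewrite !prefixE => /eqP xt /eqP zt.
have [le|/ltnW le] := leqP (size (lsq x)) (size (lsq z)).
  by apply: (lnxt_prefix sx sz); rewrite prefixE -zt take_takel // xt.
by apply/esym/(lnxt_prefix sz sx); rewrite prefixE -xt take_takel // zt.
Qed.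

(** The letter is the shortest prefix of [t] that [u] kills; it is not empty because [u] is a
    non-zero path. *)
Lemma lnxt_exists u t : bb (ltgt u) t != 0 ->
  bb (lsrc u) (lsq u ++ t) = 0 -> exists2 x, lnxt (inr u) x & prefix (lsq x) t.
Proof.
move=> nzt zut.
have ex : exists j, bb (lsrc u) (lsq u ++ take j t) == 0.
  by exists (size t); rewrite take_size zut.
case: (ex_minnP ex) => j /eqP zj minj.
have j0 : (0 < j)%N.
  rewrite lt0n; apply/eqP => j0; have := nzl_bb u.
  by move: zj; rewrite j0 take0 cats0 /lsrc => ->; rewrite eqxx.
have jt : (j <= size t)%N by apply: minj; rewrite take_size zut.
have nzj : bb (ltgt u) (take j t) != 0.
  by apply: contraNN nzt => /eqP h; rewrite -[t](cat_take_drop j) bb_cat0.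
have [|x xP] := nzl_exists _ nzj.
  by rewrite -size_eq0 size_takel // -lt0n.
exists x; last by rewrite /lsq xP prefixE size_takel ?eqxx.
rewrite /lnxt {1}/lsrc /lsq xP -/(lsq u) -[(_, take j t).1]/(ltgt u) -[(_, take j t).2]/(take j t).
rewrite eqxx zj eqxx size_takel // take_takel ?leq_pred //.
by apply/negP => /minj; lia.
Qed.

Lemma pi_ker y : pi y = 0 <-> pos_part (len_grading phi) y.
Proof. by case: piP => _ h; apply: h. Qed.

Lemma pos_part_bb v s : s != [::] -> pos_part (len_grading phi) (bb v s).
Proof.
move=> s0; apply: sums_of_in; exists (size s); first by rewrite lt0n size_eq0.
exact: len_grading_pe.
Qed.

(** An admissible pair of tails already has product 0, so there is nothing to rewrite. *)
Definition lkap (z r x : nzl) : L := 0.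

Lemma monomial_axioms : exists D : nzl -> {linear L -> L},
  word_axioms (fun v => bb v [::]) lbb lsrc ltgt lnxt lkap (fun x => D x) pi.
Proof.
have [D0 D0P] := deletion_exists admI monI quoI.
pose D (x : nzl) := D0 (val x); exists D.
have DP x v s : D x (bb v s) = if [&& bb v s != 0, v == lsrc x & prefix (lsq x) s]
    then bb (ltgt x) (drop (size (lsq x)) s) else 0 by apply: D0P.
have lin0 (P : pred nzl) (c : K) y y' :
    \sum_(x | P x) lbb x * D x (c *: y + y') =
    c *: (\sum_(x | P x) lbb x * D x y) + \sum_(x | P x) lbb x * D x y'.
  rewrite scaler_sumr -big_split; apply: eq_bigr => i _.
  by rewrite linearP mulrDr scalerAr.
have one (x : nzl) t : lbb x * bb (ltgt x) t = bb (lsrc x) (lsq x ++ t).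
  by rewrite /lbb bb_mul eqxx.
have pick (s : vertex Q + nzl) v t x : (forall x, lnxt s x -> lsrc x = v) ->
    bb v t != 0 -> lnxt s x -> prefix (lsq x) t ->
    \sum_(x | lnxt s x) lbb x * D x (bb v t) = bb v t.
  move=> sv nzt sx xt; rewrite (bigD1 x) //= DP nzt (sv x sx) eqxx xt /=.
  rewrite one big1 ?addr0.
    by rewrite sv //; case/prefixP: xt => w ->; rewrite drop_size_cat.
  move=> z /andP[sz zx]; rewrite DP; case: and3P => [[_ _ zt]|_]; last by rewrite mulr0.
  by rewrite (lnxt_prefix2 sz sx zt xt) eqxx in zx.
split.
- by move=> v v'; rewrite bb_mul /=.
- by rewrite -raddf_sum pe_sum1; apply: rmorph1.
- by move=> x; rewrite /lbb bb_mul /= eqxx.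
- by move=> x; rewrite /lbb bb_mul /= eqxx cats0.
- by case=> [v|u] x /= => [/andP[/eqP]|/and3P[/eqP]].
- by move=> z r x; rewrite mulr0.
- by move=> x y y'; rewrite linearD.
- move=> x y; have h : bb (ltgt x) [::] * bb (ltgt x) [::] = bb (ltgt x) [::].
    by rewrite bb_mul eqxx.
  have [c ->] := nzb_span admI quoI y; rewrite linear_sum mulr_sumr.
  apply: eq_bigr => t _; rewrite linearZ -scalerAr DP.
  by case: ifP => _; rewrite ?mulr0 // bb_mul eqxx.
- move=> v y vy /pi_ker ypos; rewrite -vy.
  move: ypos; apply: (sums_of_ind (C := fun y =>
     \sum_(x | lnxt (inl v) x) lbb x * D x (bb v [::] * y) = bb v [::] * y)).
  + by rewrite mulr0 big1 // => x _; rewrite linear0 mulr0.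
  + move=> y1 y2 h1 h2; rewrite mulrDr -[bb v [::] * y1]scale1r lin0.
    by rewrite h1 h2.
  move=> _ [n n0 [z hz <-]].
  have [r [_ ->]] := path_alg_sum z; rewrite phi_lin_sum mulr_sumr.
  apply: (big_ind (fun y => \sum_(x | lnxt (inl v) x) lbb x * D x y = y)).
  + by rewrite big1 // => x _; rewrite linear0 mulr0.
  + by move=> y1 y2 h1 h2; rewrite -[y1]scale1r lin0 h1 h2.
  move=> p _; have [->|/hz zp] := eqVneq (pa_fun z p) 0.
    by rewrite scale0r mulr0 big1 // => x _; rewrite linear0 mulr0.
  rewrite -scalerAr pelt_pe -/(bb _ _) bb_mul /=.
  have [->|nz] := eqVneq (if v == (path_val p).1 then bb v (path_val p).2 else 0) 0.
    by rewrite scaler0 big1 // => x _; rewrite linear0 mulr0.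
  move: nz; case: (eqVneq v) => [_ nz|]; last by rewrite eqxx.
  rewrite -[_ *: _]addr0 lin0 [X in _ + X = _]big1 ?addr0; last by move=> x _; rewrite linear0 mulr0.
  congr (_ *: _); move: zp nz; rewrite /plen.
  case: (path_val p).2 => [|a s] zp nz; first by rewrite -zp in n0.
  have nza : bb v [:: a] != 0.
    by apply: contraNN nz => /eqP h; rewrite -[a :: s]/([:: a] ++ s) bb_cat0.
  have [x xP] := nzl_exists (isT : [:: a] != [::]) nza.
  apply: (pick (inl v) v (a :: s) x) => //; rewrite /= ?/lsrc ?/lsq ?xP //= ?eqxx ?prefix0s //.
  by move=> x' /andP[/eqP].
- move=> s x z y sz sx zy.
  rewrite -[LHS]/(hom_lhs lbb lkap D (lnxt (inr z)) x z y).
  move: zy; apply: (bb_left_ind admI quoI (v := ltgt z)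
    (C := fun y => hom_lhs lbb lkap D (lnxt (inr z)) x z y = if x == z then y else 0)).
  + have := hom_lhs_linear lbb lkap D (lnxt (inr z)) x z (-1) 0 0.
    by rewrite scaler0 addr0 scaleN1r addNr => ->; rewrite if_same.
  + move=> c y1 y2 h1 h2; rewrite hom_lhs_linear h1 h2; case: ifP => // _.
    by rewrite scaler0 addr0.
  move=> t nzt; rewrite /hom_lhs [X in _ - X]big1 ?subr0; last by move=> i _; rewrite mul0r.
  rewrite one DP.
  (* If [z t] is non-zero, deleting [z] gives back [t], and [t] starts with no letter admissible
     after [z]. If [z t] is zero, [t] starts with exactly one such letter and the inner sum restores
     [t]. *)
  have [zt0|nzzt] := eqVneq (bb (lsrc z) (lsq z ++ t)) 0; last first.
    have [->|xz] := eqVneq x z.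
      rewrite eqxx prefix_prefix drop_size_cat //= big1 ?addr0 // => x' zx'.
      rewrite DP nzt; case: and3P => [[_ _ /prefixP[w def_t]]|_]; last by rewrite mulr0.
      case/and3P: zx' => _ /eqP h _; case/eqP: nzzt.
      by rewrite def_t catA bb_cat0.
    rewrite addr0; case: and3P => // -[_ _ xzt]; case/eqP: xz.
    exact: lnxt_prefix2 sx sz xzt (prefix_prefix _ _).
  rewrite add0r; case: (eqVneq x z) => // _.
  have [x' zx' x't] := lnxt_exists nzt zt0.
  by apply: pick zx' x't => // x'' /and3P[/eqP].
- by move=> *; rewrite mul0r linear0.
- move=> s z x sz zx; rewrite big1; last by move=> r _; rewrite mulr0.
  case/and3P: zx => /eqP zx /eqP h _.
  by rewrite /lbb bb_mul -/(ltgt z) -/(lsrc x) zx eqxx h.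
- by move=> *; rewrite mul0r.
- by move=> *; rewrite mul0r.
- by case: piP.
- by move=> x; apply/pi_ker/pos_part_bb/nzl_neq0.
- move=> v y /pi_ker h; apply/pi_ker.
  exact: (proj1 (pos_part_mul (len_grading_pe phi v [::]) h)).
Qed.

End MonomialResolution.

Notation path_axioms phi admI quoI pi D := (word_axioms (fun v => bb phi v [::])
  (@lbb _ _ _ _ _ admI quoI) (@lsrc _ _ _ _ _ admI quoI) (@ltgt _ _ _ _ _ admI quoI)
  (@lnxt _ _ _ _ _ admI quoI) (@lkap _ _ _ _ _ admI quoI) (fun x => D x) pi).

Section ColumnRadical.
Variables (B : nzRingType) (J : set B) (W : finType) (e : W -> B).
Hypothesis e_idem : forall w, e w * e w = e w.

Lemma column_radical (f : column e) : (forall w, J (cev f w)) ->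
  radical_of J (f : (column e : lmodType B^c)).
Proof.
move=> Jf; rewrite [f](column_sum e_idem); apply: sums_of_sum => w _.
by apply: sums_of_in; exists (cgen e_idem w), (cev f w).
Qed.

Lemma radical_column (f : column e) w : J 0 -> (forall x y, J x -> J y -> J (x + y)) ->
  (forall x y, J y -> J (x * y)) ->
  radical_of J (f : (column e : lmodType B^c)) -> J (cev f w).
Proof.
move=> J0 JD JM; apply: (sums_of_ind (C := fun f : column e => J (cev f w))).
- by rewrite cev0.
- by move=> f1 f2 h1 h2; rewrite cevD; apply: JD.
- by move=> _ [u [b [Jb ->]]]; rewrite cev_ract; apply: JM.
Qed.

End ColumnRadical.

Section MonomialLengths.
Variables (K : fieldType) (Q : quiver) (I : set (path_alg K Q)).
Variables (L : algType K) (phi : {lrmorphism path_alg K Q -> L}).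
Hypotheses (admI : admissible I) (monI : monomial_ideal I) (quoI : is_quotient I phi).
Variables (L0 : lmodType L^c) (pi : {linear (L^c)^o -> L0}).

Local Notation bb := (bb phi).
Local Notation nzl := (nzl admI quoI).
Local Notation J := (pos_part (len_grading phi)).

Variable D : nzl -> {linear L -> L}.
Hypothesis ax : path_axioms phi admI quoI pi D.

Local Notation lword := (word (@lnxt _ _ _ _ _ admI quoI)).
Definition lres : resolution L0 := word_resolution ax.
Definition lgen n (w : lword n) : lres n := cgen (we_idem ax (n := n)) w.

Lemma lres_linear_eq n (M : lmodType L^c) (f g : {linear lres n -> M}) :
  (forall w, f (lgen w) = g (lgen w)) -> f =1 g.
Proof. exact: column_linear_eq. Qed.

Fixpoint wst n : lword n -> vertex Q :=
  match n with 0 => fun v => v | n'.+1 => fun p => wst (wpre p) end.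

Fixpoint wsq n : lword n -> seq (arrow Q) :=
  match n with
  | 0 => fun _ => [::]
  | n'.+1 => fun p => wsq (wpre p) ++ lsq (wlet p)
  end.

Lemma wsqS n (p : lword n.+1) : wsq p = wsq (wpre p) ++ lsq (wlet p).
Proof. by []. Qed.

Lemma wstS n (p : lword n.+1) : wst p = wst (wpre p).
Proof. by []. Qed.

Lemma wend n (w : lword n) :
  walk_end (wst w) (wsq w) = send (@ltgt _ _ _ _ _ admI quoI) (wlast w).
Proof.
elim: n w => [//|n IHn] w; rewrite wsqS walk_end_cat IHn wlastS.
by rewrite -(wx_nxt ax (wlet_nxt w)).
Qed.

Lemma wwalk n (w : lword n) : walk (wst w) (wsq w).
Proof.
elim: n w => [//|n IHn] w; rewrite wsqS walk_cat wstS IHn wend.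
by rewrite -(wx_nxt ax (wlet_nxt w)); apply: bb_walk (nzl_bb (wlet w)).
Qed.

Lemma pos_part_supp y : J y ->
  exists2 z, phi z = y & forall p, plen p = 0%N -> pa_fun z p = 0.
Proof.
apply: (sums_of_ind (C := fun y => exists2 z, phi z = y & _)).
- by exists 0; rewrite ?raddf0.
- move=> y1 y2 [z1 <- h1] [z2 <- h2]; exists (z1 + z2); first exact: raddfD.
  by move=> p p0; rewrite pa_funD h1 // h2 // addr0.
- move=> _ [n n0 [z hz <-]]; exists z => // p p0.
  by apply/eqP/negPn/negP => /hz; rewrite p0 => n1; rewrite -n1 in n0.
Qed.

(** A preimage supported in positive length would differ from the trivial path by an element of the
    ideal whose support contains that trivial path, but admissibility excludes paths of length at
    most 1 from the ideal. *)
Lemma vertex_pos_part v : ~ J (bb v [::]).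
Proof.
move=> /pos_part_supp[z zv z0].
have h : phi (z - pe K v [::]) = 0 by rewrite raddfB; apply/eqP; rewrite subr_eq0; apply/eqP.
have vP : walk v [::] by [].
have := phi_supp monI quoI (p := QPath (path_val := (v, [::])) vP) h.
rewrite pa_funD z0 // add0r -[- _]scaleN1r pa_funZ pe_fun eqxx mulr1 oppr_eq0 oner_eq0.
by move=> /(_ isT) /= /eqP; apply/negP; apply: (bb_short admI quoI).
Qed.

Lemma pos_partM u y : J y -> J (u * y) /\ J (y * u).
Proof.
move=> Jy; have [c ->] := nzb_span admI quoI u.
apply: (big_ind (fun u => J (u * y) /\ J (y * u))).
- by rewrite mul0r mulr0; split; apply: sums_of0.
- by move=> u1 u2 [? ?] [? ?]; rewrite mulrDl mulrDr; split; apply: sums_ofD.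
move=> t _; apply: (pos_part_mul (n := size (val t).2)) => //.
exists (c t *: pe K (val t).1 (val t).2); last exact: linearZ.
move=> p; rewrite pa_funZ mulf_eq0 negb_or => /andP[_].
exact: len_homogeneous_pe.
Qed.

Lemma lres_minimal : minimal_resolution J lres.
Proof.
move=> n x; apply: column_radical; first exact: (we_idem ax).
move=> w; rewrite [cev _ _]cev_wd /wd_fun.
rewrite [X in _ - X](_ : _ = 0); last first.
  by case: n x w => [|n] x w //; rewrite wcorrS big1 // => p _; rewrite mul0r.
rewrite subr0; apply: sums_of_sum => p _.
by apply: (proj2 (pos_partM _ _)); apply/pos_part_bb/nzl_neq0.
Qed.

Lemma lres_radical n (x : lres n) w : radical_of J x -> J (cev x w).
Proof.
apply: radical_column; [exact: sums_of0|by move=> ? ?; apply: sums_ofD|].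
by move=> y z /(pos_partM y)[].
Qed.

(** Excluding a chain of the wrong length ends in a contradiction with this. *)
Lemma lgen_radical n (w : lword n) : ~ radical_of J (lgen w).
Proof.
move/(lres_radical w); rewrite [cev _ _]cev_gen eqxx; exact: vertex_pos_part.
Qed.

Lemma lres_d_gen n (p : lword n.+1) :
  res_d lres n (lgen p) = ract (lgen (wpre p)) (bb (lsrc (wlet p)) (lsq (wlet p))).
Proof.
apply: columnP => w; rewrite cev_ract [LHS]cev_wd /wd_fun.
rewrite [X in _ - X](_ : _ = 0); last first.
  by case: n p w => [|n] p w //; rewrite wcorrS big1 // => q _; rewrite mul0r.
rewrite subr0 [cev (lgen _) w]cev_gen; case: (eqVneq w) => [->|wp].
  rewrite (bigD1 p) //= [cev _ p]cev_gen eqxx big1 ?addr0.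
    by rewrite (b_we ax) (we_b ax p).
  by move=> q /andP[_ /negPf qp]; rewrite [cev _ q]cev_gen qp mulr0.
rewrite mul0r big1 // => q /eqP qw; rewrite [cev _ q]cev_gen.
case: eqP => [qp|_]; last by rewrite mulr0.
by rewrite -qw qp eqxx in wp.
Qed.

Lemma lgen_e n (w : lword n) :
  ract (lgen w) (bb (walk_end (wst w) (wsq w)) [::]) = lgen w.
Proof. by rewrite wend; apply: cgen_e. Qed.

Lemma lres_eps_gen (v : lword 0) : res_eps lres (lgen v) = pi (bb v [::]).
Proof.
rewrite [LHS]wepsE (bigD1 (v : vertex Q)) //= [cev _ _]cev_gen eqxx big1 ?addr0 //.
by move=> v' /negPf vv; rewrite [cev _ _]cev_gen vv.
Qed.

End MonomialLengths.

(** * Degrees of generators against lengths of chains *)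

Section GradedComparison.
Variables (K : fieldType) (Q : quiver) (I : set (path_alg K Q)).
Variables (L : algType K) (phi : {lrmorphism path_alg K Q -> L}).
Hypotheses (admI : admissible I) (monI : monomial_ideal I) (quoI : is_quotient I phi).
Variables (L0 : lmodType L^c) (pi : {linear (L^c)^o -> L0}).

Local Notation bb := (bb phi).
Local Notation nzl := (nzl admI quoI).
Local Notation J := (pos_part (len_grading phi)).

Variable D : nzl -> {linear L -> L}.
Hypothesis ax : path_axioms phi admI quoI pi D.

Local Notation lword := (word (@lnxt _ _ _ _ _ admI quoI)).
Local Notation lres := (lres ax).
Local Notation lgen := (@lgen _ _ _ _ _ admI quoI _ _ _ ax _).

Variables (P : resolution L0) (H : forall n : nat, int -> set (P n)).
Arguments H : clear implicits.
Hypothesis mH : minimal_graded (len_grading phi) H.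

Lemma H_direct n : direct_sum (H n). Proof. by case: mH => h _ _ _; case: (h n). Qed.

Lemma H_ract n i x m b : H n i x -> len_grading phi m b -> H n (i + m%:Z) (ract x b).
Proof. by case: mH => h _ _ _; case: (h n) => _; apply. Qed.

Lemma H_ract_e n i x v : H n i x -> H n i (ract x (bb v [::])).
Proof.
by move=> /H_ract-/(_ _ _ (len_grading_pe phi v [::])); rewrite addr0.
Qed.

(** Since [res_d] preserves degrees, the component of degree [i] of the preimage [z] is still a
    preimage. *)
Lemma component_lift n i (t : P n) (z : P n.+1) : H n i t -> res_d P n z = t ->
  exists2 y, H n.+1 i y & res_d P n y = t.
Proof.
move=> Ht dz; have [_ /(_ z)[s [f [us Hf def_z]]] _] := H_direct n.+1.
have Hd : forall j, H n j (res_d P n (f j)).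
  by move=> j; case: mH => _ h _ _; apply: h.
have def_t : t = \sum_(j <- s) res_d P n (f j) by rewrite -dz def_z linear_sum.
have := direct_sum_component (H_direct n) Ht us Hd def_t.
case: ifP => _ ->; first by exists (f i).
by exists 0; rewrite ?linear0 //; exact: (direct_sum0 (H_direct _)).
Qed.

Lemma component_lift_eps (t : L0) :
  exists2 y, H 0%N 0 y & res_eps P y = t.
Proof.
have [z <-] := res_eps_surj P t.
have [_ /(_ z)[s [f [us Hf def_z]]] _] := H_direct 0.
have e0 j : j != 0 -> res_eps P (f j) = 0.
  by move=> j0; case: mH => _ _ h _; apply: h j0.
exists (if 0 \in s then f 0 else 0).
  by case: ifP => // _; exact: (direct_sum0 (H_direct _)).
rewrite def_z linear_sum; case: ifP => s0.
  rewrite (bigD1_seq 0) //= [X in _ + X]big1 ?addr0 // => j; exact: e0.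
rewrite linear0 big1_seq // => j /andP[_ js]; apply: e0.
by apply: contraFN s0 => /eqP <-.
Qed.

(** In the chain resolution the boundary of a generator is the previous generator times a path whose
    length is the growth of [wsq]. So once a map is homogeneous on generators, the next lift can be
    chosen homogeneous by [component_lift]. *)
Lemma graded_chain_map : exists2 F : forall n, {linear lres n -> P n}, chain_map F &
  forall n (w : lword n), H n (size (wsq w))%:Z (F n (lgen w)).
Proof.
pose Qd n (F : {linear lres n -> P n}) :=
  forall w : lword n, H n (size (wsq w))%:Z (F (lgen w)).
apply: (@chain_map_rec _ _ lres P Qd).
- have /choice[y yP] : forall v, exists y, H 0%N 0 y /\ res_eps P y = pi (bb v [::]).
    by move=> v; have [y ? ?] := component_lift_eps (pi (bb v [::])); exists y.
  (* The factor makes the image invariant under the idempotent of the generator, as [colmap_gen]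
     requires. The degree is unchanged because a vertex has degree 0. *)
  pose x (v : lword 0) := ract (y v) (bb v [::]).
  have xe v : ract (x v) (bb v [::]) = x v by rewrite /x ractA bb_mul eqxx.
  pose F0 : {linear lres 0 -> P 0%N} := @colmap _ _ _ _ x.
  have F0g v : F0 (lgen v) = x v by apply: colmap_gen; apply: xe.
  exists F0 => [v|f]; first by rewrite F0g; apply: H_ract_e; case: (yP v).
  pose F0e : {linear lres 0 -> L0} := (res_eps P \o F0)%FUN.
  apply: (lres_linear_eq (f := F0e)) => v; rewrite -[F0e _]/(res_eps P (F0 (lgen v))).
  rewrite F0g linear_ract (proj2 (yP v)) -pi_ract bb_mul eqxx.
  by rewrite -(lres_eps_gen ax).
move=> n F QF Fc.
have /choice[y yP] : forall w : lword n.+1, exists y,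
    H n.+1 (size (wsq w))%:Z y /\ res_d P n y = F (res_d lres n (lgen w)).
  move=> w; set t := F _.
  have Ht : H n (size (wsq w))%:Z t.
    rewrite /t lres_d_gen linear_ract wsqS size_cat PoszD.
    by apply: H_ract; [apply: QF|apply: len_grading_pe].
  have /cycle_boundary[z dz] : is_cycle t by apply/Fc/boundary_cycle.
  by have [y ? ?] := component_lift Ht (esym dz); exists y.
pose e (w : lword n.+1) := bb (walk_end (wst w) (wsq w)) [::].
pose x (w : lword n.+1) := ract (y w) (e w).
pose F' : {linear lres n.+1 -> P n.+1} := @colmap _ _ _ _ x.
have F'g w : F' (lgen w) = x w.
  by apply: colmap_gen; rewrite /x /e (wend ax) ractA /we bb_mul eqxx.
exists F' => [w|f]; first by rewrite F'g; apply: H_ract_e; case: (yP w).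
pose dF' : {linear lres n.+1 -> P n} := (res_d P n \o F')%FUN.
pose Fd : {linear lres n.+1 -> P n} := (F \o res_d lres n)%FUN.
apply: (lres_linear_eq (f := dF') (g := Fd)) => w.
rewrite -[dF' _]/(res_d P n (F' (lgen w))) -[Fd _]/(F (res_d lres n (lgen w))).
by rewrite F'g linear_ract (proj2 (yP w)) -!linear_ract (lgen_e ax).
Qed.

Variables (D0 A : nat).
Hypothesis stP : stacked D0 A H.

(** An element of degree [k] times a path of length [m] has degree [k + m] and lies in the radical
    when [m > 0]. In a degree other than [k] only terms with [m > 0] occur. *)
Lemma generated_component n k i (y : P n) : generated_in (H n) k%:Z ->
  H n i%:Z y -> i <> k -> radical_of J y.
Proof.
move=> gen Hy ik.
(* [g m] is the part of degree [k + m]. It vanishes from [N] on, so that two such families can be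
   added over a common range. *)
pose C (y : P n) := exists N (g : nat -> P n),
  [/\ forall m, H n (k%:Z + m%:Z) (g m), forall m, (0 < m)%N -> radical_of J (g m),
      forall m, (N <= m)%N -> g m = 0 & y = \sum_(m < N) g m].
have C0 : C 0.
  exists 0%N, (fun=> 0); rewrite big_ord0; split=> // m; last by move=> _; apply: sums_of0.
  exact: (direct_sum0 (H_direct _)).
have CD y1 y2 : C y1 -> C y2 -> C (y1 + y2).
  move=> [N [g [g1 g2 g3 ->]]] [N' [g' [g1' g2' g3' ->]]].
  exists (maxn N N'), (fun m => g m + g' m); split.
  - by move=> m; apply: direct_sumD => //; apply: H_direct.
  - by move=> m m0; apply: sums_ofD; [apply: g2|apply: g2'].
  - by move=> m; rewrite geq_max => /andP[? ?]; rewrite g3 // g3' // addr0.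
  rewrite big_split /=; congr (_ + _).
    rewrite (big_ord_widen _ g (leq_maxl N N')) [LHS]big_mkcond /=; apply: eq_bigr => m _.
    by case: ltnP => // /g3 ->.
  rewrite (big_ord_widen _ g' (leq_maxr N N')) [LHS]big_mkcond /=; apply: eq_bigr => m _.
  by case: ltnP => // /g3' ->.
have {gen} Cy : C y.
  apply: (sums_of_ind (C := C) C0 CD _ (gen y)) => _ [u [b [Hu ->]]].
  have [c ->] := nzb_span admI quoI b; rewrite ract_sumr.
  apply: (big_ind C) => // t _; set l := size (val t).2.
  have bl : len_grading phi l (c t *: nzb t).
    exists (c t *: pe K (val t).1 (val t).2); last exact: linearZ.
    move=> p; rewrite pa_funZ mulf_eq0 negb_or => /andP[_].
    exact: len_homogeneous_pe.
  exists l.+1, (fun m => if m == l then ract u (c t *: nzb t) else 0); split.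
  - move=> m; case: eqP => [->|_]; first exact: H_ract.
    exact: (direct_sum0 (H_direct _)).
  - move=> m m0; case: eqP => [ml|_]; last exact: sums_of0.
    apply: sums_of_in; exists u, (c t *: nzb t); split=> //.
    by apply: sums_of_in; exists l; rewrite -?ml // ml.
  - by move=> m; case: eqP => // ->; rewrite ltnn.
  by rewrite -big_mkcond (big_pred1 (ord_max : 'I_l.+1)) // => m.
have [N [g [Hg rg _ def_y]]] := Cy.
pose s := [seq k%:Z + m%:Z | m <- index_iota 0 N].
pose g' (j : int) := if (k%:Z <= j)%R then g `|j - k%:Z|%N else 0.
have Hg' j : H n j (g' j).
  rewrite /g'; case: ifP => kj; last exact: (direct_sum0 (H_direct _)).
  by have := Hg `|j - k%:Z|%N; rewrite (_ : k%:Z + _ = j) //; lia.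
have us : uniq s by rewrite map_inj_uniq ?iota_uniq // => m m'; lia.
have := direct_sum_component (H_direct n) Hy us Hg'.
rewrite big_map big_mkord => -> //; last first.
  rewrite def_y; apply: eq_bigr => m _; rewrite /g'; case: ifP => [_|]; last by lia.
  by congr g; lia.
case: ifP => _; last exact: sums_of0.
rewrite /g'; case: ifP => [ki|_]; last exact: sums_of0.
by apply: rg; lia.
Qed.

(* Comparing with the graded resolution, a word of the wrong length would give a
   generator in the radical; above the global dimension, the comparison is with
   a resolution vanishing in degree [n]. *)
Lemma word_length n (w : lword n) : size (wsq w) = delta D0 A n.
Proof.
have mlres := lres_minimal (ax := ax).
have [le_n|] := pselect (le_gldim L^c n); last first.
  move=> /existsNP[m /not_implyP[gm /negP]]; rewrite -ltnNge => mn.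
  have [P' P'0] := gm L0.
  have [F cF] := chain_map_exists lres P'; have [G cG] := chain_map_exists P' lres.
  have := chain_map_radical mlres mlres (chain_map_comp cF cG) (chain_map_id lres) (lgen w).
  rewrite /= (P'0 n mn (F n _)) linear0 sub0r => h; exfalso.
  apply: (lgen_radical monI (ax := ax) (w := w)); rewrite -[lgen w]opprK.
  exact: radicalN.
have [F cF FH] := graded_chain_map.
have [G cG] := chain_map_exists P lres.
have r1 := chain_map_radical mlres mlres (chain_map_comp cF cG) (chain_map_id lres) (lgen w).
apply: contrapT => nd.
have rF := generated_component (stP le_n) (FH n w) nd.
case: (lgen_radical monI (ax := ax) (w := w)).
(* Both [F n (lgen w)] and the defect of the composite of [F] and [G] lie in the radical, hence so
   would [lgen w]. *)
have -> : lgen w = G n (F n (lgen w)) - (G n (F n (lgen w)) - lgen w) by rewrite opprB addrC subrK.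
by apply: sums_ofD; [apply: radical_linear|apply: radicalN].
Qed.

End GradedComparison.

(** * Chains of a stacked monomial algebra *)

Lemma delta_even D A k : delta D A k.*2 = (k * D)%N.
Proof. by case: k => // k; rewrite /delta odd_double doubleK. Qed.

Lemma delta_odd D A k : delta D A k.*2.+1 = if k == 0%N then 1%N else (k * D + A)%N.
Proof. by case: k => // k; rewrite /delta /= odd_double /= doubleK. Qed.

Lemma even_or_odd n : exists k, n = k.*2 \/ n = k.*2.+1.
Proof. by exists n./2; have := odd_double_half n; case: (odd n); [right|left]; lia. Qed.

Section Window.
Variables (Q : quiver) (D0 : nat).

Definition win i (s : seq (arrow Q)) := take D0 (drop i s).

Lemma size_win i s : (i + D0 <= size s)%N -> size (win i s) = D0.
Proof. by move=> h; rewrite size_takel // size_drop; lia. Qed.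

Lemma win_cat i s t : (i + D0 <= size s)%N -> win i (s ++ t) = win i s.
Proof.
rewrite /win; case: (posnP D0) => [->|D1 h]; first by rewrite !take0.
rewrite drop_cat ifT; last by lia.
by rewrite takel_cat // size_drop; lia.
Qed.

Lemma win_drop i j s : win i (drop j s) = win (i + j) s.
Proof. by rewrite /win drop_drop. Qed.

Lemma win_catr i s t : win (size s + i) (s ++ t) = win i t.
Proof. by rewrite addnC -win_drop drop_size_cat. Qed.

Variables (zs : seq (arrow Q) -> bool) (A : nat).

Definition full (s : seq (arrow Q)) : Prop :=
  forall i, (A %| i)%N -> (i + D0 <= size s)%N -> zs (win i s).

(* The [n]-chains, see [word_chain] and [chain_word]. From [n = 4] on there are
   none unless [A %| D0], which [full] alone does not ensure. *)
Definition chain n (s : seq (arrow Q)) : Prop :=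
  [/\ size s = delta D0 A n, full s & (4 <= n)%N -> (A %| D0)%N].

End Window.

Section Windows.
Variables (K : fieldType) (Q : quiver) (I : set (path_alg K Q)).
Variables (L : algType K) (phi : {lrmorphism path_alg K Q -> L}).
Hypotheses (admI : admissible I) (quoI : is_quotient I phi).
Variables (L0 : lmodType L^c) (pi : {linear (L^c)^o -> L0}).

Local Notation bb := (bb phi).
Local Notation nzl := (nzl admI quoI).

Variable D : nzl -> {linear L -> L}.
Hypothesis ax : path_axioms phi admI quoI pi D.

Local Notation lword := (word (@lnxt _ _ _ _ _ admI quoI)).
Local Notation lres := (lres ax).
Local Notation lgen := (@lgen _ _ _ _ _ admI quoI _ _ _ ax _).

Local Notation zs := (zs phi).
Local Notation lnxt := (@lnxt _ _ _ _ _ admI quoI).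

Variables D0 A : nat.
Local Notation win := (win D0).
Hypotheses (D2 : (2 <= D0)%N) (A1 : (1 <= A)%N).
Hypothesis lenP : forall n (w : lword n), size (wsq w) = delta D0 A n.

Lemma zs_win v s i : walk v s -> zs (win i s) -> zs s.
Proof.
move=> ws h.
have def_s : s = take i s ++ win i s ++ drop D0 (drop i s).
  by rewrite !cat_take_drop.
by rewrite def_s; apply: (@zs_cat _ _ _ _ _ admI quoI v) => //; rewrite -def_s.
Qed.

Lemma bb0_zs v s : walk v s -> (bb v s == 0) = zs s.
Proof. by move=> ws; rewrite (zsP admI quoI). Qed.

(* Every minimal zero path is a 2-chain, hence has length [D0]. *)
Lemma minimal_word v s : walk v s -> zs s -> ~~ zs (behead s) ->
  ~~ zs (take (size s).-1 s) ->
  exists w : lword 2, [/\ wst w = v, wsq w = s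
    & exists2 u : nzl, wlast w = inr u & lsq u = behead s].
Proof.
move=> ws z nz1 nz2.
case: s ws z nz1 nz2 => [|a q].
  by move=> _ z; have := zs_short admI quoI (isT : size (Nil (arrow Q)) <= 1)%N; rewrite z.
move=> ws z nz1 nz2; have /= /andP[/eqP va wq] := ws.
have q0 : q != [::].
  by apply: contraTN z => /eqP->; apply: (zs_short admI quoI).
have wa : walk v [:: a] by rewrite /= va eqxx.
have [xa xaP] := nzl_exists admI quoI (isT : [:: a] != [::]) (bb_short admI quoI wa (leqnn _)).
have [|xq xqP] := nzl_exists admI quoI q0 (v := tgt a).
  by rewrite (nz_zs admI quoI) wq.
have n1 : lnxt (wlast (v : lword 0)) xa.
  by apply/andP; rewrite /lsrc /lsq xaP.
pose w1 : lword 1 := wsnoc n1.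
have n2 : lnxt (wlast w1) xq.
  apply/and3P; rewrite /lsrc /ltgt /lsq xaP xqP; split=> //; first by rewrite bb0_zs.
  rewrite -[(v, _).1]/v -[((v, _).2 ++ _)]/(a :: take (size q).-1 q).
  case: q {xqP} q0 wq ws z nz1 nz2 => // b q _ wq ws z nz1 nz2.
  rewrite bb0_zs //; exact: (walk_take (size q).+1 ws).
exists (wsnoc n2); split=> //; first by rewrite /= /lsq xaP xqP.
by exists xq; rewrite /lsq ?xqP.
Qed.

(** Arrows are removed from either end as long as the path stays zero. A zero path that allows no
    removal comes from a word of length 2, so it has [D0] arrows. *)
Lemma zs_window v s : walk v s -> zs s ->
  exists2 i, (i + D0 <= size s)%N & zs (win i s).
Proof.
elim: {s}(size s) {-2}s v (leqnn (size s)) => [|n IHn] s v sn ws z.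
  by have := zs_short admI quoI (leq_trans sn (leq0n 1)); rewrite z.
case: (boolP (zs (behead s))) => [zb|nzb].
  case: s sn ws z zb => [|a q] sn ws z zb; first exact: IHn ws z.
  have /= /andP[_ wq] := ws.
  have [i iq zi] := IHn q _ sn wq zb.
  by exists i.+1 => //; rewrite /win.
case: (boolP (zs (take (size s).-1 s))) => [zt|nzt].
  have [|i it zi] := IHn _ v _ (walk_take (size s).-1 ws) zt.
    by rewrite size_takel ?leq_pred //; lia.
  move: it; rewrite size_takel ?leq_pred // => it.
  exists i; first by lia.
  rewrite -(cat_take_drop (size s).-1 s) win_cat //.
  by rewrite size_takel // leq_pred.
have [w [_ def_w _]] := minimal_word ws z nzb nzt.
have := lenP w; rewrite def_w (delta_even _ _ 1) mul1n => sD.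
by exists 0%N; rewrite ?sD // /win drop0 take_oversize ?sD.
Qed.

Lemma short_nz v s : walk v s -> (size s < D0)%N -> ~~ zs s.
Proof. by move=> ws sD; apply/negP => /(zs_window ws)[i]; lia. Qed.

Lemma relation_word v s : walk v s -> zs s -> size s = D0 ->
  exists w : lword 2, [/\ wst w = v, wsq w = s
    & exists2 u : nzl, wlast w = inr u & lsq u = behead s].
Proof.
move=> ws z sD; apply: minimal_word => //.
  case: s ws sD {z} => [|a q] ws sD; first by rewrite /= in sD; lia.
  by have /= /andP[_ wq] := ws; apply: short_nz wq _; rewrite -sD.
apply: short_nz (walk_take (size s).-1 ws) _.
by rewrite size_takel ?leq_pred //; lia.
Qed.

Lemma lnxt_walk (u x : nzl) : lnxt (inr u) x ->
  walk (lsrc u) (lsq u ++ lsq x) /\ zs (lsq u ++ lsq x).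
Proof.
move=> /and3P[/eqP ux h _].
have w : walk (lsrc u) (lsq u ++ lsq x).
  by rewrite walk_cat (bb_walk (nzl_bb u)) -/(ltgt u) -ux (bb_walk (nzl_bb x)).
by split=> //; rewrite -(bb0_zs w).
Qed.

(** By minimality of [x], dropping the last arrow of [u x] leaves a non-zero path, so a zero window
    must reach the end. *)
Lemma tail_window (u x : nzl) (s : seq (arrow Q) := lsq u ++ lsq x) : lnxt (inr u) x ->
  (D0 <= size s)%N /\ zs (win (size s - D0) s).
Proof.
move=> ux; have [ws z] := lnxt_walk ux; case/and3P: ux => _ _ nz.
have [i iD zi] := zs_window ws z; rewrite -/s in iD zi; split; first by lia.
suff -> : (size s - D0 = i)%N by [].
apply/eqP; rewrite eqn_leq; apply/andP; split; last by lia.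
rewrite leqNgt; apply/negP => lt_i; case/negP: nz.
have x0 : (0 < size (lsq x))%N by rewrite lt0n size_eq0 nzl_neq0.
have sP : s = (lsq u ++ take (size (lsq x)).-1 (lsq x)) ++ drop (size (lsq x)).-1 (lsq x).
  by rewrite -catA cat_take_drop.
have st : size (lsq u ++ take (size (lsq x)).-1 (lsq x)) = (size s).-1.
  by rewrite /s !size_cat size_takel ?leq_pred // -!subn1 addnBA.
have wt : walk (lsrc u) (lsq u ++ take (size (lsq x)).-1 (lsq x)).
  by move: ws; rewrite -/s sP walk_cat => /andP[].
rewrite bb0_zs //; apply: (zs_win (i := i) wt).
by move: zi; rewrite sP win_cat // st; lia.
Qed.

Lemma word_window n (w : lword n.+2) :
  (D0 <= size (wsq w))%N /\ zs (win (size (wsq w) - D0) (wsq w)).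
Proof.
have [sD z] := @tail_window (wlet (wpre w)) (wlet w) (wlet_nxt w).
rewrite wsqS (wsqS (wpre w)) -catA; split; first by rewrite size_cat; lia.
set s := _ ++ lsq (wlet w) in z sD *; set t := wsq _.
rewrite (_ : (size (t ++ s) - D0 = size t + (size s - D0))%N) ?win_catr //.
by rewrite size_cat; lia.
Qed.

(** The cut points between letters are values of [delta], hence determined by the number of
    letters. *)
Lemma word_eq n (w w' : lword n) : wst w = wst w' -> wsq w = wsq w' -> w = w'.
Proof.
elim: n w w' => [//|n IHn] w w' vv; rewrite !wsqS => /eqP.
rewrite eqseq_cat ?lenP // => /andP[/eqP ss /eqP xx].
have pp : wpre w = wpre w' by apply: IHn.
apply: word_inj => //; apply: val_inj.
rewrite [RHS]surjective_pairing [LHS]surjective_pairing.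
rewrite -/(lsq (wlet w)) -/(lsq (wlet w')) xx; congr (_, _).
by rewrite -[_.1]/(lsrc (wlet w)) -[RHS]/(lsrc (wlet w'))
     (wx_nxt ax (wlet_nxt w)) (wx_nxt ax (wlet_nxt w')) pp.
Qed.

(** The last letter of a word of length 3 has [A] arrows. If [A] were at least [D0], the final zero
    window would fit inside that non-zero letter. *)
Lemma exponent_lt (w : lword 3) : (A < D0)%N.
Proof.
pose u := wlet (wpre w); pose x := wlet w.
have [sD z] := @tail_window u x (wlet_nxt w).
have sx : size (lsq x) = A.
  have := lenP w; rewrite wsqS size_cat lenP (delta_even _ _ 1) mul1n.
  by rewrite (delta_odd _ _ 1) mul1n => /addnI.
have su : size (lsq u) = D0.-1.
  have := lenP (wpre w); rewrite wsqS size_cat lenP (delta_even _ _ 1) mul1n.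
  by rewrite -/u (delta_odd _ _ 0) /=; lia.
rewrite ltnNge; apply/negP => DA; move: z; rewrite size_cat su sx.
rewrite (_ : (D0.-1 + A - D0 = size (lsq u) + (A - D0))%N); last by lia.
rewrite win_catr => /(zs_win (bb_walk (nzl_bb x))); apply/negP.
by have := nzl_bb x; rewrite (nz_zs admI quoI) => /andP[].
Qed.

(* Without words of length 3 the value of [A] is immaterial. *)
Lemma exponent_normalize : exists A', [/\ (1 <= A')%N, (A' < D0)%N,
  forall n (w : lword n), size (wsq w) = delta D0 A' n & (1 < A')%N -> A' = A].
Proof.
have [[w _]|no3] := pselect (exists w : lword 3, True).
  by exists A; split=> //; apply: exponent_lt w.
exists 1%N; split=> // n w; rewrite lenP; case: n w => [|[|[|n]]] // w.
case: no3; elim: n w => [|n IHn] w; first by exists w.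
exact: IHn (wpre w).
Qed.

(** The first relation is a word of length 2. The second forces the rest of [s] to begin with an
    admissible third letter, which has [A] arrows because words of length 3 have [D0 + A]; the final
    zero window of that word starts at [A]. *)
Lemma overlap v s j : walk v s -> size s = (D0 + j)%N -> (0 < j < D0)%N ->
  zs (win 0 s) -> zs (win j s) -> (A <= j)%N /\ zs (win A s).
Proof.
move=> ws sj /andP[j0 jD] z0 zj.
have [w [wv ws2 [u lu u2]]] : exists w : lword 2, [/\ wst w = v, wsq w = win 0 s
    & exists2 u : nzl, wlast w = inr u & lsq u = behead (win 0 s)].
  apply: relation_word => //; last by rewrite size_win; lia.
  by rewrite /win drop0; apply: walk_take.
have def_s : s = win 0 s ++ drop D0 s by rewrite /win drop0 cat_take_drop.
have wu : walk_end v (win 0 s) = ltgt u.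
  by have := wend ax w; rewrite lu wv ws2.
have wd : walk (ltgt u) (drop D0 s) by move: ws; rewrite {1}def_s walk_cat wu => /andP[].
have sw : size (win 0 s) = D0 by rewrite size_win; lia.
have bs : lsq u ++ drop D0 s = behead s.
  by rewrite u2 [in RHS]def_s; case: (win 0 s) sw D2 => [|a q] //= <-.
have sb : size (behead s) = (D0 + j).-1 by rewrite size_behead sj.
have wb : walk (lsrc u) (lsq u ++ drop D0 s).
  by rewrite walk_cat (bb_walk (nzl_bb u)) -/(ltgt u).
have winb i : win i (behead s) = win i.+1 s.
  by rewrite -[behead s]drop1 win_drop addn1.
have [x ux xP] : exists2 x, lnxt (inr u) x & prefix (lsq x) (drop D0 s).
  apply: lnxt_exists.
    by rewrite (nz_zs admI quoI) wd; apply: short_nz wd _; rewrite size_drop; lia.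
  apply/eqP; rewrite bb0_zs //; apply: (zs_win (i := j.-1) wb).
  by rewrite bs winb prednK.
have n3 : lnxt (wlast w) x by rewrite lu.
have := lenP (wsnoc n3); rewrite wsqS (_ : wpre _ = w) // (_ : wlet _ = x) //.
rewrite size_cat ws2 sw (delta_odd _ _ 1) mul1n => /addnI sx.
have [t def_t] := prefixP xP.
split; first by rewrite -sx (leq_trans (size_prefix xP)) // size_drop sj addKn.
have [sD z] := tail_window ux.
have su : size (lsq u) = D0.-1 by rewrite u2 size_behead sw.
move: z; rewrite size_cat su sx (_ : (D0.-1 + A - D0 = A.-1)%N); last by lia.
rewrite -(win_cat t); last by rewrite size_cat su sx; lia.
rewrite -catA -def_t bs winb prednK //.
Qed.

(** Descent on [j - i]: [overlap] supplies the zero window at [i + A], which either is the one at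
    [j] or takes the place of the one at [i]. *)
Lemma overlap_chain v s i j : walk v s -> (i < j)%N -> (j < i + D0)%N ->
  (j + D0 <= size s)%N -> zs (win i s) -> zs (win j s) ->
  (A %| j - i)%N /\ forall k, (i <= k <= j)%N -> (A %| k - i)%N -> zs (win k s).
Proof.
move=> ws; have [m] := ubnP (j - i); elim: m i => // m IHm i jim ij jiD js zi zj.
have wd := walk_take (D0 + (j - i)) (walk_drop i ws).
have wk k : (k <= j - i)%N -> win k (take (D0 + (j - i)) (drop i s)) = win (k + i) s.
  move=> kj; rewrite -(win_drop D0 k i) -[in RHS](cat_take_drop (D0 + (j - i)) (drop i s)).
  by rewrite win_cat // size_takel ?size_drop; lia.
have [||||Aj zA] := overlap (j := j - i) wd.
- by rewrite size_takel // size_drop; lia.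
- by lia.
- by rewrite wk.
- by rewrite wk // subnK // ltnW.
rewrite wk // addnC in zA.
have [ijA|ijA] := eqVneq (i + A)%N j.
  split; first by rewrite -ijA addKn.
  move=> k /andP[ik kj] /dvdnP[q qk].
  have [->|->] : k = i \/ k = j by case: q qk => [|[|q]]; nia.
    by [].
  by [].
have [||||||h1 h2] := IHm (i + A)%N; try by lia.
have ji : (j - i = j - (i + A) + A)%N by lia.
split; first by rewrite ji dvdn_addl.
move=> k /andP[ik kj] Ak.
have [->//|ki] := eqVneq k i.
have Aki : (A <= k - i)%N by apply: dvdn_leq => //; lia.
by apply: h2; [lia|rewrite subnDA dvdn_subl].
Qed.

Hypothesis AD : (A < D0)%N.

Local Notation full := (full D0 zs A).
Local Notation chain := (chain D0 zs A).

(** The final windows of [w] and of its prefix overlap at the distance by which [delta] grows: [A]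
    from an even to an odd number of letters, [D0 - A] from odd to even. In the second case
    [overlap_chain] makes [A] divide [D0 - A]; this is the source of the divisibility in [chain]. *)
Lemma word_full n (w : lword n) : full (wsq w) /\ ((4 <= n)%N -> (A %| D0)%N).
Proof.
elim: n w => [|n IHn] w; first by split=> // i _ /=; lia.
case: n IHn w => [|n] IHn w.
  by split=> // i _; rewrite (lenP w) /delta /=; lia.
have [sD zl] := word_window w.
case: n IHn w sD zl => [|n] IHn w sD zl.
  split=> // i _ iD; rewrite lenP (delta_even _ _ 1) mul1n subnn in zl.
  by rewrite lenP (delta_even _ _ 1) mul1n in iD; rewrite (_ : i = 0%N) //; lia.
have [fw' dw'] := IHn (wpre w); have [sD' zl'] := word_window (wpre w).
have sw := lenP w; have sw' := lenP (wpre w).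
have def_w := wsqS w.
have zp : zs (win (size (wsq (wpre w)) - D0) (wsq w)).
  by rewrite def_w win_cat //; lia.
(* Windows of [w] that do not lie in its prefix start between the two final windows, where
   [overlap_chain] supplies every multiple of [A]. *)
have main : (A %| size (wsq (wpre w)) - D0)%N -> (A %| D0)%N \/ n = 0%N ->
    (size (wsq (wpre w)) < size (wsq w) < size (wsq (wpre w)) + D0)%N ->
    full (wsq w).
  move=> Aw _ /andP[lt1 lt2] i Ai iD.
  have [iw|iw] := leqP (i + D0) (size (wsq (wpre w))).
    by rewrite def_w win_cat //; apply: fw'.
  have [|||_ h] := overlap_chain (wwalk ax w) _ _ _ zp zl; try lia.
  by apply: h; [lia|rewrite dvdn_subr //; lia].
have [k [def_n|def_n]] := even_or_odd n.
- have [n0|n0] := posnP n.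
    have e1 : delta D0 A n.+2 = D0 by rewrite n0 /delta /= mul1n.
    have e2 : delta D0 A n.+3 = (D0 + A)%N by rewrite n0 /delta /= mul1n.
    rewrite e1 in sw'; rewrite e2 in sw; split; last by lia.
    apply: main.
    + by rewrite sw' subnn.
    + by right.
    + by rewrite sw sw'; lia.
  have A4 : (A %| D0)%N by apply: dw'; lia.
  have e1 : delta D0 A n.+2 = (k.+1 * D0)%N by rewrite def_n -(delta_even _ A).
  have e2 : delta D0 A n.+3 = (k.+1 * D0 + A)%N by rewrite def_n (delta_odd _ _ k.+1).
  rewrite e1 in sw'; rewrite e2 in sw; split=> //; apply: main.
  + by rewrite sw' mulSn addKn dvdn_mull.
  + by left.
  + by rewrite sw sw'; lia.
have e1 : delta D0 A n.+2 = (k.+1 * D0 + A)%N by rewrite def_n (delta_odd _ _ k.+1).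
have e2 : delta D0 A n.+3 = (k.+2 * D0)%N by rewrite def_n -(delta_even _ A).
rewrite e1 in sw'; rewrite e2 in sw.
have s1 : size (wsq w) = (size (wsq (wpre w)) + (D0 - A))%N by rewrite sw sw'; lia.
have [|||h _] := overlap_chain (wwalk ax w) _ _ _ zp zl; try by lia.
have A4 : (A %| D0)%N.
  rewrite (_ : D0 = size (wsq w) - D0 - (size (wsq (wpre w)) - D0) + A)%N; last by lia.
  by rewrite dvdn_add.
split=> //; apply: main.
+ by rewrite sw' mulSn -addnA addKn dvdn_add // dvdn_mull.
+ by left.
+ by lia.
Qed.

Lemma full_take i s : full s -> full (take i s).
Proof.
move=> fs j Aj; rewrite size_take_min leq_min => /andP[ji js].
rewrite -(win_cat (drop i s)) ?cat_take_drop; first exact: fs.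
by rewrite size_take_min leq_min ji.
Qed.

Lemma word_chain n (w : lword n) : chain n (wsq w).
Proof. by have [? ?] := word_full w; split. Qed.

Lemma delta_lt n : (delta D0 A n < delta D0 A n.+1)%N.
Proof.
case: n => [|[|n]]; [by []|by rewrite (delta_even _ _ 1) mul1n|].
by have [[|k] [->|->]] := even_or_odd n;
  rewrite -?doubleS ?delta_odd ?delta_even /=; lia.
Qed.

Lemma delta_add2 n : delta D0 A n.+4 = (delta D0 A n.+2 + D0)%N.
Proof.
by have [k [->|->]] := even_or_odd n; rewrite -?doubleS ?delta_odd ?delta_even /=; lia.
Qed.

Lemma delta_dvd n : ((3 <= n.+2)%N -> (A %| D0)%N \/ n = 1%N) ->
  (A %| delta D0 A n.+2 - D0)%N.
Proof.
case: n => [|[|n]] h; first by rewrite /delta /= mul1n subnn.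
  by rewrite /delta /= mul1n addKn.
have [A4|//] := h isT.
rewrite delta_add2 addnK.
by have [k [->|->]] := even_or_odd n; rewrite -?doubleS ?delta_odd ?delta_even /=;
  rewrite ?dvdn_add ?dvdn_mull.
Qed.

(** The chain is cut at the values of [delta]. The work is to show that the last piece is a letter
    admissible after the previous one. *)
Lemma chain_word n v s : walk v s -> chain n s ->
  exists w : lword n, wst w = v /\ wsq w = s.
Proof.
elim: n s => [|n IHn] s ws [ss fs As].
  by exists v; case: s ss {fs As ws}.
case: n IHn ss As => [|n] IHn ss As.
  case: s ws ss fs => [|a [|b s]] // ws _ _.
  have [x xP] := nzl_exists admI quoI (isT : [:: a] != [::])
    (bb_short admI quoI ws (leqnn _)).
  have n1 : lnxt (wlast (v : lword 0)) x.
    by apply/andP; rewrite /lsrc /lsq xP.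
  by exists (wsnoc n1); rewrite /= /lsq xP.
case: n IHn ss As => [|n] IHn ss As.
  rewrite (delta_even _ _ 1) mul1n in ss.
  have zs0 : zs s.
    by have := fs 0%N (dvdn0 A); rewrite /win drop0 take_oversize ?ss //; apply.
  by have [w [? ? _]] := relation_word ws zs0 ss; exists w.
have lt1 : (delta D0 A n.+2 < delta D0 A n.+3)%N by apply: delta_lt.
have lt2 : (delta D0 A n.+3 < delta D0 A n.+2 + D0)%N.
  have [[|k] [->|->]] := even_or_odd n;
    rewrite -?doubleS ?delta_odd ?delta_even /=; nia.
set m := delta D0 A n.+2 in lt1 lt2.
have [|w [wv ws2]] := IHn (take m s) (walk_take m ws).
  split; first by rewrite size_takel // ss ltnW.
    exact: full_take.
  by move=> n4; apply: As; apply: ltnW.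
pose u := wlet w.
have sz : size (drop m s) = (delta D0 A n.+3 - m)%N by rewrite size_drop ss.
have wd : walk (ltgt u) (drop m s).
  by have := wend ax w; rewrite wv ws2 wlastS /= => <-; apply: walk_drop.
have [x xP] : exists x : nzl, val x = (ltgt u, drop m s).
  apply: nzl_exists; first by rewrite -size_eq0 sz; lia.
  by rewrite (nz_zs admI quoI) wd; apply: short_nz wd _; lia.
have def_w := wsqS w; rewrite ws2 in def_w.
have su : size (lsq u) = (m - delta D0 A n.+1)%N.
  by have := lenP w; rewrite wsqS size_cat lenP -/u -/m => <-; rewrite addKn.
have wpe : take m s = wsq (wpre w) ++ lsq u by [].
have def_s : s = wsq (wpre w) ++ (lsq u ++ drop m s).
  by rewrite catA -wpe cat_take_drop.
have wu : walk (lsrc u) (lsq u ++ drop m s).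
  by rewrite walk_cat (bb_walk (nzl_bb u)).
have shift i : win (size (wsq (wpre w)) + i) s = win i (lsq u ++ drop m s).
  by rewrite {1}def_s win_catr.
rewrite lenP in shift.
have hx : lnxt (inr u) x.
  apply/and3P; rewrite {1}/lsrc /lsq xP -/(lsq u); split=> //.
    (* The last window of [s] starts no earlier than [delta n.+1], so it lies in the last two pieces
       and makes their product zero. *)
    have dl : (delta D0 A n.+1 + D0 <= delta D0 A n.+3)%N.
      by case: (n) => [|n']; [rewrite /delta /=; lia|rewrite delta_add2].
    rewrite bb0_zs //; apply: (zs_win (i := delta D0 A n.+3 - D0 - delta D0 A n.+1) wu).
    rewrite -shift subnKC; last by lia.
    apply: fs; last by rewrite ss; lia.
    apply: delta_dvd => _; case: (n) As => [|n'] As; [by right|by left; apply: As].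
  rewrite -[(ltgt u, drop m s).2]/(drop m s).
  have wt : walk (lsrc u) (lsq u ++ take (size (drop m s)).-1 (drop m s)).
    have := walk_take (size (lsq u) + (size (drop m s)).-1) wu.
    by rewrite take_cat ltnNge leq_addr /= addKn.
  (* Minimality: with one arrow less, the last two pieces would still contain a zero window. For
     [n > 0] they have only [D0 - 1] arrows; for [n = 0] the window would overlap the first one at a
     positive distance below [A], against [overlap_chain]. *)
  rewrite bb0_zs //; apply/negP => zt; have [i iD zi] := zs_window wt zt.
  have st : size (lsq u ++ take (size (drop m s)).-1 (drop m s)) =
      (delta D0 A n.+3 - delta D0 A n.+1).-1.
    by rewrite size_cat size_takel ?leq_pred // su sz; have := delta_lt n.+1; lia.
  rewrite st in iD.
  have zi' : zs (win (delta D0 A n.+1 + i) s).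
    rewrite shift -(cat_take_drop (size (drop m s)).-1 (drop m s)) catA win_cat //.
    by rewrite st.
  move: iD zi'; rewrite /m in lt1 lt2; case: (n) ss lt1 lt2 => [|n'] ss' lt1' lt2'.
    move=> iD zi'; have z0 : zs (win 0 s) by apply: fs => //; rewrite ss' /delta /=; lia.
    have [|||] := overlap_chain ws _ _ _ z0 zi'.
    - by [].
    - by move: iD; rewrite /delta /=; lia.
    - by move: iD; rewrite ss' /delta /=; lia.
    by rewrite subn0 => h _; have := dvdn_leq (isT : (0 < delta D0 A 1 + i)%N) h; move: iD; rewrite /delta /=; lia.
  by rewrite delta_add2; lia.
have n3 : lnxt (wlast w) x by [].
exists (wsnoc n3); split; first by rewrite wstS -wv.
by rewrite wsqS (_ : wpre _ = w) // (_ : wlet _ = x) // ws2 /lsq xP cat_take_drop.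
Qed.

(** The delicate case is two odd degrees from 3 on, where [2 * A <= D0] is needed; it follows from
    [A < D0] once [A] divides [D0]. *)
Lemma delta_super m n : ((4 <= m + n)%N -> (A %| D0)%N) ->
  (delta D0 A m + delta D0 A n <= delta D0 A (m + n))%N.
Proof.
move=> h; have A2 : (4 <= m + n)%N -> (A.*2 <= D0)%N.
  by move=> /h /dvdnP[[|[|q]] qP]; nia.
have [i [mi|mi]] := even_or_odd m; have [j [nj|nj]] := even_or_odd n.
- by rewrite mi nj -doubleD !delta_even; lia.
- rewrite mi nj addnS -doubleD !delta_odd delta_even.
  by case: j {nj h A2} => [|j]; rewrite ?addn0 ?addnS /=; case: i {mi} => [|i] /=; nia.
- rewrite mi nj addSn -doubleD !delta_odd delta_even.
  by case: i {mi h A2} => [|i]; rewrite ?add0n ?addSn /=; case: j {nj} => [|j] /=; nia.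
rewrite mi nj addSn addnS -doubleD -doubleS !delta_odd delta_even.
move: A2; rewrite mi nj; case: i {mi} => [|i]; case: j {nj} => [|j] /= A2.
- by lia.
- by have := A2 _; rewrite (_ : (3 < _)%N) => [/(_ isT)|]; nia.
- by have := A2 _; rewrite (_ : (3 < _)%N) => [/(_ isT)|]; nia.
- by have := A2 _; rewrite (_ : (3 < _)%N) => [/(_ isT)|]; nia.
Qed.

(** With two letters more than [m + n], the last window does not reach back into paths of [m] and
    [n] letters placed at the start. *)
Lemma delta_super2 m n : ((2 <= m + n)%N -> (A %| D0)%N) ->
  (delta D0 A m + delta D0 A n + D0 <= delta D0 A (m + n).+2)%N.
Proof.
move=> h; have [m1|] := leqP (m + n) 1.
  have : (m = 0 /\ n = 0) \/ (m = 1 /\ n = 0) \/ (m = 0 /\ n = 1) :> Prop by lia.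
  by move=> [[-> ->]|[[-> ->]|[-> ->]]]; rewrite /delta /=; lia.
move=> mn; have [k def_k] : exists k, (m + n)%N = k.+2 by exists (m + n).-2; lia.
have := @delta_super m n (fun _ => h mn); rewrite def_k delta_add2; lia.
Qed.

End Windows.

Lemma drop_catl (T : Type) m (s t : seq T) : (m <= size s)%N ->
  drop m (s ++ t) = drop m s ++ t.
Proof.
move=> ms; rewrite drop_cat; case: ltngtP ms => // -> _.
by rewrite subnn drop0 drop_size.
Qed.

(** * The Ext algebra *)

Section Lifting.
Variables (K : fieldType) (Q : quiver) (I : set (path_alg K Q)).
Variables (L : algType K) (phi : {lrmorphism path_alg K Q -> L}).
Hypotheses (admI : admissible I) (quoI : is_quotient I phi).
Variables (L0 : lmodType L^c) (pi : {linear (L^c)^o -> L0}).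

Local Notation bb := (bb phi).
Local Notation nzl := (nzl admI quoI).

Variable D : nzl -> {linear L -> L}.
Hypothesis ax : path_axioms phi admI quoI pi D.

Local Notation lword := (word (@lnxt _ _ _ _ _ admI quoI)).
Local Notation lres := (lres ax).
Local Notation lgen := (@lgen _ _ _ _ _ admI quoI _ _ _ ax _).

Variables D0 A : nat.
Hypotheses (D2 : (2 <= D0)%N) (A1 : (1 <= A)%N) (AD : (A < D0)%N).
Hypothesis lenP : forall n (w : lword n), size (wsq w) = delta D0 A n.

Local Notation lnxt := (@lnxt _ _ _ _ _ admI quoI).

Section LiftOf.
Variables (n : nat) (a : lword n).

(* [w] is the path [a], followed by [z], followed by some path. *)
Definition starts k m (z : lword k) (w : lword m) : bool :=
  [&& wst w == wst a, wst z == walk_end (wst a) (wsq a)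
    & prefix (wsq a ++ wsq z) (wsq w)].

Lemma startsP k m (z : lword k) (w : lword m) : reflect
  [/\ wst w = wst a, wst z = walk_end (wst a) (wsq a)
    & prefix (wsq a ++ wsq z) (wsq w)] (starts z w).
Proof. by apply: (iffP and3P) => -[]; [move=> /eqP ? /eqP ?|move=> -> ->]. Qed.

Definition wend_of k (z : lword k) : vertex Q := walk_end (wst z) (wsq z).

Definition rest k m (z : lword k) (w : lword m) : L :=
  if starts z w then bb (wend_of z) (drop (size (wsq a ++ wsq z)) (wsq w)) else 0.

(** Lifts the class dual to [a]: a generator with path [a], then [z], then [t] goes to the generator
    of [z] times [t]. Since [k] fixes the length of [z], at most one [z] contributes. *)
Definition lift_gen k (w : lword (k + n)) : lres k :=
  \sum_(z : lword k) ract (lgen z) (rest z w).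

Definition word_lift k : {linear lres (k + n) -> lres k} :=
  @colmap _ _ _ _ (@lift_gen k).

Lemma starts_end k m (z : lword k) (w : lword m) : starts z w ->
  walk_end (wend_of z) (drop (size (wsq a ++ wsq z)) (wsq w)) = wend_of w.
Proof.
case/startsP=> wa za /prefixP[s def_w].
by rewrite def_w drop_size_cat // /wend_of def_w wa za !walk_end_cat.
Qed.

Lemma starts_walk k m (z : lword k) (w : lword m) : starts z w ->
  walk (wend_of z) (drop (size (wsq a ++ wsq z)) (wsq w)).
Proof.
case/startsP=> wa za /prefixP[s def_w].
have := wwalk ax w; rewrite def_w drop_size_cat // wa !walk_cat walk_end_cat -za.
by rewrite -/(wend_of z) => /andP[].
Qed.

Lemma word_lift_gen k (w : lword (k + n)) : word_lift k (lgen w) = lift_gen w.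
Proof.
apply: colmap_gen; rewrite /lift_gen ract_suml; apply: eq_bigr => z _.
rewrite ractA /we -(wend ax) -/(wend_of w) /rest.
case: ifP => [zw|_]; last by rewrite mul0r.
by rewrite bb_mul (starts_end zw) eqxx cats0.
Qed.

Lemma word_lift_eps (w : lword n) :
  res_eps lres (word_lift 0 (lgen w)) = pi (if w == a then bb (wend_of a) [::] else 0).
Proof.
rewrite word_lift_gen /lift_gen linear_sum.
have [->|wa] := eqVneq w a.
  rewrite (big_only1 (wend_of a : lword 0)) //; last first.
    move=> v /eqP va _; rewrite /rest.
    by case: ifP => [/startsP[_ /va]|_]; rewrite ?ract0r ?linear0.
  rewrite linear_ract (lres_eps_gen ax) -pi_ract.
  by rewrite /rest /starts /= !eqxx cats0 prefix_refl /= drop_size bb_mul eqxx.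
rewrite linear0 big1 // => v _; rewrite /rest.
case: ifP => [|_]; last by rewrite ract0r linear0.
case/startsP => wwa _; rewrite cats0 prefixE lenP -(lenP w) take_size => /eqP wsa.
by case/eqP: wa; apply: (word_eq ax lenP wwa wsa).
Qed.

Hypothesis A4 : forall m, (4 <= m)%N -> lword m -> (A %| D0)%N.

Lemma startsS k m (z : lword k) (w : lword m.+1) :
  (delta D0 A n + delta D0 A k <= delta D0 A m)%N ->
  starts z w = starts z (wpre w).
Proof.
move=> le_m; rewrite /starts; congr [&& _, _ & _].
rewrite !prefixE wsqS takel_cat // size_cat !lenP //.
Qed.

(** By [delta_super2] the last zero window of [w] lies beyond [a] and all letters of [z] but the
    last. So the last letter of [z] kills [t], and [t] begins with the next letter. When [z] is a
    vertex, [t] only has to be non-empty, and [delta] increases. *)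
Lemma rest_zero k (z : lword k) (w : lword (k + n).+1) : starts z w ->
  let t := drop (size (wsq a ++ wsq z)) (wsq w) in
  bb (wend_of z) t != 0 -> exists2 q, lnxt (wlast z) q & prefix (lsq q) t.
Proof.
move=> zw t nzt; have wt : walk (wend_of z) t := starts_walk zw.
have def_w : wsq w = wsq a ++ wsq z ++ t.
  by case/startsP: zw => _ _ /prefixP[s def_w]; rewrite /t {2}def_w drop_size_cat // catA.
have zwe := wend ax z; rewrite -/(wend_of z) in zwe.
move: (wend_of z) (t) nzt wt def_w zwe => v {}t nzt wt def_w zwe.
case: k z w zw def_w zwe => [|k] z w zw def_w zwe.
  case: t nzt wt def_w => [|b s] nzt wt def_w.
    have := lenP w; rewrite def_w !cats0 lenP add0n => e.
    by have := delta_lt D2 A1 AD n; rewrite e ltnn.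
  have nzb : bb v [:: b] != 0.
    by apply: contraNN nzt => /eqP h; rewrite -[b :: s]/([:: b] ++ s) bb_cat0.
  have [x xP] := nzl_exists admI quoI (isT : [:: b] != [::]) nzb.
  exists x; last by rewrite /lsq xP /= eqxx prefix0s.
  by apply/andP; rewrite /lsrc /lsq xP zwe.
pose u := wlet z; rewrite wlastS in zwe *.
apply: lnxt_exists; first by rewrite -[ltgt u]zwe.
have wu : walk (lsrc u) (lsq u ++ t).
  by rewrite walk_cat (bb_walk (nzl_bb u)) -/(ltgt u) -[ltgt u]zwe.
apply/eqP; rewrite (bb0_zs admI quoI wu).
have [sD zw'] := word_window D2 A1 lenP w.
have le_d : (delta D0 A n + delta D0 A k + D0 <= delta D0 A (n + k).+2)%N.
  apply: (delta_super2 D2 A1 AD) => nk.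
  by apply: (A4 _ w); rewrite addSn addnC; lia.
have dw : size (wsq w) = delta D0 A (n + k).+2.
  by rewrite lenP addSn addnC.
pose i := (delta D0 A (n + k).+2 - D0 - (delta D0 A n + delta D0 A k))%N.
apply: (zs_win admI quoI (D0 := D0) (i := i) wu).
rewrite -(win_catr D0 i (wsq a ++ wsq (wpre z))) size_cat !lenP.
rewrite subnKC; last by lia.
by move: zw'; rewrite dw def_w wsqS -!catA.
Qed.

(** Both sides are [z] times the path [t] that is left of [w]. On the left side a non-zero [t]
    begins with exactly one admissible letter, so a single extension of [z] contributes. *)
Lemma word_lift_d k (w : lword (k.+1 + n)) :
  res_d lres k (word_lift k.+1 (lgen w)) = word_lift k (res_d lres (k + n) (lgen w)).
Proof.
rewrite word_lift_gen lres_d_gen linear_ract word_lift_gen.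
rewrite /lift_gen linear_sum ract_suml.
under eq_bigr do rewrite linear_ract lres_d_gen ractA.
rewrite (partition_big (@wpre _ _ _ k) xpredT) //; apply: eq_bigr => z _.
transitivity (ract (lgen z) (\sum_(z' | wpre z' == z)
    bb (lsrc (wlet z')) (lsq (wlet z')) * rest z' w)).
  by rewrite ract_sumr; apply: eq_bigr => z' /eqP ->.
rewrite ractA; congr (ract _ _).
have le_d : (delta D0 A n + delta D0 A k <= delta D0 A (k + n))%N.
  rewrite addnC; apply: (delta_super D2 A1 AD) => kn; exact: (A4 kn (wpre w)).
have sS := startsS z w le_d.
have [zw|nzw] := boolP (starts z w); last first.
  rewrite {2}/rest -sS (negPf nzw) mul0r big1 // => z' /eqP z'z.
  rewrite /rest; case: startsP => [[h1 h2 h3]|_]; last by rewrite mulr0.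
  case/negP: nzw; apply/startsP; rewrite -z'z; split=> //.
  by apply: prefix_trans h3; rewrite wsqS catA prefix_prefix.
have zw' : starts z (wpre w) by rewrite -sS.
pose t := drop (size (wsq a ++ wsq z)) (wsq w).
have def_t : t = drop (size (wsq a ++ wsq z)) (wsq (wpre w)) ++ lsq (wlet w).
  by rewrite /t wsqS drop_catl // size_cat !lenP.
have -> : rest z (wpre w) * bb (lsrc (wlet w)) (lsq (wlet w)) = bb (wend_of z) t.
  rewrite /rest zw' bb_mul (starts_end zw') def_t /wend_of (wend ax).
  by rewrite -(wx_nxt ax (wlet_nxt w)) eqxx.
have zwe : wend_of z = send (@ltgt _ _ _ _ _ admI quoI) (wlast z) by apply: (wend ax).
have sz (z' : lword k.+1) : wpre z' = z -> starts z' w = prefix (lsq (wlet z')) t.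
  move=> z'z; case/startsP: zw => h1 h2 /prefixP[r def_w].
  have def_r : t = r by rewrite /t def_w drop_size_cat.
  rewrite /starts wstS z'z h1 h2 !eqxx wsqS z'z catA def_w def_r /=.
  by rewrite prefix_catr // eqxx.
rewrite (eq_bigr (fun z' => if prefix (lsq (wlet z')) t then bb (wend_of z) t else 0)).
  rewrite (sum_word z (fun q => if prefix (lsq q) t then bb (wend_of z) t else 0)).
  have [->|nzt] := eqVneq (bb (wend_of z) t) 0.
    by rewrite big1 // => q _; rewrite if_same.
  have [q zq qt] := rest_zero zw nzt.
  rewrite (bigD1 q) //= qt big1 ?addr0 // => q' /andP[zq' qq'].
  case: ifP => // q't; case/eqP: qq'; exact: lnxt_prefix2 zq' zq q't qt.
move=> z' /eqP z'z; rewrite /rest sz //; case: ifP => [q't|_]; last by rewrite mulr0.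
have /prefixP[r def_t'] := q't.
rewrite bb_mul /wend_of (wend ax) wlastS /= -/(ltgt _) eqxx.
rewrite (wx_nxt ax (wlet_nxt z')) z'z -zwe def_t'; congr (bb _ _).
congr (_ ++ _); rewrite -(wsqS w) catA size_cat addnC -drop_drop -/t def_t'.
by rewrite drop_size_cat.
Qed.

End LiftOf.
End Lifting.

Section ExtBasis.
Variables (K : fieldType) (Q : quiver) (I : set (path_alg K Q)).
Variables (L : algType K) (phi : {lrmorphism path_alg K Q -> L}).
Hypotheses (admI : admissible I) (monI : monomial_ideal I) (quoI : is_quotient I phi).
Variables (L0 : lmodType L^c) (pi : {linear (L^c)^o -> L0}).
Hypothesis piP : is_degree0_module (len_grading phi) pi.

Local Notation bb := (bb phi).
Local Notation nzl := (nzl admI quoI).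
Local Notation J := (pos_part (len_grading phi)).

Variable D : nzl -> {linear L -> L}.
Hypothesis ax : path_axioms phi admI quoI pi D.

Local Notation lword := (word (@lnxt _ _ _ _ _ admI quoI)).
Local Notation lres := (lres ax).
Local Notation lgen := (@lgen _ _ _ _ _ admI quoI _ _ _ ax _).

Variables D0 A : nat.
Hypotheses (D2 : (2 <= D0)%N) (A1 : (1 <= A)%N) (AD : (A < D0)%N).
Hypothesis lenP : forall n (w : lword n), size (wsq w) = delta D0 A n.
Variables (P : resolution L0) (mP : minimal_resolution J P).
Variables (F : forall n, {linear lres n -> P n}) (G : forall n, {linear P n -> lres n}).
Hypotheses (cF : chain_map F) (cG : chain_map G).
Variables (E : algType K) (cls : forall n, {linear P n -> L0} -> E).
Hypothesis extE : is_ext_algebra cls.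

Arguments F : clear implicits.
Arguments G : clear implicits.
Arguments cls : clear implicits.

Lemma L0_radical (x : L0) : radical_of J x -> x = 0.
Proof.
apply: (sums_of_ind (C := fun x => x = 0)) => // [y z -> ->|y]; first by rewrite addr0.
move=> [u [b [Jb ->]]]; have [z <-] : exists z, pi z = u by case: piP => h _; apply: h.
rewrite -pi_ract; apply/(pi_ker piP); exact: (proj1 (pos_partM admI quoI _ _)).
Qed.

Lemma radical_eq n (f : {linear lres n -> L0}) x y : radical_of J (x - y) -> f x = f y.
Proof.
move=> h; apply/eqP; rewrite -subr_eq0 -linearB; apply/eqP/L0_radical.
exact: radical_linear.
Qed.

(** By minimality boundaries lie in the radical, which dies in [L0]. So the Ext space of degree [n]
    is the space of all maps from [P n] to [L0]. *)
Lemma all_cocycles n (f : {linear P n -> L0}) : cocycle f.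
Proof. by move=> x; apply/L0_radical/radical_linear/mP. Qed.

Lemma cls_eq0 n (f : {linear P n -> L0}) : cls n f = 0 -> forall x, f x = 0.
Proof.
move/(ext_cls_eq0 extE (all_cocycles f)).
case: n f => [//|n] f [g gP] x; rewrite gP; exact: all_cocycles.
Qed.

Lemma kscale_linear (U : lmodType L^c) (c : K) (f : {linear U -> L0}) :
  linear (fun x => ract (f x) c%:A).
Proof.
move=> a x y; rewrite linearP ractDl; congr (_ + _).
by rewrite !scale_ract !ractA mulr_algl mulr_algr.
Qed.

Definition kscale (U : lmodType L^c) (c : K) (f : {linear U -> L0}) :
  {linear U -> L0} := mklin (@kscale_linear U c f).

Lemma ksum_linear (U : lmodType L^c) (T : Type) (r : seq T) (c : T -> K)
    (f : T -> {linear U -> L0}) :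
  linear (fun x => \sum_(i <- r) ract (f i x) (c i)%:A).
Proof.
move=> a x y; rewrite scaler_sumr -big_split; apply: eq_bigr => i _.
exact: kscale_linear.
Qed.

Definition ksum (U : lmodType L^c) (T : Type) (r : seq T) (c : T -> K)
  (f : T -> {linear U -> L0}) : {linear U -> L0} := mklin (@ksum_linear U T r c f).

Lemma cls_sum (T : Type) (r : seq T) n (c : T -> K) (f : T -> {linear P n -> L0})
    (h : {linear P n -> L0}) :
  (forall x, h x = \sum_(i <- r) ract (f i x) (c i)%:A) ->
  cls n h = \sum_(i <- r) c i *: cls n (f i).
Proof.
elim: r h => [|i r IHr] h hP.
  rewrite big_nil -[RHS](scale0r (cls n h)); apply: (ext_clsZ extE).
    exact: all_cocycles.
  by move=> x; rewrite hP big_nil scale0r ract0r.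
rewrite big_cons.
pose h' : {linear P n -> L0} := (h \- kscale (c i) (f i))%R.
have h'P x : h' x = \sum_(i <- r) ract (f i x) (c i)%:A.
  by rewrite /= hP big_cons addrAC subrr add0r.
rewrite -(IHr _ h'P) -(ext_clsZ extE (f := f i) (h := kscale (c i) (f i))) //;
  last exact: all_cocycles.
apply: (ext_clsD extE); try exact: all_cocycles.
by move=> x /=; rewrite addrC subrK.
Qed.

Lemma chi_linear n (w : lword n) : linear (fun x : lres n => pi (cev x w)).
Proof.
move=> a x y; rewrite !scale_ract cevD linearD; congr (_ + _).
by rewrite cev_ract pi_ract.
Qed.

Definition chi n (w : lword n) : {linear lres n -> L0} := mklin (@chi_linear n w).

Lemma chi_gen n (w z : lword n) :
  chi w (lgen z) = pi (if w == z then bb (wend_of w) [::] else 0).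
Proof. by rewrite /= [cev _ _]cev_gen /we -(wend ax) -/(wend_of z); case: eqP => [->|]. Qed.

(** The classes [cls] are defined on maps from [P], hence the passage through the comparison map
    [G]. *)
Definition chiG n (w : lword n) : {linear P n -> L0} := (chi w \o G n)%FUN.

Definition eps n (w : lword n) : E := cls n (chiG w).

Lemma GF_radical n (f : {linear lres n -> L0}) x : f (G n (F n x)) = f x.
Proof.
apply: radical_eq.
exact: (chain_map_radical (lres_minimal (ax := ax)) (lres_minimal (ax := ax))
  (chain_map_comp cF cG) (chain_map_id lres)).
Qed.

Lemma FG_radical n (f : {linear P n -> L0}) x : f (F n (G n x)) = f x.
Proof.
apply/eqP; rewrite -subr_eq0 -linearB; apply/eqP/L0_radical/radical_linear.
exact: (chain_map_radical mP mP (chain_map_comp cG cF) (chain_map_id P)).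
Qed.

(** Modulo paths of positive length only multiples of the trivial path at [v] are left. *)
Lemma L0_scalar v (t : L0) : ract t (bb v [::]) = t -> exists c : K, t = pi (c *: bb v [::]).
Proof.
have [y <-] : exists y, pi y = t by case: piP => h _; apply: h.
rewrite -pi_ract => <-; have [c ->] := nzb_span admI quoI y.
rewrite mulr_suml; apply: (big_ind (fun y => exists c : K, pi y = pi (c *: bb v [::]))).
- by exists 0; rewrite scale0r.
- by move=> y1 y2 [c1 h1] [c2 h2]; exists (c1 + c2); rewrite scalerDl !linearD h1 h2.
move=> x _; rewrite -scalerAl; set d := c x.
rewrite /nzb bb_mul cats0; case: eqP => xv; last by exists 0; rewrite scaler0 scale0r.
case: (val x) xv => [v' [|b s]] /= xv; first by exists d; rewrite -xv.
exists 0; rewrite scale0r linear0; apply/(pi_ker piP).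
rewrite -mulr_algl; apply: (proj1 (pos_partM admI quoI _ _)).
exact: pos_part_bb.
Qed.

Lemma pi_scale c (y : L) : pi (c *: y : L) = ract (pi y) c%:A.
Proof. by rewrite -pi_ract mulr_algr. Qed.

Lemma chi_span n (f : {linear lres n -> L0}) :
  exists c : lword n -> K, forall x, f x = \sum_w ract (chi w x) (c w)%:A.
Proof.
have /choice[c cP] : forall w : lword n, exists c : K, f (lgen w) = pi (c *: bb (wend_of w) [::]).
  by move=> w; apply: L0_scalar; rewrite -linear_ract (lgen_e ax).
exists c => x; pose g := ksum (index_enum (lword n)) c (@chi n).
have gE y : g y = \sum_w ract (chi w y) (c w)%:A by [].
rewrite -gE; apply: lres_linear_eq => w; rewrite gE cP.
rewrite (big_only1 w) // => [|z zw _]; first by rewrite chi_gen eqxx pi_scale.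
by rewrite chi_gen (negPf zw) linear0 ract0l.
Qed.

Lemma cls_span n (f : {linear P n -> L0}) :
  exists c : lword n -> K, cls n f = \sum_w c w *: eps w.
Proof.
have [c cP] := chi_span (f \o F n)%FUN; exists c.
apply: cls_sum => x; rewrite -FG_radical -[LHS]/((f \o F n)%FUN (G n x)) cP.
by [].
Qed.

Lemma eps_free n (c : lword n -> K) : \sum_w c w *: eps w = 0 -> forall w, c w = 0.
Proof.
move=> c0 w; pose h := ksum (index_enum (lword n)) c (@chiG n).
have h0 : cls n h = 0 by rewrite -c0; apply: cls_sum.
have := cls_eq0 h0 (F n (lgen w)).
rewrite -[LHS]/(\sum_z ract (chi z (G n (F n (lgen w)))) (c z)%:A).
rewrite (big_only1 w) // => [|z zw _]; last first.
  by rewrite GF_radical chi_gen (negPf zw) linear0 ract0l.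
rewrite GF_radical chi_gen eqxx -pi_scale.
move=> /(pi_ker piP) Jc; apply/eqP/negPn/negP => cw0.
apply: (@vertex_pos_part _ _ _ _ _ admI monI quoI (wend_of w)).
have := proj1 (pos_partM admI quoI ((c w)^-1)%:A Jc).
by rewrite mulr_algl scalerA mulVf // scale1r.
Qed.

Definition epsT (i : {n : nat & lword n}) : E := eps (tagged i).

Local Notation T n := (fun w : lword n => Tagged (fun n => lword n) w).

Lemma T_inj n : injective (T n).
Proof. by move=> w w' /eqP; rewrite eq_Tagged => /eqP. Qed.

Lemma eps_basis : is_basis (epsT : ({n : nat & (lword n : choiceType)} : choiceType) -> E).
Proof.
have [_ span free] := ext_direct extE; split=> [y|s c us s0].
  have [s [f [us fP ->]]] := span y.
  apply: (big_ind (fun y => exists s (c : {n : nat & lword n} -> K),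
     uniq s /\ y = \sum_(i <- s) c i *: epsT i)).
  - by exists [::], (fun=> 0); rewrite big_nil.
  - move=> _ _ [s1 [c1 [us1 ->]]] [s2 [c2 [us2 ->]]].
    pose c i := (if i \in s1 then c1 i else 0) + (if i \in s2 then c2 i else 0).
    exists (undup (s1 ++ s2)), c; split; first exact: undup_uniq.
    under [RHS]eq_bigr do rewrite scalerDl.
    have ext r d (ur : uniq r) : {subset r <= undup (s1 ++ s2)} ->
       \sum_(i <- r) d i *: epsT i =
       \sum_(i <- undup (s1 ++ s2)) (if i \in r then d i else 0) *: epsT i.
      move=> sr; rewrite [RHS](bigID (mem r)) /= [X in _ = _ + X]big1 ?addr0; last first.
        by move=> i /negPf->; rewrite scale0r.
      rewrite -[RHS]big_filter; under [RHS]eq_big_seq => i.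
        by rewrite mem_filter => /andP[-> _]; over.
      apply: perm_big; apply: uniq_perm => //; first by rewrite filter_uniq ?undup_uniq.
      by move=> i; rewrite mem_filter; case: (boolP (i \in r)) => // /sr.
    rewrite big_split /=; congr (_ + _); apply: ext => // i;
      by rewrite mem_undup mem_cat => ->; rewrite ?orbT.
  move=> n _; have [g _ <-] := fP n; have [c ->] := cls_span g.
  pose c' i := \sum_(w | T n w == i) c w.
  exists [seq T n w | w <- enum (lword n)], c'; split.
    by rewrite map_inj_uniq ?enum_uniq //; apply: T_inj.
  rewrite big_map big_enum; apply: eq_bigr => w _; congr (_ *: _).
  by rewrite /c' (big_pred1 w) // => w'; rewrite /= (inj_eq (@T_inj n)).
move=> i is_; have [n [w def_i]] : exists n w, i = T n w by case: i {is_} => n w; exists n, w.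
(* The relation is sorted by degree, with coefficient 0 for words outside [s]. Directness makes each
   degree vanish, and [eps_free] finishes there. *)
pose d n (w : lword n) := if T n w \in s then c (T n w) else 0.
pose f n := \sum_w d n w *: eps w.
have fP m : f m = \sum_(j <- s | tag j == m) c j *: epsT j.
  transitivity (\sum_w \sum_(j <- s | j == T m w) c j *: epsT j).
    apply: eq_bigr => z _; rewrite /d; case: ifP => zs.
      rewrite -big_filter filter_pred1_uniq // big_seq1; by [].
    rewrite scale0r big1_seq // => j /andP[/eqP-> jw]; by rewrite jw in zs.
  rewrite (exchange_big_dep xpredT) //= [RHS]big_mkcond; apply: eq_bigr => -[m' z] _ /=.
  case: eqP => [mm|mm].
    move: z; rewrite mm => z; rewrite (big_pred1 z) // => z' /=.
    by rewrite eq_sym (inj_eq (@T_inj m)).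
  by rewrite big1 // => z' /eqP /(congr1 tag).
have f0 m : f m = 0.
  have [ms|ms] := boolP (m \in undup [seq tag j | j <- s]); last first.
    rewrite fP big1_seq // => j /andP[/eqP jm js].
    by rewrite mem_undup -jm map_f in ms.
  apply: (free (undup [seq tag j | j <- s]) f) => //; first exact: undup_uniq.
    move=> l; exists (ksum (index_enum (lword l)) (@d l) (@chiG l)); first exact: all_cocycles.
    exact: cls_sum.
  under eq_bigr do rewrite fP big_mkcond.
  rewrite exchange_big /= -[RHS]s0; apply: eq_big_seq => j js.
  rewrite (bigD1_seq (tag j)) ?undup_uniq ?mem_undup ?map_f //= eqxx.
  by rewrite big1 ?addr0 // => l /negPf; rewrite eq_sym => ->.
have := eps_free (f0 n) w; by rewrite /d -def_i is_.
Qed.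

Lemma word_dvd m : (4 <= m)%N -> lword m -> (A %| D0)%N.
Proof. by move=> m4 w; have [_ h] := word_full ax D2 A1 lenP AD w; apply: h. Qed.

(** The Yoneda product applies [b] after a lift of [a], so [a] is the first part of the resulting
    path. On a word [a z t] the dual of [b] forces [z = b], and [t] must be trivial because positive
    length dies in [L0]. *)
Lemma eps_mul m n (b : lword m) (a : lword n) : eps b * eps a =
  \sum_(w : lword (m + n) | [&& wst w == wst a, wst b == wend_of a
                            & wsq w == wsq a ++ wsq b]) eps w.
Proof.
pose lm k := word_lift ax a k.
(* The explicit lift lives on the chain resolution; between the two comparison maps it becomes a
   lift on [P]. *)
pose l k : {linear P (k + n)%N -> P k} := (F k \o (lm k \o G (k + n)%N))%FUN.
have lmE k x : res_d lres k (lm k.+1 x) = lm k (res_d lres (k + n) x).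
  apply: (lres_linear_eq (f := (res_d lres k \o lm k.+1)%FUN)
    (g := (lm k \o res_d lres (k + n))%FUN)) => w.
  exact: (word_lift_d ax D2 A1 AD lenP a (@word_dvd)).
have lift_l : lifting (chiG a) l.
  split=> [x|k x].
    rewrite -[l 0%N x]/(F 0%N (lm 0%N (G n x))) (proj1 cF).
    rewrite -[RHS]/(chi a (G n x)).
    apply: (lres_linear_eq (f := (res_eps lres \o lm 0%N)%FUN) (g := chi a)) => w.
    rewrite chi_gen eq_sym; apply: (word_lift_eps ax lenP).
  rewrite -[l k.+1 x]/(F k.+1 (lm k.+1 (G (k.+1 + n)%N x))) (proj2 cF) lmE.
  by rewrite (proj2 cG (k + n)%N x).
pose h : {linear P (m + n)%N -> L0} := (chiG b \o l m)%FUN.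
rewrite -(ext_yoneda extE (all_cocycles (chiG b)) (all_cocycles (chiG a)) lift_l (h := h)) //.
pose cnd (w : lword (m + n)) := [&& wst w == wst a, wst b == wend_of a
                            & wsq w == wsq a ++ wsq b].
pose c w : K := (cnd w)%:R.
transitivity (\sum_w c w *: eps w); last first.
  rewrite [RHS]big_mkcond; apply: eq_bigr => w _; rewrite /c /cnd.
  by case: ifP; rewrite ?scale1r ?scale0r.
apply: cls_sum => x.
rewrite -[h x]/(chi b (G m (F m (lm m (G (m + n)%N x))))) GF_radical.
pose k := ksum (index_enum (lword (m + n))) c (@chi (m + n)).
apply: (lres_linear_eq (f := (chi b \o lm m)%FUN) (g := k)) => w.
rewrite -[LHS]/(chi b (word_lift ax a m (lgen w))) word_lift_gen.
rewrite -[RHS]/(\sum_z ract (chi z (lgen w)) (c z)%:A).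
rewrite (big_only1 w) // => [|z zw _]; last first.
  by rewrite chi_gen (negPf zw) linear0 ract0l.
rewrite chi_gen eqxx -pi_scale /lift_gen linear_sum.
rewrite (big_only1 b) // => [|z zb _]; last first.
  by rewrite linear_ract chi_gen eq_sym (negPf zb) linear0 ract0l.
rewrite linear_ract chi_gen eqxx -pi_ract /rest /c /cnd.
case: startsP => [[h1 h2 h3]|ns]; last first.
  rewrite mulr0 linear0; case: and3P => [[/eqP h1 /eqP h2 /eqP h3]|_].
    by case: ns; split=> //; rewrite h3 prefix_refl.
  by rewrite scale0r linear0.
rewrite h1 h2 !eqxx /=.
have st : starts a b w by apply/startsP.
have ste := starts_end st.
case: (prefixP h3) => t def_w; rewrite def_w drop_size_cat // in ste *.
rewrite -{2}[wsq a ++ wsq b]cats0 eqseq_cat // eqxx /=.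
case: t ste {def_w} => [|d t] ste.
  by rewrite eqxx scale1r bb_mul eqxx -ste.
rewrite scale0r linear0; apply/(pi_ker piP).
exact: (proj1 (pos_partM admI quoI _ (pos_part_bb _ _ _))).
Qed.

End ExtBasis.

(** * Combinatorics of chains *)

Section StackedPaths.
Variables (Q : quiver) (zs : seq (arrow Q) -> bool) (D0 A : nat).
Hypotheses (D2 : (2 <= D0)%N) (A1 : (1 <= A)%N) (AD : (A < D0)%N).
Hypothesis nD2A : (1 < A)%N -> D0 <> (2 * A)%N.

Local Notation win := (win D0).
Local Notation delta := (delta D0 A).

Hypothesis overlapP : forall v s i j, walk v s -> (i < j)%N -> (j < i + D0)%N ->
  (j + D0 <= size s)%N -> zs (win i s) -> zs (win j s) ->
  (A %| j - i)%N /\ forall k, (i <= k <= j)%N -> (A %| k - i)%N -> zs (win k s).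

Local Notation full := (full D0 zs A).
Local Notation chain := (chain D0 zs A).

(* The degrees of the generators of the Ext algebra: the even ones of degree
   [rho], the odd ones in the degrees satisfying [isO]; [reg] is the regrading. *)
Definition rho := if D0 == 2 then 1%N else 2.
Definition isO n := (D0 != 2) && ((n == 1%N) || ((A != 1%N) && (n == 3))).
Definition reg n :=
  if D0 == 2 then n else if A == 1%N then uphalf n
  else if n == 1%N then 1%N else n./2.

Lemma delta1 : delta 1 = 1%N. Proof. by []. Qed.
Lemma delta2 : delta 2 = D0. Proof. by rewrite /Defs.delta /= mul1n. Qed.
Lemma delta3 : delta 3 = (D0 + A)%N. Proof. by rewrite /Defs.delta /= mul1n. Qed.
Lemma delta5 : delta 5 = (D0 + D0 + A)%N. Proof. by rewrite /Defs.delta /= mulSn mul1n. Qed.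

Lemma delta_rho : delta rho = if D0 == 2 then 1%N else D0.
Proof. by rewrite /rho; case: eqP => _; rewrite ?delta2. Qed.

Lemma delta_id n : D0 = 2 -> delta n = n.
Proof.
move=> D02; have A01 : A = 1%N by lia.
have [k [->|->]] := even_or_odd n; first by rewrite delta_even D02; lia.
by rewrite delta_odd D02 A01; case: eqP; lia.
Qed.

Lemma rho_notO : ~~ isO rho.
Proof. by rewrite /isO /rho; case: (D0 == 2); rewrite /= ?andbF. Qed.

Lemma rho_bounds : (0 < rho < 4)%N.
Proof. by rewrite /rho; case: ifP. Qed.

Lemma isOP j : isO j -> D0 != 2 /\ ((j = 1%N) \/ (A <> 1%N /\ j = 3)).
Proof. by case/andP => -> /orP[/eqP->|/andP[/eqP ? /eqP->]]; split; auto. Qed.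

Lemma rhoP : (D0 = 2 /\ A = 1%N /\ rho = 1%N) \/ (D0 != 2 /\ rho = 2).
Proof. by rewrite /rho; case: eqP => [D02|_]; [left; lia|right]. Qed.

Lemma delta_add2' n : (2 <= n)%N -> delta n.+2 = (delta n + D0)%N.
Proof. by case: n => [|[|n]] // _; apply: delta_add2. Qed.

Lemma delta_subrho n : (0 < n)%N -> ~~ isO n ->
  (rho <= n)%N /\ delta n = (delta (n - rho) + delta rho)%N.
Proof.
move=> n0; rewrite negb_and negbK => nO.
have [[D02 [A01 ->]]|[D02 ->]] := rhoP.
  by rewrite !(delta_id _ D02); lia.
rewrite (negPf D02) /= in nO; rewrite delta2.
case: n n0 nO => [|[|n]] // _ nO; split=> //; rewrite subSS subSS subn0.
case: n nO => [|[|n]] nO.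
- by rewrite delta2.
- by rewrite delta3 delta1; lia.
by rewrite delta_add2'.
Qed.

Lemma delta_mult n : (A %| D0)%N -> n != 1%N -> (A %| delta n)%N.
Proof.
move=> AD0 n1; have [k [nk|nk]] := even_or_odd n; rewrite nk ?delta_even ?delta_odd.
  by rewrite dvdn_mull.
by case: k nk => [|k] nk /=; [rewrite nk in n1|rewrite dvdn_add ?dvdn_mull].
Qed.

(** An even generator is cut off at a multiple of [A], so the windows of the piece cut off are
    windows of the whole. *)
Lemma delta_subrho_dvd n : (0 < n)%N -> ~~ isO n -> ((4 <= n)%N -> (A %| D0)%N) ->
  (A %| delta (n - rho))%N.
Proof.
move=> n0 nO A4; have [[D02 [A01 _]]|[D02 rho2]] := rhoP; first by rewrite A01.
rewrite rho2; case: n n0 nO A4 => [|[|[|[|n]]]] // n0 nO A4.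
- by move: nO; rewrite /isO D02 /= andbT negbK => /eqP->.
by apply: delta_mult => //; apply: A4.
Qed.

Lemma chain_suffix n k s t : chain n (s ++ t) -> (A %| size s)%N -> size t = delta k ->
  ((4 <= k)%N -> (A %| D0)%N) -> chain k t.
Proof.
move=> [_ f _] As st A4; split=> // i Ai it.
rewrite -(win_catr D0 _ s); apply: f; first by rewrite dvdn_add.
by rewrite size_cat; lia.
Qed.

Lemma chain_prefix n k s t : chain n (s ++ t) -> size s = delta k -> (k <= n)%N -> chain k s.
Proof.
move=> [_ f A4] ss kn; split=> // [i Ai it|k4]; last by apply: A4; apply: leq_trans kn.
by rewrite -(win_cat t it); apply: f => //; rewrite size_cat; lia.
Qed.

Lemma full_suffix s t : full (s ++ t) -> (A %| size s)%N -> full t.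
Proof.
move=> f As i Ai it; rewrite -(win_catr D0 _ s); apply: f; first by rewrite dvdn_add.
by rewrite size_cat; lia.
Qed.

Lemma full_prefix s t : full (s ++ t) -> full s.
Proof.
move=> f i Ai it; rewrite -(win_cat t it); apply: f => //; rewrite size_cat; lia.
Qed.

Lemma chain_pos n s : chain n s -> (0 < n)%N -> (0 < size s)%N.
Proof.
case=> -> _ _; case: n => // n _.
by apply: leq_ltn_trans (delta_lt D2 A1 AD n).
Qed.

(** Windows inside [s ++ t] or [t ++ u] are covered. Any other starts strictly between the last
    window of [s ++ t] and the first of [t ++ u]; these overlap because [t] is not empty, and
    [overlapP] fills the gap. *)
Lemma full_glue v s t u : walk v (s ++ t ++ u) -> (0 < size t)%N ->
  (A %| size s)%N -> (A %| size s + size t - D0)%N -> (D0 <= size s + size t)%N ->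
  (D0 <= size t + size u)%N -> full (s ++ t) -> full (t ++ u) ->
  full (s ++ t ++ u).
Proof.
move=> w t0 As Ast st tu fst ftu i Ai; rewrite !size_cat => iD.
have [le1|lt1] := leqP (i + D0) (size s + size t).
  rewrite catA win_cat ?size_cat //; apply: fst; rewrite ?size_cat //.
have [le2|lt2] := leqP (size s) i.
  rewrite -(subnKC le2) win_catr; apply: ftu; rewrite ?size_cat; last by lia.
  exact: dvdn_sub.
have z0 : zs (win (size s + size t - D0) (s ++ t ++ u)).
  rewrite catA win_cat ?size_cat; last by lia.
  by apply: fst; rewrite ?size_cat //; lia.
have z1 : zs (win (size s) (s ++ t ++ u)).
  rewrite -[X in win X]addn0 win_catr; apply: ftu => //; rewrite size_cat; lia.
have [||| _ h] := overlapP w _ _ _ z0 z1; rewrite ?size_cat; try lia.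
by apply: h; [lia|apply: dvdn_sub].
Qed.

(** The product reverses paths, so cutting an even generator off the end of the path exposes the
    leftmost factor of the element. *)
Lemma chain_split n s : chain n s -> (0 < n)%N -> ~~ isO n ->
  (rho <= n)%N /\ exists s1 t, [/\ s = s1 ++ t, chain (n - rho) s1 & chain rho t].
Proof.
move=> Gs n0 nO; have [rn dn] := delta_subrho n0 nO; split=> //.
have [ss _ A4] := Gs.
exists (take (delta (n - rho)) s), (drop (delta (n - rho)) s); rewrite cat_take_drop.
have st : size (take (delta (n - rho)) s) = delta (n - rho).
  by rewrite size_takel // ss dn leq_addr.
split=> //.
  apply: (chain_prefix (n := n) (t := drop (delta (n - rho)) s)) => //; last exact: leq_subr.
  by rewrite cat_take_drop.
apply: (chain_suffix (n := n) (s := take (delta (n - rho)) s)); rewrite ?cat_take_drop //.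
- by rewrite st; apply: delta_subrho_dvd.
- by rewrite size_drop ss dn addKn.
by have [[_ [_ ->]]|[_ ->]] := rhoP.
Qed.

(** Lengths decide. Degrees 1 and 1 would need [D0 = 2]; degrees 1 and 3 would need [D0 = A + 1]
    with [A] dividing [D0], hence [A = 1]; degrees 3 and 3 would need [D0 = 2 * A]. *)
Lemma chain_OO j k s t : isO j -> isO k -> chain j s -> chain k t -> ~ chain (j + k) (s ++ t).
Proof.
move=> /isOP[D02 j13] /isOP[_ k13] [sj _ _] [tk _ _] [].
rewrite size_cat sj tk => st _ A4.
move: st A4; case: j13 => [->|[A01 ->]]; case: k13 => [->|[A01' ->]];
  rewrite ?delta1 ?delta2 ?delta3 ?(delta_even _ _ 2) ?(delta_even _ _ 3) => st A4.
- by move: D02; rewrite -st.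
- by have [[|[|q]] qP] := dvdnP (A4 isT); nia.
- by have [[|[|q]] qP] := dvdnP (A4 isT); nia.
- by apply: nD2A; lia.
Qed.

(** For [j = 1] the length [D0 + 1 = D0 + A] gives [A = 1]. For [j = 3] the chain has degree 5,
    which brings the divisibility of [D0] by [A]. In both cases [rho + j] is no degree of an odd
    generator. *)
Lemma chain_odd_even j s : isO j -> chain (rho + j) s -> size s = (delta rho + delta j)%N ->
  [/\ D0 != 2, rho = 2, (A %| D0)%N, (A %| delta j)%N & ~~ isO (rho + j)].
Proof.
move=> /isOP[D02 j13] [ss _ A4].
have [[D02' _]|[_ rho2]] := rhoP; first by rewrite D02' in D02.
rewrite {}ss rho2 delta2 in A4 *; rewrite /isO D02 /=.
case: j13 A4 => [->|[A01 ->]] A4; rewrite ?delta1 ?delta3 ?delta5 => e.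
  by have -> : A = 1%N by lia.
by have AD0 := A4 isT; split; rewrite ?dvdn_add ?andbF.
Qed.

Lemma delta_rho2 : delta (rho + rho) = (delta rho + delta rho)%N.
Proof.
have [[D02 [_ ->]]|[_ ->]] := rhoP; first by rewrite !delta_id.
by rewrite delta2 (delta_even _ _ 2); lia.
Qed.

Lemma isO_add_rho n : (0 < n)%N -> ~~ isO n -> ~~ isO (n + rho).
Proof.
move=> n0; rewrite /isO; have [[D02 _]|[D02 ->]] := rhoP; first by rewrite D02.
by rewrite D02; case: n n0 => [|[|[|[|n]]]]; rewrite /= ?orbT ?andbF.
Qed.

(** Whether an even generator can be appended is decided by the last even generator alone: [g ++ x]
    and [x ++ z] are glued along [x]. This locality keeps the relations quadratic. *)
Lemma chain_loc v n g x z : walk v (g ++ x ++ z) -> (0 < n)%N -> ~~ isO n ->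
  chain n (g ++ x) -> chain rho x -> chain rho z ->
  chain (rho + rho) (x ++ z) <-> chain (n + rho) (g ++ x ++ z).
Proof.
move=> w n0 nO Gn [sx _ _] [sz _ _]; have [sn fn A4] := Gn.
have [rn dn] := delta_subrho n0 nO.
have sg : size g = delta (n - rho) by move: sn; rewrite size_cat sx dn => /addIn.
have Ag : (A %| size g)%N by rewrite sg delta_subrho_dvd.
have [_ dn'] := delta_subrho (ltn_addr rho n0) (isO_add_rho n0 nO).
rewrite addnK in dn'.
split=> [Gxz|Gg]; last first.
  apply: (chain_suffix Gg Ag); first by rewrite size_cat sx sz delta_rho2.
  by move=> r4; case: Gg => _ _; apply; lia.
have [sxz fxz A4'] := Gxz.
have [nr|nr] := eqVneq n rho.
  by move: sg; rewrite nr subnn => /size0nil ->.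
split; first by rewrite !size_cat sg sx sz dn' dn addnA.
  apply: (full_glue w) => //; rewrite ?sg ?sx ?sz.
  - by have := delta_rho; case: ifP => _; lia.
  - have [[_ [A01 _]]|[_ r2]] := rhoP; first by rewrite A01.
    by rewrite {2}r2 delta2 addnK -sg.
  - rewrite -dn; have [[D02 [_ r1]]|[_ r2]] := rhoP.
      by rewrite (delta_id _ D02); lia.
    by rewrite dn r2 delta2 leq_addl.
  have [[D02 [_ r1]]|[_ r2]] := rhoP; first by rewrite (delta_id _ D02) r1; lia.
  by rewrite r2 delta2 leq_addl.
have [[_ [A01 _]]|[_ r2]] := rhoP; first by rewrite A01.
by move=> _; apply: A4'; rewrite r2.
Qed.

Lemma reg0 n : (reg n == 0%N) = (n == 0%N).
Proof.
rewrite /reg; case: (D0 == 2) => //.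
by case: (A == 1%N); case: n => [|[|n]].
Qed.

Lemma reg_rho : reg rho = 1%N.
Proof. by rewrite /reg /rho; case: eqP => // _; case: eqP. Qed.

Lemma reg_isO j : isO j -> reg j = 1%N.
Proof.
rewrite /reg => /isOP[/negPf-> [->|[/eqP/negPf-> ->]]] //.
by case: eqP.
Qed.

(** For [D0 = 2] the regrading is the identity. Otherwise lengths prevent two odd degrees from
    multiplying to a chain, and halving is additive in the remaining cases. The exceptional value at
    degree 1 for [A > 1] is harmless, since degree 1 then combines only with degree 0. *)
Lemma reg_add m n s t : chain m s -> chain n t -> chain (m + n) (s ++ t) ->
  reg (m + n) = (reg m + reg n)%N.
Proof.
move=> [sm _ _] [sn _ _] [e _ A4]; rewrite size_cat sm sn in e; rewrite /reg.
case: eqP => // /eqP D02; case: eqP => A01.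
  have [i [mi|mi]] := even_or_odd m; have [k [nk|nk]] := even_or_odd n;
    try by rewrite mi nk; lia.
  move: e; rewrite mi nk addSn addnS -doubleD -doubleS !delta_odd delta_even A01.
  by case: i {mi} => [|i]; case: k {nk} => [|k] /=; move/eqP: D02; nia.
have [i [mi|mi]] := even_or_odd m; have [k [nk|nk]] := even_or_odd n.
- by rewrite mi nk -doubleD; case: eqP; case: eqP; case: eqP; lia.
- move: e; rewrite mi nk addnS -doubleD !delta_odd delta_even => e.
  case: k {nk} e => [|k] e; case: i {mi} e => [|i] //= e.
    by exfalso; move: e; rewrite addn0 /=; lia.
  by rewrite ?addn0 ?addnS ?addSn /= ?uphalf_double; lia.
- move: e; rewrite mi nk addSn -doubleD !delta_odd delta_even => e.
  case: i {mi} e => [|i] e; case: k {nk} e => [|k] //= e.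
  - by exfalso; move: e; rewrite add0n /=; lia.
  - by rewrite !addn0.
  by rewrite !uphalf_double doubleK addnS addSn addnS.
exfalso; move: e A4; rewrite mi nk addSn addnS -doubleD -doubleS !delta_odd delta_even.
case: i {mi} => [|i]; case: k {nk} => [|k] /= e A4.
- by move/eqP: D02; lia.
- by have [[|[|q]] qP] := dvdnP (A4 isT); nia.
- by have [|[|[|q]] qP] := dvdnP (A4 _); [lia|nia..].
by apply: nD2A; nia.
Qed.

Section OddGenerator.
Variables (v : vertex Q) (j : nat).
Hypothesis Oj : isO j.

Lemma isO_gt0 : (0 < j)%N.
Proof. by have [_ [->|[_ ->]]] := isOP Oj. Qed.

(** The suffix [x ++ z] starts at a multiple of [A], so only its length is in question. For [z] of
    degree 1 the length is right exactly if [A = 1], which the length of the whole chain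
    enforces. *)
Lemma chain_loc_odd n g x z : chain n (g ++ x) -> (0 < n)%N -> ~~ isO n -> chain rho x ->
  chain j z -> chain (n + j) (g ++ x ++ z) -> chain (rho + j) (x ++ z).
Proof.
move=> [sn _ A4] n0 nO [sx _ _] [sz _ _] Gg; have [sg _ A4'] := Gg.
have [rn dn] := delta_subrho n0 nO.
have sg' : size g = delta (n - rho) by move: sn; rewrite size_cat sx dn => /addIn.
have [D02 j13] := isOP Oj.
have [[D02' _]|[_ r2]] := rhoP; first by rewrite D02' in D02.
have e : delta (n + j) = (delta n + delta j)%N.
  by rewrite -sg !size_cat sg' sx sz dn addnA.
apply: (chain_suffix Gg); first by rewrite sg' delta_subrho_dvd.
  rewrite size_cat sx sz r2 delta2; rewrite r2 in rn.
  case: j13 e A4' => [->|[_ ->]] e A4'; last by rewrite delta3 delta5 addnA.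
  rewrite delta1 delta3; have [->//|A01] := eqVneq A 1%N.
  exfalso; have [k [nk|nk]] := even_or_odd n.
    move: e; rewrite nk addn1 delta_even delta_odd; case: k nk => [|k] nk /=.
      by rewrite nk in rn.
    by rewrite delta1; lia.
  have k1 : (1 < k)%N.
    by move: nO; rewrite /isO D02 nk A01; case: (k) => [|[|?]].
  have : (A %| D0)%N by apply: A4'; lia.
  move: e; rewrite nk addn1 -doubleS delta_even delta_odd delta1.
  case: (k) k1 => // k' _ /= e /dvdnP[[|[|q]] qP]; nia.
by move=> r4; apply: A4'; apply: leq_trans r4 _; rewrite leq_add2r.
Qed.

Variables (b r x z : seq (arrow Q)).
Hypotheses (xz_br : x ++ z = b ++ r) (Gbr : chain (rho + j) (b ++ r)).
Hypotheses (Gb : chain j b) (Gr : chain rho r) (Gx : chain rho x) (Gz : chain j z).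

(** The same path is factored as [x ++ z], with [x] even and [z] odd, and as [b ++ r], with [b] odd
    and [r] even. This is the exchange relation; the lemmas below carry admissibility from one
    factorization to the other. *)
Lemma odd_even : [/\ D0 != 2, rho = 2, (A %| D0)%N, (A %| delta j)%N & ~~ isO (rho + j)].
Proof.
apply: (chain_odd_even Oj Gbr); rewrite size_cat addnC.
by case: Gb => -> _ _; case: Gr => -> _ _.
Qed.

Lemma chain_odd_sum n : (0 < n)%N -> ~~ isO n -> ~~ isO (n + j).
Proof.
move=> n0 nO; have [D02 r2 AD0 Aj O2] := odd_even; have j0 := isO_gt0.
have [rn _] := delta_subrho n0 nO.
apply: contraNN O2 => /isOP[_ nj].
by rewrite (_ : rho = n) /isO ?D02; case: nj => [nj|[/eqP A01 nj]]; lia.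
Qed.

(** The path is also [g ++ b ++ r], and cutting off the even [r] leaves [g ++ b]. Conversely
    [g ++ x] and [b ++ r], which is [x ++ z], are glued along [x]. *)
Lemma chain_swap n g : walk v (g ++ x ++ z) -> (0 < n)%N -> ~~ isO n -> chain n (g ++ x) ->
  ~~ isO (n + j) /\
  (chain (n + j) (g ++ x ++ z) <-> chain (n - rho + j) (g ++ b)).
Proof.
move=> w n0 nO Gn; have [D02 r2 AD0 Aj O2] := odd_even.
have [sn fn _] := Gn; have [rn dn] := delta_subrho n0 nO.
have [sx _ _] := Gx; have [sr _ _] := Gr.
have sg : size g = delta (n - rho) by move: sn; rewrite size_cat sx dn => /addIn.
have j0 := isO_gt0.
have nOj := chain_odd_sum n0 nO.
have [_ dnj] := delta_subrho (ltn_addr j n0) nOj.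
rewrite -addnBAC // in dnj.
split=> //; rewrite {1}xz_br catA; split=> [Gg|[sb fb _]].
  apply: (chain_prefix Gg); last by rewrite leq_add2r leq_subr.
  by have [] := Gg; rewrite size_cat sr dnj => /addIn.
split=> //; first by rewrite size_cat sb sr dnj.
rewrite -catA -xz_br; apply: (full_glue w) => //.
- by rewrite sx r2 delta2; lia.
- by rewrite sg delta_subrho_dvd.
- by rewrite sx r2 delta2 addnK sg delta_subrho_dvd.
- by rewrite sx r2 delta2 leq_addl.
- by rewrite sx r2 delta2 leq_addr.
by rewrite xz_br; case: Gbr.
Qed.

(** If an even [y] ends the path [g ++ b], then [y ++ r] is a chain. In [gdel_gkap] this contradicts
    the admissibility of [y] after [r], so deletions vanish on corrections. *)
Lemma chain_swap_prev m g h y : walk v (g ++ b ++ r) -> (0 < m)%N -> chain m g ->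
  chain (m + j) (g ++ b) -> g ++ b = h ++ y -> chain rho y -> chain (rho + rho) (y ++ r).
Proof.
move=> w m0 Gg Ggb def_gb [sy _ _]; have [D02 r2 AD0 Aj O2] := odd_even.
have nOm : ~~ isO m by apply/negP => Om; apply: (chain_OO Om Oj Gg Gb Ggb).
have [rm dm] := delta_subrho m0 nOm; rewrite r2 in rm.
have [sg _ _] := Gg; have [sb _ _] := Gb; have [sr _ _] := Gr; have [sgb fgb _] := Ggb.
have Ad : (A %| delta (m + j) - D0)%N.
  by rewrite dvdn_sub // delta_mult //; lia.
have sgb' : (size g + size b)%N = delta (m + j) by rewrite -sgb size_cat.
have gD : (D0 <= size g)%N by rewrite sg dm r2 delta2 leq_addl.
have fgbr : full (g ++ b ++ r).
  apply: (full_glue w) => //.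
  - exact: chain_pos Gb isO_gt0.
  - by rewrite sg delta_mult //; lia.
  - by rewrite sgb'.
  - exact: leq_trans gD (leq_addr _ _).
  - by rewrite sr r2 delta2 leq_addl.
  by case: Gbr.
have sh : size h = (delta (m + j) - D0)%N.
  by rewrite -sgb def_gb size_cat sy r2 delta2 addnK.
split=> //; first by rewrite size_cat sy sr delta_rho2.
apply: (@full_suffix h); last by rewrite sh.
by rewrite catA -def_gb -catA.
Qed.

(** Read contrapositively in [gkap_gb]: if [y ++ x] is not a chain, neither is [y ++ b], so the
    correction kills the next letter. *)
Lemma chain_swap_next y : walk v (y ++ b ++ r) -> chain rho y -> chain (rho + j) (y ++ b) ->
  chain (rho + rho) (y ++ x).
Proof.
move=> w [sy _ _] Gyb; have [D02 r2 AD0 Aj O2] := odd_even.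
have [sb _ _] := Gb; have [sr _ _] := Gr; have [sx _ _] := Gx; have [_ fyb _] := Gyb.
have f : full (y ++ b ++ r).
  apply: (full_glue w) => //.
  - exact: chain_pos Gb isO_gt0.
  - by rewrite sy r2 delta2.
  - by rewrite sy r2 delta2 addKn sb.
  - by rewrite sy r2 delta2 leq_addr.
  - by rewrite sr r2 delta2 leq_addl.
  by case: Gbr.
split=> //; first by rewrite size_cat sy sx delta_rho2.
by apply: (@full_prefix _ z); rewrite -catA xz_br.
Qed.

(** Ensures in [gkap_relation] that the new first letter [r] is admissible wherever [z] was. *)
Lemma chain_swap_state y : walk v (b ++ r ++ y) -> chain rho y -> chain (rho + rho) (r ++ y) ->
  chain (rho + j) (z ++ y).
Proof.
move=> w [sy _ _] Gry; have [D02 r2 AD0 Aj O2] := odd_even.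
have [sb _ _] := Gb; have [sr _ _] := Gr; have [sx _ _] := Gx; have [sz _ _] := Gz.
have [_ fry _] := Gry; have [sbr fbr _] := Gbr.
have f : full (b ++ r ++ y).
  apply: (full_glue w) => //.
  - by rewrite sr r2 delta2; lia.
  - by rewrite sb.
  - by rewrite sb sr r2 delta2 addnK.
  - by rewrite sr r2 delta2 leq_addl.
  by rewrite sr r2 delta2 leq_addr.
split=> //; first by rewrite -sbr !size_cat sz sy sb sr.
apply: (@full_suffix x); first by rewrite catA xz_br -catA.
by rewrite sx r2 delta2.
Qed.

End OddGenerator.

End StackedPaths.

(** * Gradings given by projections *)

Section Projections.
Variables (T : eqType) (V : zmodType) (p : T -> V -> V).
Hypothesis pB : forall i x y, p i (x - y) = p i x - p i y.
Hypothesis p_orth : forall i j x, p i (p j x) = if i == j then p j x else 0.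
Hypothesis p_sum : forall x, exists s, uniq s /\ x = \sum_(i <- s) p i x.

Lemma projection0 i : p i 0 = 0.
Proof. by have := pB i 0 0; rewrite subrr subrr. Qed.

Lemma projections_direct_sum : direct_sum (fun i x => p i x = x).
Proof.
have pN i x : p i (- x) = - p i x by rewrite -sub0r pB projection0 sub0r.
have pD i x y : p i (x + y) = p i x + p i y by rewrite -{1}[y]opprK pB pN opprK.
split=> [i|x|s f us fP s0 i si].
- by split=> [|x y /= xi yi]; [apply: projection0|rewrite pB xi yi].
- have [s [us xs]] := p_sum x; exists s, (fun i => p i x); split=> // i.
  by rewrite p_orth eqxx.
have := congr1 (p i) s0; rewrite projection0 (big_morph (p i) (pD i) (projection0 i)).
rewrite (bigD1_seq i) //= fP big1 ?addr0 // => j /negPf ji.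
by rewrite -fP p_orth eq_sym ji.
Qed.

End Projections.

Section GradedColumns.
Variables (B : nzRingType) (pr : nat -> B -> B).
Hypothesis prB : forall k x y, pr k (x - y) = pr k x - pr k y.
Hypothesis pr_orth : forall j k x, pr j (pr k x) = if j == k then pr k x else 0.
Hypothesis pr_sum : forall x, exists N, forall M, (N <= M)%N -> x = \sum_(k < M) pr k x.
Hypothesis pr_mul : forall j k x y, pr j x = x -> pr k y = y -> pr (j + k) (x * y) = x * y.
Variables (W : finType) (e : W -> B).
Hypothesis e_pr : forall w, pr 0 (e w) = e w.

(** Algebra degrees are natural numbers, while the shifted module degrees are integers; negative
    components are 0. *)
Definition prz (i : int) (x : B) : B := if i is Posz k then pr k x else 0.

Lemma przB i x y : prz i (x - y) = prz i x - prz i y.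
Proof. by case: i => k; rewrite /prz ?subr0. Qed.

Lemma prz_orth i j x : prz i (prz j x) = if i == j then prz j x else 0.
Proof.
case: i j => i [] j /=; rewrite ?if_same //.
exact: (projection0 prB).
Qed.

Lemma prz_mul i k x y : prz i x = x -> pr k y = y -> prz (i + k%:Z) (x * y) = x * y.
Proof.
case: i => [j|j] /= xj yk; first exact: pr_mul.
by rewrite -xj mul0r; case: (_ + _) => //= m; rewrite (projection0 prB).
Qed.

Lemma e_mul_pr k x w : e w * x = x -> e w * pr k x = pr k x.
Proof.
move=> ex; have [N NP] := pr_sum x; set M := maxn N k.+1.
have xM := NP M (leq_maxl _ _); have kM : (k < M)%N := leq_maxr _ _.
have pD i a b : pr i (a + b) = pr i a + pr i b.
  have p0 := projection0 prB i.
  have pN c : pr i (- c) = - pr i c by rewrite -sub0r prB p0 sub0r.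
  by rewrite -{1}[b]opprK prB pN opprK.
have := congr1 (pr k) ex; rewrite {1}xM mulr_sumr.
rewrite (big_morph (pr k) (pD k) (projection0 prB k)) (bigD1 (Ordinal kM)) //=.
have h j : pr j (e w * pr j x) = e w * pr j x.
  by apply: (pr_mul (j := 0)) => //; rewrite pr_orth eqxx.
rewrite h big1 ?addr0 // => j /negPf jk; rewrite -h pr_orth.
by case: eqP => // kj; rewrite -val_eqE /= -kj eqxx in jk.
Qed.

Lemma col_prz_subproof i (f : column e) w : e w * prz i (cev f w) = prz i (cev f w).
Proof. by case: i => k /=; rewrite ?mulr0 // e_mul_pr // cev_e. Qed.

Definition col_prz i (f : column e) : column e := mkcol (col_prz_subproof i f).

Lemma col_prz_direct_sum n : direct_sum
  (fun i (f : (column e : lmodType B^c)) => col_prz (i - n) f = f).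
Proof.
apply: (projections_direct_sum (p := fun i => col_prz (i - n))) => [i x y|i j x|x].
- by apply: columnP => w; rewrite cevB !cev_mkcol cevB przB.
- apply: columnP => w; rewrite !cev_mkcol prz_orth (inj_eq (addIr _)).
  by case: eqP; rewrite ?cev_mkcol ?cev0.
have /choice[N NP] : forall w, exists N, forall M, (N <= M)%N ->
    cev x w = \sum_(k < M) pr k (cev x w) by move=> w; apply: pr_sum.
pose M := \max_w N w.
exists [seq k%:Z + n | k <- index_iota 0 M]; split.
  by rewrite map_inj_uniq ?iota_uniq // => j k /addIr [].
apply: columnP => w; rewrite cev_sum big_map big_mkord.
rewrite {1}(NP w M) ?leq_bigmax //; apply: eq_bigr => k _.
by rewrite cev_mkcol addrK.
Qed.

Lemma col_prz_grading n : module_grading (fun k x => pr k x = x)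
  (fun i (f : (column e : lmodType B^c)) => col_prz (i - n) f = f).
Proof.
split=> [|i k f b fi bk]; first exact: col_prz_direct_sum.
apply: columnP => w; rewrite cev_mkcol cev_ract addrAC; apply: prz_mul => //.
by rewrite -{2}fi cev_mkcol.
Qed.

End GradedColumns.

(** * Koszulness *)

Section Elements.
Variables (K : fieldType) (Q : quiver) (zs : seq (arrow Q) -> bool) (D0 A : nat).
Hypotheses (D2 : (2 <= D0)%N) (A1 : (1 <= A)%N) (AD : (A < D0)%N).
Hypothesis nD2A : (1 < A)%N -> D0 <> (2 * A)%N.
Hypothesis overlapP : forall v s i j, walk v s -> (i < j)%N -> (j < i + D0)%N ->
  (j + D0 <= size s)%N -> zs (win D0 i s) -> zs (win D0 j s) ->
  (A %| j - i)%N /\ forall k, (i <= k <= j)%N -> (A %| k - i)%N -> zs (win D0 k s).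

Variables (Wd : nat -> finType) (st : forall n, Wd n -> vertex Q).
Variable sq : forall n, Wd n -> seq (arrow Q).
Hypothesis W_inj : forall n (w w' : Wd n), st w = st w' -> sq w = sq w' -> w = w'.
Hypothesis W_chain : forall n (w : Wd n), walk (st w) (sq w) /\ chain D0 zs A n (sq w).
Hypothesis chainb_W : forall n v s, walk v s -> chain D0 zs A n s ->
  exists w : Wd n, st w = v /\ sq w = s.

Variables (E : algType K) (ep : forall n, Wd n -> E).
Hypothesis ep_basis : is_basis
  ((fun i => ep (tagged i)) : ({n : nat & (Wd n : choiceType)} : choiceType) -> E).
Hypothesis ep_mul : forall m n (b : Wd m) (a : Wd n), ep b * ep a =
  \sum_(w : Wd (m + n) | [&& st w == st a, st b == walk_end (st a) (sq a)
                           & sq w == sq a ++ sq b]) ep w.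

Local Notation chain := (chain D0 zs A).
Local Notation rho := (rho D0).
Local Notation isO := (isO D0 A).
Local Notation reg := (reg D0 A).
Local Notation delta := (delta D0 A).

Definition chainb n v s : bool := [exists w : Wd n, (st w == v) && (sq w == s)].

Lemma chainbP n v s : reflect (walk v s /\ chain n s) (chainb n v s).
Proof.
apply: (iffP existsP) => [[w /andP[/eqP <- /eqP <-]]|[ws Gs]]; first exact: W_chain.
by have [w [<- <-]] := chainb_W ws Gs; exists w; rewrite !eqxx.
Qed.

(** Being 0 outside chains, it lets the product of two classes be the class of the concatenation
    with no further case. *)
Definition el n v s : E := \sum_(w : Wd n | (st w == v) && (sq w == s)) ep w.

Lemma el_ep n (w : Wd n) : el n (st w) (sq w) = ep w.
Proof.
rewrite /el (big_pred1 w) // => w' /=.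
by apply/andP/eqP => [[/eqP h1 /eqP h2]|->]; [apply: W_inj|].
Qed.

Lemma chainb_ex n v s : chainb n v s -> exists w : Wd n, st w = v /\ sq w = s.
Proof. by case/existsP => w /andP[/eqP ? /eqP ?]; exists w. Qed.

Lemma chainb_word n (w : Wd n) : chainb n (st w) (sq w).
Proof. by apply/chainbP. Qed.

Lemma el0 n v s : ~~ chainb n v s -> el n v s = 0.
Proof. by move/existsPn => h; rewrite /el big1 // => w; rewrite (negPf (h w)). Qed.

Lemma el_mul m n v s v' t : chainb m v' t -> chainb n v s ->
  el m v' t * el n v s = if v' == walk_end v s then el (m + n) v (s ++ t) else 0.
Proof.
move=> /chainb_ex[b [<- <-]] /chainb_ex[a [<- <-]]; rewrite !el_ep ep_mul /el.
case: eqP => h; last by rewrite big1 // => w; rewrite andbF.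
by apply: eq_bigl.
Qed.

Lemma chainb0 v s : chainb 0 v s = (s == [::]).
Proof.
apply/chainbP/eqP => [[_ [/size0nil]]//|->]; split=> //; split=> // i _ /=; lia.
Qed.

Lemma chainb_vertex v : chainb 0 v [::]. Proof. by rewrite chainb0. Qed.

Definition ev v : E := el 0 v [::].

Lemma ev_el n v v' s : chainb n v s -> ev v' * el n v s = if v' == walk_end v s then el n v s else 0.
Proof. by move=> g; rewrite el_mul ?chainb_vertex // cats0. Qed.

Lemma el_ev n v v' s : chainb n v s -> el n v s * ev v' = if v == v' then el n v s else 0.
Proof.
move=> g; rewrite el_mul ?chainb_vertex //= addn0.
by case: eqP => [->|].
Qed.

Lemma el_span y : exists (s : seq {n : nat & Wd n}) (c : {n : nat & Wd n} -> K),
  y = \sum_(i <- s) c i *: el (tag i) (st (tagged i)) (sq (tagged i)).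
Proof.
case: ep_basis => span _; have [s [c [_ ->]]] := span y.
by exists s, c; apply: eq_bigr => i _; rewrite el_ep.
Qed.

Lemma el_ind (C : E -> Prop) : C 0 -> (forall c y y', C y -> C y' -> C (c *: y + y')) ->
  (forall n v s, chainb n v s -> C (el n v s)) -> forall y, C y.
Proof.
move=> C0 CD Ce y; have [s [c ->]] := el_span y.
apply: (big_ind C) => // [y1 y2 h1 h2|i _].
  by rewrite -[y1]scale1r; apply: CD.
by rewrite -[_ *: _]addr0; apply: CD => //; apply/Ce/chainb_word.
Qed.

Lemma el_left_ind u (C : E -> Prop) : C 0 ->
  (forall c y y', C y -> C y' -> C (c *: y + y')) ->
  (forall n v s, chainb n v s -> walk_end v s = u -> C (el n v s)) ->
  forall y, ev u * y = y -> C y.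
Proof.
move=> C0 CD Ce y <-; move: y; apply: el_ind => [|c y y' h1 h2|n v s g].
- by rewrite mulr0.
- by rewrite mulrDr -scalerAr; apply: CD.
by rewrite ev_el //; case: eqP => [vu|//]; apply: Ce.
Qed.

Lemma el_ext (V : lmodType K) (F : nat -> vertex Q -> seq (arrow Q) -> V) :
  exists f : {linear E -> V}, forall n v s, chainb n v s -> f (el n v s) = F n v s.
Proof.
have [f fP] := basis_ext ep_basis (fun i => F (tag i) (st (tagged i)) (sq (tagged i))).
exists f => n v s /chainb_ex[w [<- <-]]; rewrite el_ep.
exact: (fP (Tagged (fun n => Wd n : choiceType) w)).
Qed.

Lemma ev_orth v v' : ev v * ev v' = if v == v' then ev v else 0.
Proof. by rewrite el_ev ?chainb_vertex. Qed.

Lemma ev_sum : \sum_v ev v = 1.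
Proof.
suff h y : (\sum_v ev v) * y = y by rewrite -[LHS]mulr1 h.
move: y; apply: el_ind => [|c y y' h1 h2|n v s g].
- by rewrite mulr0.
- by rewrite mulrDr -scalerAr h1 h2.
rewrite mulr_suml (big_only1 (walk_end v s)) // => [|v' /negPf nv _].
  by rewrite ev_el // eqxx.
by rewrite ev_el // nv.
Qed.

Definition isL n := (n == rho) || isO n.

Lemma isO_rho n : isO n -> (n == rho) = false.
Proof. by apply: contraTF => /eqP->; apply: (rho_notO D0 A). Qed.

Lemma isL_lt4 n : isL n -> (n < 4)%N.
Proof.
case/orP => [/eqP->|/isOP[_ [->|[_ ->]]]] //.
by case/andP: (rho_bounds D0).
Qed.

(** Generators have degree at most 3; indexing by ['I_4] makes their collection over all degrees
    finite, as the word construction requires. *)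
Definition gen : finType := {x : {i : 'I_4 & Wd i} | isL (tag x)}.
Definition gdeg (x : gen) : nat := tag (val x).
Definition gst (x : gen) : vertex Q := st (tagged (val x)).
Definition gsq (x : gen) : seq (arrow Q) := sq (tagged (val x)).

Lemma gen_isL x : isL (gdeg x). Proof. exact: (svalP x). Qed.

Lemma gen_chainb x : chainb (gdeg x) (gst x) (gsq x). Proof. exact: chainb_word. Qed.

Lemma gen_inj x y : gdeg x = gdeg y -> gst x = gst y -> gsq x = gsq y -> x = y.
Proof.
case: x y => [[i w] h] [[j z] h'] /= ij; have {}ij : i = j by apply: val_inj.
rewrite /gst /gsq /=; move: z h'; rewrite -ij => z h' h1 h2.
by apply: val_inj; rewrite /= (W_inj h1 h2).
Qed.

Lemma gen_ex n v s : isL n -> chainb n v s ->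
  exists x : gen, [/\ gdeg x = n, gst x = v & gsq x = s].
Proof.
move=> Ln /chainb_ex[w [<- <-]].
pose x := Tagged (fun i : 'I_4 => Wd i) (w : Wd (Ordinal (isL_lt4 Ln))).
have h : isL (tag x) by [].
by exists (exist (fun x : {i : 'I_4 & Wd i} => isL (tag x)) x h).
Qed.

Definition gend x := walk_end (gst x) (gsq x).
Definition gb x : E := el (gdeg x) (gst x) (gsq x).

Lemma gen_walk x : walk (gst x) (gsq x).
Proof. by case/chainbP: (gen_chainb x). Qed.

Lemma gen_chain x : chain (gdeg x) (gsq x).
Proof. by case/chainbP: (gen_chainb x). Qed.

Lemma gen_cases x : gdeg x = rho \/ isO (gdeg x).
Proof. by have /orP[/eqP|] := gen_isL x; [left|right]. Qed.

Lemma gdeg_gt0 x : (0 < gdeg x)%N.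
Proof.
case: (gen_cases x) => [->|/isOP[_ [->|[_ ->]]]] //.
by case/andP: (rho_bounds D0).
Qed.

Lemma gdeg_reg x : reg (gdeg x) = 1%N.
Proof. by case: (gen_cases x) => [->|]; [apply: reg_rho|apply: reg_isO]. Qed.

(* The product of the generators [z] and [x], in this order, is the path [x z]. *)
Definition gnxt (s : vertex Q + gen) (x : gen) : bool :=
  match s with
  | inl v => gend x == v
  | inr z => (gend x == gst z) &&
      ((gdeg z != rho) || ~~ chainb (gdeg z + gdeg x) (gst x) (gsq x ++ gsq z))
  end.

(* If the path [x z], with [z] odd and [x] even, is [c r] with [r] even, then
   the product of [z] and [x] is that of [r] and [c]. *)
Definition gkap (z r x : gen) : E :=
  let s := gsq x ++ gsq z in let k := (size s - delta rho)%N in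
  if [&& isO (gdeg z), gdeg x == rho, gdeg r == rho, gend x == gst z,
         chainb (rho + gdeg z) (gst x) s,
         drop k s == gsq r & walk_end (gst x) (take k s) == gst r]
  then el (gdeg z) (gst x) (take k s) else 0.

(** The leftmost letter of an element sits at the end of its path. In a degree of odd generators the
    whole chain is that letter; otherwise it is the final even generator, of length [delta rho]. *)
Definition gdel_val (x : gen) n v s : E :=
  if n == 0%N then 0
  else if isO n then if [&& gdeg x == n, gst x == v & gsq x == s] then ev v else 0
  else let k := (size s - delta rho)%N in
    if [&& gdeg x == rho, gst x == walk_end v (take k s) & gsq x == drop k s]
    then el (n - rho) v (take k s) else 0.

Lemma gdel_exists : exists D : gen -> {linear E -> E},
  forall x n v s, chainb n v s -> D x (el n v s) = gdel_val x n v s.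
Proof.
have /choice[D DP] : forall x, exists f : {linear E -> E},
    forall n v s, chainb n v s -> f (el n v s) = gdel_val x n v s.
  by move=> x; apply: el_ext.
by exists D.
Qed.

Lemma ev_left n v s y : chainb n v s -> walk_end v s = y -> ev y * el n v s = el n v s.
Proof. by move=> g <-; rewrite ev_el // eqxx. Qed.

Lemma gb_src x : ev (gend x) * gb x = gb x.
Proof. exact: ev_left (gen_chainb x) _. Qed.

Lemma gb_tgt x : gb x * ev (gst x) = gb x.
Proof. by rewrite /gb el_ev ?gen_chainb // eqxx. Qed.

Lemma gb_mul z n v s : chainb n v s -> gb z * el n v s =
  if gst z == walk_end v s then el (gdeg z + n) v (s ++ gsq z) else 0.
Proof. by move=> g; rewrite el_mul // gen_chainb. Qed.

Lemma gnxt_end s x : gnxt s x -> gend x = send gst s.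
Proof. by case: s => [v|z] /= => [/eqP|/andP[/eqP]]. Qed.

Lemma chainb_size n v s : chainb n v s -> size s = delta n.
Proof. by case/chainbP => _ []. Qed.

Lemma gsize_rho x : gdeg x = rho -> size (gsq x) = delta rho.
Proof. by move=> <-; apply: chainb_size (gen_chainb x). Qed.

Lemma chainbE n v s : walk v s -> chain n s -> chainb n v s.
Proof. by move=> ? ?; apply/chainbP. Qed.

Lemma gkap_split z x : isO (gdeg z) -> gdeg x = rho ->
  chainb (rho + gdeg z) (gst x) (gsq x ++ gsq z) ->
  exists c r, [/\ gsq x ++ gsq z = c ++ gsq r, gdeg r = rho, chainb (gdeg z) (gst x) c
    & walk_end (gst x) c = gst r].
Proof.
move=> Oz rx g; have /chainbP[w G] := g.
have Gz := gen_chain z; have := gen_chain x; rewrite rx => Gx.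
have szx : size (gsq x ++ gsq z) = (delta rho + delta (gdeg z))%N.
  by rewrite size_cat; case: Gz => -> _ _; case: Gx => -> _ _.
have [_ _ _ _ nO] := chain_odd_even D2 A1 AD nD2A Oz G szx.
have n0 : (0 < rho + gdeg z)%N by rewrite addn_gt0 gdeg_gt0 orbT.
have [_ [c [t [def_s Gc Gt]]]] := chain_split D2 A1 AD nD2A G n0 nO.
rewrite addKn in Gc; move: w; rewrite def_s walk_cat => /andP[wc wt].
have [|r [r1 r2 r3]] := @gen_ex rho (walk_end (gst x) c) t _ (chainbE wt Gt).
  by rewrite /isL eqxx.
by exists c, r; rewrite r3 r2; split=> //; apply: chainbE.
Qed.

Lemma gkapE z x c t r : isO (gdeg z) -> gdeg x = rho -> gend x = gst z ->
  chainb (rho + gdeg z) (gst x) (gsq x ++ gsq z) -> gsq x ++ gsq z = c ++ t ->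
  size t = delta rho ->
  gkap z r x = if [&& gdeg r == rho, gsq r == t & gst r == walk_end (gst x) c]
               then el (gdeg z) (gst x) c else 0.
Proof.
move=> Oz rx xz g def_s st'; rewrite /gkap Oz rx xz g !eqxx /= def_s size_cat st' addnK.
by rewrite take_size_cat // drop_size_cat // (eq_sym t) (eq_sym (walk_end _ _)).
Qed.

Lemma gkapP z r x : gkap z r x = 0 \/ exists c,
  [/\ isO (gdeg z) /\ gdeg x = rho, gdeg r = rho, gend x = gst z,
      gsq x ++ gsq z = c ++ gsq r
    & [/\ chainb (rho + gdeg z) (gst x) (gsq x ++ gsq z), walk_end (gst x) c = gst r,
          chainb (gdeg z) (gst x) c & gkap z r x = el (gdeg z) (gst x) c]].
Proof.
have [[Oz [rx [rr [xz g]]]]|h] := pselect (isO (gdeg z) /\ gdeg x = rho /\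
    gdeg r = rho /\ gend x = gst z /\ chainb (rho + gdeg z) (gst x) (gsq x ++ gsq z)); last first.
  left; rewrite /gkap; case: ifP => // /and5P[Oz /eqP rx /eqP rr /eqP xz /and3P[g _ _]].
  by case: h.
have [c [r' [def_s rr' gc cr]]] := gkap_split Oz rx g.
have sr := gsize_rho rr'.
rewrite (gkapE r Oz rx xz g def_s sr) rr eqxx /= cr.
case: andP => [[/eqP h1 /eqP h2]|_]; last by left.
by right; exists c; rewrite h1 h2.
Qed.

Lemma gkap_src z r x : ev (gst r) * gkap z r x = gkap z r x.
Proof.
case: (gkapP z r x) => [->|[c [_ _ _ _ [_ cr gc ->]]]]; first by rewrite mulr0.
exact: ev_left gc cr.
Qed.

Section Deletion.
Variable D : gen -> {linear E -> E}.
Hypothesis DP : forall x n v s, chainb n v s -> D x (el n v s) = gdel_val x n v s.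

Lemma gdel_odd x n v s : chainb n v s -> isO n ->
  D x (el n v s) = if [&& gdeg x == n, gst x == v & gsq x == s] then ev v else 0.
Proof.
move=> g On; rewrite DP // /gdel_val On; case: eqP => // n0.
by have [_ [h|[_ h]]] := isOP On; rewrite h in n0.
Qed.

Lemma gdel_even x n v s t : chainb n v (s ++ t) -> (0 < n)%N -> ~~ isO n ->
  size t = delta rho ->
  D x (el n v (s ++ t)) = if [&& gdeg x == rho, gst x == walk_end v s & gsq x == t]
                          then el (n - rho) v s else 0.
Proof.
move=> g n0 nO tr; rewrite DP // /gdel_val eqn0Ngt n0 (negPf nO) size_cat tr addnK /=.
by rewrite take_size_cat // drop_size_cat.
Qed.

Lemma gdel0 x v : D x (ev v) = 0.
Proof. by rewrite DP ?chainb_vertex. Qed.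

Lemma gdel_gend x y : ev (gst x) * D x y = D x y.
Proof.
move: y; apply: el_ind => [|c y y' h1 h2|n v s g].
- by rewrite linear0 mulr0.
- by rewrite linearP mulrDr -scalerAr h1 h2.
rewrite DP // /gdel_val; case: eqP => [_|/eqP n0]; first by rewrite mulr0.
case: ifP => On.
  by case: ifP => [/and3P[_ /eqP-> _]|_]; rewrite ?mulr0 // ev_orth eqxx.
case: ifP => [/and3P[_ /eqP xv _]|_]; last by rewrite mulr0.
have [gk|ngk] := boolP (chainb (n - rho) v (take (size s - delta rho) s)).
  by apply: ev_left gk _.
by rewrite el0 // mulr0.
Qed.

Lemma gfirst n v s : chainb n v s -> (0 < n)%N -> exists x n' g,
  [/\ s = g ++ gsq x, chainb n' v g, walk_end v g = gst x /\ n = (n' + gdeg x)%N,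
      forall y, D y (el n v s) = if y == x then el n' v g else 0
    & (isO n /\ n' = 0%N /\ g = [::]) \/ (~~ isO n /\ gdeg x = rho)].
Proof.
move=> g n0; have [On|nO] := boolP (isO n).
  have [|x [x1 x2 x3]] := gen_ex _ g; first by rewrite /isL On orbT.
  exists x, 0%N, [::]; rewrite chainb_vertex x1 x2 x3; split=> //; last by left.
  move=> y; rewrite gdel_odd // -x1 -x2 -x3; congr (if _ then _ else _).
  by apply/and3P/eqP => [[/eqP h1 /eqP h2 /eqP h3]|->]; [apply: gen_inj|].
have /chainbP[w G] := g; have [rn [s1 [t [def_s G1 Gt]]]] := chain_split D2 A1 AD nD2A G n0 nO.
move: w; rewrite def_s walk_cat => /andP[w1 wt].
have [|x [x1 x2 x3]] := gen_ex _ (chainbE wt Gt); first by rewrite /isL eqxx.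
exists x, (n - rho)%N, s1; rewrite x1 x2 x3; split=> //.
- exact: chainbE.
- by rewrite subnK.
- move=> y; rewrite def_s in g; rewrite gdel_even //; last by rewrite -x3 gsize_rho.
  rewrite -{1}x1 -{1}x2 -{1}x3; congr (if _ then _ else _).
  by apply/and3P/eqP => [[/eqP h1 /eqP h2 /eqP h3]|->]; [apply: gen_inj|].
by right.
Qed.

Lemma gdel_gb x z : D x (gb z) = if x == z then ev (gst z) else 0.
Proof.
have [x1 [n' [g [def_z gg [gx1 dz] -> h]]]] := gfirst (gen_chainb z) (gdeg_gt0 z).
have n0 : n' = 0%N.
  case: h => [[_ []]//|[nO r1]].
  by case: (gen_cases z) => [rz|Oz]; [lia|rewrite Oz in nO].
rewrite n0 in gg dz; move: gg; rewrite chainb0 => /eqP g0.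
rewrite g0 in def_z gx1 *; rewrite /= in gx1.
have <- : z = x1 by apply: gen_inj.
by rewrite n0 gx1.
Qed.

Lemma gb_kap z r x c : gdeg r = rho -> gsq x ++ gsq z = c ++ gsq r ->
  chainb (gdeg z) (gst x) c -> walk_end (gst x) c = gst r ->
  gb r * el (gdeg z) (gst x) c = el (rho + gdeg z) (gst x) (gsq x ++ gsq z).
Proof. by move=> rr def_s gc cr; rewrite gb_mul // cr eqxx rr def_s. Qed.

Lemma gb_mul_gb z x : gb z * gb x =
  if gst z == gend x then el (gdeg z + gdeg x) (gst x) (gsq x ++ gsq z) else 0.
Proof. by rewrite [gb x]/gb gb_mul ?gen_chainb. Qed.

Lemma chainb_OO j k v s u t : isO j -> isO k -> chainb j v s -> chainb k u t ->
  ~~ chainb (k + j) v (s ++ t).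
Proof.
move=> Oj Ok /chainbP[_ Gs] /chainbP[_ Gt]; apply/negP => /chainbP[_]; rewrite addnC.
exact: (chain_OO D2 A1 AD nD2A Oj Ok Gs Gt).
Qed.

Lemma gkap_relation s z x : gnxt s z -> gnxt (inr z) x ->
  gb z * gb x = \sum_(r | gnxt s r) gb r * gkap z r x.
Proof.
move=> sz zx; have [xz nzx] := andP zx; rewrite gb_mul_gb [gst z == _]eq_sym xz.
have kap0 : ~~ (isO (gdeg z) && (gdeg x == rho)) -> forall r, gkap z r x = 0.
  move=> h r; case: (gkapP z r x) => // -[c [[Oz rx] _ _ _ _]].
  by rewrite Oz rx eqxx in h.
have sum0 : (forall r, gkap z r x = 0) -> \sum_(r | gnxt s r) gb r * gkap z r x = 0.
  by move=> h; rewrite big1 // => r _; rewrite h mulr0.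
case: (gen_cases z) => [rz|Oz].
  (* An even [z] admits [x] only when their product is 0, and corrections arise only from an odd
     [z]. *)
  rewrite rz eqxx /= in nzx; rewrite rz el0 // sum0 // => r.
  by apply: kap0; rewrite rz (negPf (rho_notO D0 A)).
case: (gen_cases x) => [rx|Ox]; last first.
  rewrite el0; last exact: chainb_OO Ox Oz (gen_chainb x) (gen_chainb z).
  by rewrite sum0 // => r; apply: kap0; rewrite Oz isO_rho.
rewrite rx [(gdeg z + _)%N]addnC.
have [g|ng] := boolP (chainb (rho + gdeg z) (gst x) (gsq x ++ gsq z)); last first.
  rewrite el0 // sum0 // => r.
  by case: (gkapP z r x) => // -[c [_ _ _ _ [g]]]; rewrite g in ng.
have [c [r [def_s rr gc cr]]] := gkap_split Oz rx g.
have kE r' := gkapE r' Oz rx (eqP xz) g def_s (gsize_rho rr).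
rewrite (big_only1 r) => [||r' r'r _].
- by rewrite kE rr eqxx eqxx cr eqxx /= gb_kap.
(* It remains that [r] is admissible after [s]. If [s] is an even letter [z0], a chain formed by [r]
   and [z0] would by [chain_swap_state] give one formed by [z] and [z0]. *)
- have er : gend r = gend z.
    rewrite /gend -cr -walk_end_cat -def_s walk_end_cat.
    by rewrite -/(gend x) (eqP xz).
  case: s sz {sum0} => [v|z0] /= sz; first by rewrite er.
  have /andP[z0z nz0] := sz; rewrite er z0z /=.
  have [r0|//] := eqVneq (gdeg z0) rho.
  rewrite r0 eqxx /= rr in nz0 *; apply/negP => /chainbP[wr Gr].
  case/negP: nz0; apply/chainbP.
  have wz : walk (gst z) (gsq z ++ gsq z0).
    by rewrite walk_cat gen_walk -/(gend z) (eqP z0z) gen_walk.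
  split=> //; have /chainbP[wxz Gxz] := g.
  have Gr' := gen_chain r; rewrite rr in Gr'.
  have Gx' := gen_chain x; rewrite rx in Gx'.
  have Gz0 := gen_chain z0; rewrite r0 in Gz0.
  have [wc Gc] := chainbP _ _ _ gc.
  rewrite def_s in Gxz.
  apply: (chain_swap_state D2 A1 AD nD2A overlapP Oz def_s Gxz Gc Gr' Gx' (gen_chain z)
            (v := gst x) (y := gsq z0)) => //.
  by rewrite walk_cat wc cr.
rewrite kE; case: and3P => [[/eqP h1 /eqP h2 /eqP h3]|_]; last by rewrite mulr0.
by case/eqP: r'r; apply: gen_inj; rewrite ?h1 ?rr // h3 cr.
Qed.

Lemma gkap_gb z r x x' : gnxt (inr z) x -> gnxt (inr x) x' -> gkap z r x * gb x' = 0.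
Proof.
move=> zx /andP[/eqP x'x nx'].
case: (gkapP z r x) => [->|]; first by rewrite mul0r.
move=> [c [[Oz rx] rr xz def_s [g cr gc ->]]].
rewrite el_mul ?gen_chainb //; case: eqP => // _; rewrite el0 //.
case: (gen_cases x') => [rx'|Ox']; last exact: chainb_OO Ox' Oz (gen_chainb x') gc.
rewrite rx' rx eqxx /= in nx' *; apply: contraNN nx'; rewrite addnC => /chainbP[w G].
have /chainbP[wxz Gxz] := g; rewrite def_s in Gxz.
have Gr' := gen_chain r; rewrite rr in Gr'.
have Gx := gen_chain x; rewrite rx in Gx.
have Gx' := gen_chain x'; rewrite rx' in Gx'.
have [_ Gc] := chainbP _ _ _ gc.
apply/chainbP; split; first by rewrite walk_cat gen_walk -/(gend x') x'x gen_walk.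
apply: (chain_swap_next D2 A1 AD nD2A overlapP Oz def_s Gxz Gc Gr' Gx (v := gst x')) => //.
by rewrite walk_cat gen_walk -/(gend x') x'x -def_s wxz.
Qed.

Lemma gkap_gkap z r x r' x' : gkap z r r' * gkap x r' x' = 0.
Proof.
case: (gkapP z r r') => [->|]; first by rewrite mul0r.
move=> [c [[Oz _] _ _ _ [_ _ gc ->]]].
case: (gkapP x r' x') => [->|]; first by rewrite mulr0.
move=> [c' [[Ox _] _ _ _ [_ _ gc' ->]]].
by rewrite el_mul //; case: eqP => // _; rewrite el0 //; apply: chainb_OO gc' gc.
Qed.

Lemma gdel_gkap z r x x' y : gnxt (inr z) x' -> gnxt (inr r) x ->
  ev (gst x') * y = y -> D x (gkap z r x' * y) = 0.
Proof.
move=> zx' /andP[/eqP xr nxr].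
case: (gkapP z r x') => [-> _|]; first by rewrite mul0r linear0.
move=> [c [[Oz rx'] rr xz def_s [g cr gc ->]]]; move: y.
apply: el_left_ind => [|a y y' h1 h2|n v s gs vs].
- by rewrite mulr0 linear0.
- by rewrite mulrDr -scalerAr linearP h1 h2 scaler0 addr0.
rewrite el_mul // vs eqxx.
have [gsc|ngsc] := boolP (chainb (gdeg z + n) v (s ++ c)); last by rewrite el0 // linear0.
have /chainbP[wxz Gxz] := g; rewrite def_s in Gxz wxz.
have Gr' := gen_chain r; rewrite rr in Gr'.
have [_ Gc] := chainbP _ _ _ gc.
(* For [n = 0] the correction itself would be the deleted letter, and the path of [x] followed by
   that of [r] is a chain that admissibility excludes. For [n > 0] the deleted letter is even, and
   [chain_swap_prev] gives the same contradiction. *)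
case: n gs gsc => [|n] gs gsc.
  move: gs; rewrite chainb0 => /eqP s0; rewrite s0 /= addn0 in vs gsc *.
  rewrite gdel_odd //; case: and3P => // -[/eqP x1 /eqP x2 /eqP x3].
  rewrite rr eqxx /= x1 x2 x3 vs in nxr.
  by rewrite -def_s g in nxr.
have nOn : ~~ isO n.+1.
  apply/negP => On; have := chainb_OO On Oz gs gc.
  by rewrite gsc.
have nOs : ~~ isO (gdeg z + n.+1)%N.
  rewrite addnC; exact: (chain_odd_sum D2 A1 AD nD2A Oz Gxz Gc Gr' (ltn0Sn n) nOn).
have n0 : (0 < gdeg z + n.+1)%N by rewrite addnS.
have [wsc Gsc] := chainbP _ _ _ gsc.
have [_ [h [t [def_sc Gh Gt]]]] := chain_split D2 A1 AD nD2A Gsc n0 nOs.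
have st' : size t = delta rho by case: Gt.
rewrite def_sc gdel_even // -?def_sc //.
case: and3P => // -[/eqP x1 /eqP x2 /eqP x3].
rewrite rr eqxx /= x1 in nxr; case/negP: nxr.
apply/chainbP; split.
  by rewrite walk_cat gen_walk -/(gend x) xr gen_walk.
rewrite x3; have [ws Gs] := chainbP _ _ _ gs; rewrite addnC in Gsc.
apply: (chain_swap_prev D2 A1 AD nD2A overlapP Oz Gxz Gc Gr' (v := v) (g := s) (h := h)
   (m := n.+1)) => //.
by rewrite walk_cat ws vs.
Qed.

(** Checked on chains [y], by the leftmost letter [x1] of [y]. An even [z] either stays leftmost in
    [gb z * y], or the product is 0 and [x1] is admissible after [z]. An odd [z] moves past an even
    [x1], and deleting the exchanged letter gives the term with [gkap]. *)
Lemma gdel_homotopy s x z y : gnxt s z -> gnxt s x -> ev (gst z) * y = y ->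
  D x (gb z * y)
  + (if x == z then \sum_(x' | gnxt (inr z) x') gb x' * D x' y else 0)
  - \sum_(x' | gnxt (inr z) x') gkap z x x' * D x' y = if x == z then y else 0.
Proof.
move=> sz sx; move: y.
apply: (el_left_ind (C := fun y => hom_lhs gb gkap D (gnxt (inr z)) x z y =
    if x == z then y else 0)) => [|a y y' h1 h2|n v t gt vt].
- have := hom_lhs_linear gb gkap D (gnxt (inr z)) x z (-1) 0 0.
  by rewrite scaler0 addr0 scaleN1r addNr => ->; rewrite if_same.
- by rewrite hom_lhs_linear h1 h2; case: ifP; rewrite ?scaler0 ?addr0.
rewrite /hom_lhs gb_mul // vt eqxx.
have [n0|n0] := posnP n.
  have t0 : t = [::] by apply/eqP; rewrite -(chainb0 v) -{1}n0.
  rewrite n0 t0 /= in vt *; rewrite addn0 vt.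
  rewrite [X in _ - X]big1; last by move=> x' _; rewrite gdel0 mulr0.
  rewrite [X in if _ then X else _]big1; last by move=> x' _; rewrite gdel0 mulr0.
  by rewrite if_same addr0 subr0 -[el (gdeg z) _ _]/(gb z) gdel_gb.
have [x1 [n' [g [def_t gg [gx1 def_n] Dt cases]]]] := gfirst gt n0.
have x1z : gend x1 = gst z by rewrite /gend -gx1 -walk_end_cat -def_t.
have gbx1 : gb x1 * el n' v g = el n v t.
  by rewrite gb_mul // gx1 eqxx addnC -def_n -def_t.
have pick (F : gen -> E) : \sum_(x' | gnxt (inr z) x') F x' * D x' (el n v t) =
    if gnxt (inr z) x1 then F x1 * el n' v g else 0.
  rewrite big_mkcond (big_only1 x1) // => [|x' /negPf nx' _].
    by rewrite Dt eqxx.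
  by rewrite Dt nx' mulr0 if_same.
rewrite !pick gbx1.
have nx1 : gnxt (inr z) x1 = (gdeg z != rho) ||
    ~~ chainb (gdeg z + gdeg x1) (gst x1) (gsq x1 ++ gsq z) by rewrite /= x1z eqxx.
have /chainbP[wt Gt] := gt; have /chainbP[wg Gg] := gg.
have wtz : walk v (t ++ gsq z) by rewrite walk_cat wt vt gen_walk.
have wxz : walk (gst x1) (gsq x1 ++ gsq z).
  by rewrite walk_cat gen_walk -/(gend x1) x1z gen_walk.
case: (gen_cases z) => [rz|Oz].
  have -> : gkap z x x1 = 0.
    by case: (gkapP z x x1) => // -[c [[]]]; rewrite rz (negPf (rho_notO D0 A)).
  rewrite mul0r if_same subr0 nx1 rz eqxx /=.
  have Gz := gen_chain z; rewrite rz in Gz.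
  (* By [chain_loc], [z] and [y] have a non-zero product exactly when [z] and the leftmost letter of
     [y] do. *)
  have e : chainb (rho + n) v (t ++ gsq z) =
           chainb (rho + gdeg x1) (gst x1) (gsq x1 ++ gsq z).
    case: cases => [[On [n'0 g0]]|[nOn r1]].
      by rewrite def_n def_t n'0 g0 /= -gx1 g0.
    have Gx1 := gen_chain x1; rewrite r1 in Gx1.
    rewrite def_t in Gt; rewrite def_t -catA in wtz.
    have h := chain_loc D2 A1 AD nD2A overlapP wtz n0 nOn Gt Gx1 Gz.
    rewrite addnC r1 def_t -catA.
    by apply/chainbP/chainbP => -[_ G]; split=> //; apply/h.
  rewrite -e; have [g2|ng2] := boolP (chainb (rho + n) v (t ++ gsq z)); last first.
    by rewrite el0 // linear0 add0r; case: ifP.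
  rewrite /= if_same addr0 gdel_even //.
  - rewrite addKn vt; congr (if _ then _ else _).
    apply/and3P/eqP => [[/eqP h1 /eqP h2 /eqP h3]|->]; last by rewrite rz !eqxx.
    by apply: gen_inj; rewrite ?h1 ?rz.
  - by rewrite addn_gt0 n0 orbT.
  - case: cases => [[On _]|[nOn _]]; last first.
      by rewrite addnC; apply: (isO_add_rho D2 A1 AD nD2A).
    have /chainbP[_ G2] := g2.
    have s2 : size (t ++ gsq z) = (delta rho + delta n)%N.
      by rewrite size_cat gsize_rho // addnC; case: Gt => ->.
    by have [] := chain_odd_even D2 A1 AD nD2A On G2 s2.
  exact: gsize_rho.
rewrite nx1 isO_rho //=.
(* Since [x1] is always admissible after an odd [z], the middle term already gives [y] when [x = z].
   The other two terms must cancel. *)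
suff -> : D x (el (gdeg z + n) v (t ++ gsq z)) = gkap z x x1 * el n' v g.
  by rewrite addrAC subrr add0r.
case: cases => [[On [n'0 g0]]|[nOn r1]].
  have Ox1 : isO (gdeg x1) by move: On; rewrite def_n n'0.
  rewrite el0 ?linear0; last exact: chainb_OO On Oz gt (gen_chainb z).
  case: (gkapP z x x1) => [->|[c [[_ rx1] _ _ _]]]; first by rewrite mul0r.
  by move: Ox1; rewrite rx1 (negPf (rho_notO D0 A)).
have Gz := gen_chain z; have Gx1 := gen_chain x1; rewrite r1 in Gx1.
rewrite def_t in Gt; have wtz' := wtz; rewrite def_t -catA in wtz'.
have [g1|ng1] := boolP (chainb (rho + gdeg z) (gst x1) (gsq x1 ++ gsq z)); last first.
  have -> : gkap z x x1 = 0.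
    by case: (gkapP z x x1) => // -[c [_ _ _ _ [h]]]; rewrite h in ng1.
  rewrite mul0r el0 ?linear0 //; apply: contraNN ng1 => /chainbP[_ G].
  apply/chainbP; split=> //; rewrite addnC def_t -catA in G.
  exact: (chain_loc_odd D2 A1 AD nD2A Oz Gt n0 nOn Gx1 Gz G).
have [c [r [def_s rr gc cr]]] := gkap_split Oz r1 g1.
have sr := gsize_rho rr.
rewrite (gkapE x Oz r1 x1z g1 def_s sr).
have /chainbP[_ Gxz] := g1; rewrite def_s in Gxz.
have Gr := gen_chain r; rewrite rr in Gr; have /chainbP[wc Gc] := gc.
(* Both sides are governed by [g ++ c], the path of [gb z * y] with the even [r] cut off. *)
have [nOs sw] := chain_swap D2 A1 AD nD2A overlapP Oz def_s Gxz Gc Gr Gx1 wtz' n0 nOn Gt.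
have def_tz : t ++ gsq z = (g ++ c) ++ gsq r by rewrite def_t -!catA def_s.
have def_n' : (n - rho = n')%N by rewrite def_n r1 addnK.
rewrite def_n' catA -def_t in sw.
have wgc : walk v (g ++ c) by rewrite walk_cat wg gx1 wc.
have ecr : walk_end v (g ++ c) = walk_end (gst x1) c by rewrite walk_end_cat gx1.
have gcP : el (gdeg z) (gst x1) c * el n' v g = el (n' + gdeg z) v (g ++ c).
  by rewrite el_mul // gx1 eqxx addnC.
have [g2|ng2] := boolP (chainb (gdeg z + n) v (t ++ gsq z)); last first.
  rewrite el0 // linear0; case: ifP => [_|_]; last by rewrite mul0r.
  rewrite gcP el0 //; apply: contraNN ng2 => /chainbP[_ G]; apply/chainbP; split=> //.
  by rewrite addnC; apply/sw.
rewrite def_tz in g2 *; rewrite gdel_even //; first last.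
- by rewrite addnC.
- by rewrite addn_gt0 n0 orbT.
rewrite ecr [(gst x == _) && _]andbC; case: ifP => _; last by rewrite mul0r.
suff -> : (gdeg z + n - rho = n' + gdeg z)%N by rewrite gcP.
by rewrite def_n r1 addnA addnK addnC.
Qed.

(** * The regrading and the linear resolution over the Ext algebra *)

Section Grading.
Variable pr : nat -> {linear E -> E}.
Hypothesis prP : forall k n v s, chainb n v s ->
  pr k (el n v s) = if reg n == k then el n v s else 0.

Lemma pr_orth j k y : pr j (pr k y) = if j == k then pr k y else 0.
Proof.
move: y; apply: el_ind => [|c y y' h1 h2|n v s g].
- by rewrite !linear0 if_same.
- by rewrite !linearP h1 h2; case: eqP; rewrite ?scaler0 ?addr0.
rewrite prP //; case: (eqVneq (reg n) k) => [<-|nk]; last by rewrite linear0 if_same.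
by rewrite prP // eq_sym.
Qed.

Lemma pr_sum y : exists N, forall M, (N <= M)%N -> y = \sum_(k < M) pr k y.
Proof.
move: y; apply: el_ind => [|c y y' [N1 h1] [N2 h2]|n v s g].
- by exists 0%N => M _; rewrite big1 // => k _; rewrite linear0.
- exists (maxn N1 N2) => M; rewrite geq_max => /andP[M1 M2].
  rewrite [in LHS](h1 M M1) [in LHS](h2 M M2) scaler_sumr -big_split /=.
  by apply: eq_bigr => k _; rewrite linearP.
exists (reg n).+1 => M nM; rewrite (big_only1 (Ordinal nM)) //= => [|k nk _].
  by rewrite prP // eqxx.
by rewrite prP // ifN //; apply: contraNN nk => /eqP nk; apply/eqP/val_inj.
Qed.

(** On chains this is [reg_add]: the new degree is additive whenever the concatenation is again a
    chain. *)
Lemma pr_mul j k y y' : pr j y = y -> pr k y' = y' -> pr (j + k) (y * y') = y * y'.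
Proof.
have h i (C : E -> Prop) : C 0 -> (forall c y y', C y -> C y' -> C (c *: y + y')) ->
    (forall n v s, chainb n v s -> reg n = i -> C (el n v s)) ->
    forall u, pr i u = u -> C u.
  move=> C0 CD Ce u <-; move: u; apply: el_ind => [|c u u' h1 h2|n v s g].
  - by rewrite linear0.
  - by rewrite linearP; apply: CD.
  by rewrite prP //; case: eqP => // ni; apply: Ce.
move=> jy ky'; move: y jy; apply: (h j (fun y => pr (j + k) (y * y') = y * y')) => [|c y z h1 h2|m u t gt mj].
- by rewrite mul0r linear0.
- by rewrite mulrDl -scalerAl linearP h1 h2.
move: y' ky'; apply: (h k (fun y' => pr (j + k) (_ * y') = _ * y')) => [|c y z h1 h2|n v s gs nk].
- by rewrite mulr0 linear0.
- by rewrite mulrDr -scalerAr linearP h1 h2.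
rewrite el_mul //; case: eqP => // us; last by rewrite linear0.
have [g|ng] := boolP (chainb (m + n) v (s ++ t)); last by rewrite el0 // linear0.
rewrite prP //; have /chainbP[_ Gs] := gs; have /chainbP[_ Gt] := gt.
have /chainbP[_ G] := g; rewrite addnC in G.
by rewrite addnC (reg_add D2 A1 AD nD2A Gs Gt G) nk mj addnC eqxx.
Qed.

Definition ext_regraded k : set E := fun y => pr k y = y.

Lemma ext_regraded_grading : algebra_grading ext_regraded.
Proof.
split=> [|n c y h|m n y y']; last exact: pr_mul; last by rewrite /ext_regraded linearZ /= h.
apply: (projections_direct_sum (p := fun k y => pr k y)) => [k y y'||y].
- exact: linearB.
- exact: pr_orth.
have [N NP] := pr_sum y; exists (index_iota 0 N); split; first exact: iota_uniq.
by rewrite big_mkord; apply: NP.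
Qed.

Lemma ext_regraded_sums k : ext_regraded k =
  sums_of (fun y => exists n (w : Wd n) c, reg n = k /\ y = c *: ep w).
Proof.
apply/seteqP; split=> y /=.
  move=> <-; move: y; apply: el_ind => [|c y y' h1 h2|n v s g].
  - by rewrite linear0; apply: sums_of0.
  - rewrite linearP; apply: sums_ofD => //.
    apply: sums_ofZ h1 => _ [n [w [d [nk ->]]]]; exists n, w, (c * d).
    by rewrite scalerA.
  rewrite prP //; case: eqP => [nk|_]; last exact: sums_of0.
  have [w [wv ws]] := chainb_ex g; apply: sums_of_in; exists n, w, 1.
  by rewrite scale1r -wv -ws el_ep.
apply: sums_of_ind => [|z z' h h'|z [n [w [c [nk ->]]]]]; rewrite /ext_regraded.
- exact: linear0.
- by rewrite linearD h h'.
by rewrite linearZ /= -el_ep prP ?chainb_word // nk eqxx.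
Qed.

Section Augmentation.
Variable c0 : vertex Q -> {linear E -> K^o}.
Hypothesis c0P : forall u n v s, chainb n v s ->
  c0 u (el n v s) = ((n == 0%N) && (v == u))%:R.

Lemma c0_el u n v s : (0 < n)%N -> c0 u (el n v s) = 0.
Proof.
move=> n0; have [g|ng] := boolP (chainb n v s); last by rewrite el0 // linear0.
by rewrite c0P // eqn0Ngt n0.
Qed.

Lemma c0M u y y' : c0 u (y * y') = c0 u y * c0 u y'.
Proof.
move: y'; apply: el_ind => [|c z z' h1 h2|n v s gs].
- by rewrite mulr0 linear0 mulr0.
- by rewrite mulrDr -scalerAr !linearP h1 h2 mulrDr -[c *: _]/(c * _)
    -[c *: c0 u z]/(c * _) mulrCA.
move: y; apply: el_ind => [|c z z' h1 h2|m v' t gt].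
- by rewrite mul0r linear0 mul0r.
- by rewrite mulrDl -scalerAl !linearP h1 h2 mulrDl -[c *: _]/(c * _)
    -[c *: c0 u z]/(c * _) mulrA.
rewrite el_mul // c0P // c0P //.
have [n0|n0] := posnP n; last first.
  by rewrite mulr0; case: eqP => // _; rewrite ?linear0 // c0_el // addn_gt0 n0 orbT.
have [m0|m0] := posnP m; last first.
  by rewrite mul0r; case: eqP => // _; rewrite ?linear0 // c0_el // addn_gt0 m0.
rewrite n0 m0 in gs gt *; move: gs gt; rewrite !chainb0 => /eqP-> /eqP->.
rewrite [v' == _]eq_sym /=; have [->|nv] := eqVneq v v'.
  by rewrite c0P ?chainb_vertex // -natrM mulnb andbb.
rewrite linear0 -natrM mulnb; case: eqP => //= v'u; case: eqP => // vu.
by rewrite vu v'u eqxx in nv.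
Qed.

Lemma c0_ev u v : c0 u (ev v) = (v == u)%:R.
Proof. by rewrite c0P ?chainb_vertex. Qed.

Lemma c0_1 u : c0 u 1 = 1.
Proof.
rewrite -ev_sum linear_sum (big_only1 u) // => [|v /negPf vu _].
  by rewrite c0_ev eqxx.
by rewrite c0_ev vu.
Qed.

Lemma c0_pos u k y : (0 < k)%N -> pr k y = y -> c0 u y = 0.
Proof.
move=> k0 <-; move: y; apply: el_ind => [|c y y' h1 h2|n v s g].
- by rewrite !linear0.
- by rewrite !linearP h1 h2 scaler0 addr0.
rewrite prP //; case: eqP => nk; last by rewrite linear0.
by rewrite c0_el // lt0n -(reg0 D0 A) nk -lt0n.
Qed.

Lemma pr_ev v : pr 0 (ev v) = ev v.
Proof. by rewrite prP ?chainb_vertex // reg0. Qed.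

Lemma pos_partZ c y : pos_part ext_regraded y -> pos_part ext_regraded (c *: y).
Proof.
by apply: sums_ofZ => z [n n0 hz]; exists n => //; rewrite /ext_regraded linearZ /= hz.
Qed.

Lemma augmentation_rest y : pos_part ext_regraded (y - \sum_v c0 v y *: ev v).
Proof.
move: y; apply: el_ind => [|c y y' h1 h2|n v s g].
- rewrite big1 ?subr0; first exact: sums_of0.
  by move=> v _; rewrite linear0 scale0r.
- suff -> : c *: y + y' - \sum_v c0 v (c *: y + y') *: ev v =
    c *: (y - \sum_v c0 v y *: ev v) + (y' - \sum_v c0 v y' *: ev v).
    by apply: sums_ofD => //; apply: pos_partZ.
  rewrite scalerBr addrACA -opprD scaler_sumr -big_split /=; congr (_ - _).
  apply: eq_bigr => v _; rewrite linearP scalerDl; congr (_ + _).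
  by rewrite scalerA.
have [n0|n0] := posnP n.
  move: g; rewrite n0 chainb0 => /eqP->; rewrite (big_only1 v) // => [|u /negPf uv _].
    by rewrite c0_ev eqxx scale1r subrr; apply: sums_of0.
  by rewrite c0_ev eq_sym uv scale0r.
rewrite big1 ?subr0 => [|u _]; last by rewrite c0_el // scale0r.
apply: sums_of_in; exists (reg n); first by rewrite lt0n reg0 -lt0n.
by rewrite /ext_regraded prP // eqxx.
Qed.

(** The right module of [E] modulo its positive part, realized on functions on the vertices with [E]
    acting through the coefficients [c0], so that no quotient has to be formed. *)
Definition degree0 : zmodType := {ffun vertex Q -> K}.

Definition degree0_scale (y : E^c) (f : degree0) : degree0 :=
  [ffun v => f v * c0 v y].

Fact degree0_scaleA a b f : degree0_scale a (degree0_scale b f) = degree0_scale (a * b) f.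
Proof. by apply/ffunP => v; rewrite !ffunE c0M -mulrA. Qed.

Fact degree0_scale1 : left_id 1 degree0_scale.
Proof. by move=> f; apply/ffunP => v; rewrite !ffunE c0_1 mulr1. Qed.

Fact degree0_scaleDr : right_distributive degree0_scale +%R.
Proof. by move=> a f g; apply/ffunP => v; rewrite !ffunE mulrDl. Qed.

Fact degree0_scaleDl f : {morph degree0_scale^~ f : a b / a + b}.
Proof. by move=> a b; apply/ffunP => v; rewrite !ffunE linearD mulrDr. Qed.

Definition degree0_module : lmodType E^c :=
  HB.pack degree0 (GRing.Zmodule_isLmodule.Build E^c degree0
    degree0_scaleA degree0_scale1 degree0_scaleDr degree0_scaleDl).

Definition augmentation_fun (y : (E^c)^o) : degree0_module := [ffun v => c0 v y : K].

Fact augmentation_linear : linear augmentation_fun.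
Proof.
move=> a y y'; apply/ffunP => v; rewrite !ffunE linearD; congr (_ + _).
by rewrite -c0M.
Qed.

Definition augmentation : {linear (E^c)^o -> degree0_module} := mklin augmentation_linear.

Lemma augmentation_eq0 (y : E) : augmentation y = 0 <-> forall v, c0 v y = 0.
Proof.
split=> [/ffunP h v|h]; first by have := h v; rewrite !ffunE.
by apply/ffunP => v; rewrite !ffunE h.
Qed.

Lemma augmentationP : is_degree0_module ext_regraded augmentation.
Proof.
split=> [f|y].
  exists (\sum_v (f : degree0) v *: ev v); apply/ffunP => u.
  rewrite ffunE linear_sum (big_only1 u) // => [|v /negPf vu _].
    by rewrite linearZ /= c0_ev eqxx -[LHS]/(_ * _) mulr1.
  by rewrite linearZ /= c0_ev vu scaler0.
rewrite augmentation_eq0; split=> [h|].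
  by have := augmentation_rest y; rewrite big1 ?subr0 // => v _; rewrite h scale0r.
move=> h v; move: h; apply: (sums_of_ind (C := fun y => c0 v y = 0)) => [|z z' h h'|z].
- exact: linear0.
- by rewrite linearD h h' addr0.
by move=> [k k0 hz]; apply: c0_pos hz.
Qed.

(** Multiplying the leftmost letter back restores a chain; trivial paths have no letter and account
    for the subtracted term. *)
Lemma gdel_sum v y : ev v * y = y ->
  \sum_(x | gnxt (inl v) x) gb x * D x y = y - c0 v y *: ev v.
Proof.
move: y; apply: el_left_ind => [|c y y' h1 h2|n u s g us].
- by rewrite big1 => [|x _]; rewrite !linear0 ?mulr0 // scale0r subr0.
- have -> : c *: y + y' - c0 v (c *: y + y') *: ev v =
    c *: (y - c0 v y *: ev v) + (y' - c0 v y' *: ev v).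
    rewrite scalerBr addrACA -opprD linearP scalerDl; congr (_ - (_ + _)).
    by rewrite scalerA.
  rewrite -h1 -h2 scaler_sumr -big_split /=; apply: eq_bigr => x _.
  by rewrite linearP mulrDr -scalerAr.
have [n0|n0] := posnP n.
  move: g us; rewrite n0 chainb0 => /eqP-> /= ->; rewrite c0_ev eqxx scale1r subrr.
  by rewrite big1 // => x _; rewrite gdel0 mulr0.
rewrite c0_el // scale0r subr0.
have [x1 [n' [t [def_s gt [tx1 def_n] Dt _]]]] := gfirst g n0.
rewrite (big_only1 x1) // => [||x /negPf xx1 _].
- by rewrite Dt eqxx gb_mul // tx1 eqxx def_s addnC -def_n.
- by rewrite /= -us def_s walk_end_cat tx1.
by rewrite Dt xx1 mulr0.
Qed.

Lemma gen_axioms : word_axioms ev gb gend gst gnxt gkap (fun x => D x) augmentation.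
Proof.
split.
- exact: ev_orth.
- exact: ev_sum.
- exact: gb_src.
- exact: gb_tgt.
- exact: gnxt_end.
- exact: gkap_src.
- by move=> x; apply: linearD.
- exact: gdel_gend.
- by move=> v y vy /augmentation_eq0 y0; rewrite gdel_sum // y0 scale0r subr0.
- exact: gdel_homotopy.
- exact: gdel_gkap.
- exact: gkap_relation.
- exact: gkap_gb.
- by move=> z r x r' x' _ _ _; apply: gkap_gkap.
- by have [] := augmentationP.
- by move=> x; apply/augmentation_eq0 => v; rewrite c0_el ?gdeg_gt0.
- move=> v y /augmentation_eq0 y0; apply/augmentation_eq0 => u.
  by rewrite c0M y0 mulr0.
Qed.

Definition gres := word_resolution gen_axioms.

Lemma gb_pr x : pr 1 (gb x) = gb x.
Proof. by rewrite prP ?gen_chainb // gdeg_reg eqxx. Qed.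

Lemma gkap_pr z r x : pr 1 (gkap z r x) = gkap z r x.
Proof.
case: (gkapP z r x) => [->|[c [[Oz _] _ _ _ [_ _ g ->]]]]; first exact: linear0.
by rewrite prP // reg_isO // eqxx.
Qed.

Lemma we_pr n (w : word gnxt n) : pr 0 (we ev gst w) = we ev gst w.
Proof. exact: pr_ev. Qed.

Definition gpr k : E -> E := pr k.
Fact gprB k x y : gpr k (x - y) = gpr k x - gpr k y. Proof. exact: linearB. Qed.

Local Notation gprz := (prz gpr).

Definition gres_pr n (i : int) (f : gres n) : gres n :=
  col_prz gprB pr_orth pr_sum pr_mul (@we_pr n) i f.

(** Every letter has new degree 1, so the generator of a word of length [n] is placed in degree [n]
    by the shift. *)
Definition gres_grading n (i : int) : set (gres n) :=
  fun f => gres_pr (i - n%:Z) f = f.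

Lemma gres_gradingP n i (f : gres n) :
  gres_grading i f <-> forall w, gprz (i - n%:Z) (cev f w) = cev f w.
Proof.
split=> [fi w|h]; first by rewrite -{2}fi cev_mkcol.
by apply: columnP => w; rewrite cev_mkcol.
Qed.

Lemma gprz0 j : gprz j 0 = 0.
Proof. by case: j => //= k; apply: linear0. Qed.

Lemma gprzD j x y : gprz j (x + y) = gprz j x + gprz j y.
Proof. by case: j => k /=; [apply: linearD|rewrite addr0]. Qed.

Lemma gprz_mul1 i b y : gpr 1 b = b -> gprz i y = y -> gprz (i + 1) (b * y) = b * y.
Proof.
move=> b1; case: i => k yk; last by rewrite -yk mulr0 gprz0.
have -> : Posz k + 1 = Posz (1 + k) by lia.
exact: pr_mul.
Qed.

Lemma gprz_sum j (T : Type) (r : seq T) (P : pred T) F :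
  (forall i, P i -> gprz j (F i) = F i) ->
  gprz j (\sum_(i <- r | P i) F i) = \sum_(i <- r | P i) F i.
Proof.
move=> h; apply: (big_ind (fun y => gprz j y = y)) => //; first exact: gprz0.
by move=> x y xj yj; rewrite gprzD xj yj.
Qed.

Lemma pos_part_gmul b y : gpr 1 b = b -> pos_part ext_regraded (b * y).
Proof.
move=> b1; have [N NP] := pr_sum y; rewrite (NP N) // mulr_sumr.
apply: sums_of_sum => k _; apply: sums_of_in; exists (1 + k)%N => //.
by apply: pr_mul => //; rewrite pr_orth eqxx.
Qed.

(** Both kinds of coefficients of the differential, [gb] and [gkap], have degree 1. This gives
    homogeneity and, as 1 is positive, minimality. *)
Lemma gres_minimal_graded : minimal_graded ext_regraded gres_grading.
Proof.
have wdP n (f : gres n.+1) j (w : word gnxt n) :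
    (forall p, gprz j (cev f p) = cev f p) ->
    gprz (j + 1) (cev (res_d gres n f) w) = cev (res_d gres n f) w.
  move=> fj; rewrite [cev _ w]cev_wd /wd_fun przB; last exact: gprB.
  congr (_ - _).
    by apply: gprz_sum => p _; apply: gprz_mul1 => //; apply: gb_pr.
  case: n f w fj => [|n] f w fj; first exact: gprz0.
  by apply: gprz_sum => p _; apply: gprz_mul1 => //; apply: gkap_pr.
split=> [n|n i f /gres_gradingP fi|i f /gres_gradingP fi i0|n f].
- exact: col_prz_grading.
- apply/gres_gradingP => w.
  have -> : i - n%:Z = i - n.+1%:Z + 1 by lia.
  exact: wdP.
- rewrite [LHS]wepsE; apply/augmentation_eq0 => v; rewrite linear_sum big1 // => u _.
  have := fi u; rewrite subr0; case: i i0 {fi} => k k0 /= h; last by rewrite -h linear0.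
  by apply: c0_pos h; rewrite lt0n; apply: contraNneq k0 => ->.
apply: column_radical => [|w]; first exact: we_idem gen_axioms _.
have J0 : pos_part ext_regraded 0 := sums_of0 _.
rewrite [cev _ w]cev_wd /wd_fun -scaleN1r; apply: sums_ofD.
  by apply: sums_of_sum => p _; apply/pos_part_gmul/gb_pr.
apply: pos_partZ; case: n f w => [|n] f w //.
by apply: sums_of_sum => p _; apply/pos_part_gmul/gkap_pr.
Qed.

Lemma gres_generated n : generated_in (gres_grading (n := n)) n%:Z.
Proof.
move=> f; have e_idem := we_idem gen_axioms (n := n).
rewrite [f](column_sum e_idem); apply: sums_of_sum => w _; apply: sums_of_in.
exists (cgen e_idem w : gres n), (cev f w); split=> //.
apply/gres_gradingP => u; rewrite cev_gen subrr; case: eqP => [_|_]; last exact: gprz0.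
exact: we_pr.
Qed.

Definition vertex_comb_fun (u : {ffun 'I_#|vertex Q| -> K}) : E :=
  \sum_v u (enum_rank v) *: ev v.

Lemma c0_vertex_comb v u : c0 v (vertex_comb_fun u) = u (enum_rank v).
Proof.
rewrite linear_sum (big_only1 v) // => [|w /negPf wv _].
  by rewrite linearZ /= c0_ev eqxx -[LHS]/(_ * _) mulr1.
by rewrite linearZ /= c0_ev wv scaler0.
Qed.

Fact vertex_comb_zmod : zmod_morphism vertex_comb_fun.
Proof.
move=> u w; rewrite /vertex_comb_fun -sumrB; apply: eq_bigr => v _.
by rewrite !ffunE scalerBl.
Qed.

Fact vertex_comb_monoid : monoid_morphism vertex_comb_fun.
Proof.
split=> [|u w]; rewrite /vertex_comb_fun.
  by rewrite -ev_sum; apply: eq_bigr => v _; rewrite ffunE scale1r.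
rewrite mulr_suml; apply: eq_bigr => v _; rewrite mulr_sumr (big_only1 v) //.
  by rewrite -scalerAl -scalerAr ev_orth eqxx scalerA ffunE.
move=> v' /negPf v'v _; rewrite -scalerAl -scalerAr ev_orth eq_sym v'v.
by rewrite !scaler0.
Qed.

Definition vertex_comb : {rmorphism {ffun 'I_#|vertex Q| -> K} -> E} :=
  HB.pack vertex_comb_fun (GRing.isZmodMorphism.Build _ _ vertex_comb_fun vertex_comb_zmod)
    (GRing.isMonoidMorphism.Build _ _ vertex_comb_fun vertex_comb_monoid).

Lemma pr0_span y : pr 0 y = y -> y = \sum_v c0 v y *: ev v.
Proof.
move=> <-; move: y; apply: el_ind => [|c y y' h1 h2|n v s g].
- by rewrite big1 ?linear0 // => v _; rewrite !linear0 scale0r.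
- rewrite linearP [in LHS]h1 [in LHS]h2 scaler_sumr -big_split /=.
  by apply: eq_bigr => v _; rewrite linearP scalerDl scalerA.
rewrite prP // reg0; case: eqP => [n0|_]; last first.
  by rewrite big1 // => u _; rewrite linear0 scale0r.
move: g; rewrite n0 chainb0 => /eqP->; rewrite (big_only1 v) // => [|u /negPf uv _].
  by rewrite c0_ev eqxx scale1r.
by rewrite c0_ev eq_sym uv scale0r.
Qed.

Lemma ext_regraded_split : degree0_split ext_regraded.
Proof.
exists #|vertex Q|, vertex_comb; split=> [a u|u w uw|].
- rewrite scaler_sumr; apply: eq_bigr => v _.
  by rewrite ffunE scalerA.
- apply/ffunP => i; rewrite -(enum_valK i).
  by have := congr1 (c0 (enum_val i)) uw; rewrite !c0_vertex_comb.
apply/seteqP; split=> y /=.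
  move=> /pr0_span y0; exists [ffun i => c0 (enum_val i) y : K] => //.
  by rewrite [RHS]y0; apply: eq_bigr => v _; rewrite ffunE enum_rankK.
move=> [u _ <-]; rewrite /ext_regraded linear_sum; apply: eq_bigr => v _.
by rewrite linearZ /= pr_ev.
Qed.

Lemma ext_regraded_koszul : koszul ext_regraded.
Proof.
split; [exact: ext_regraded_grading|exact: ext_regraded_split|].
exists degree0_module, augmentation, gres, gres_grading.
split; [exact: augmentationP|exact: gres_minimal_graded|exact: gres_generated].
Qed.

End Augmentation.
End Grading.
End Deletion.

(** The explicit form of the pieces serves to recognize them as sums of Ext spaces. *)
Theorem based_algebra_koszul : exists Ehat : nat -> set E, koszul Ehat /\
  forall k, Ehat k =
    sums_of (fun y => exists n (w : Wd n) c, reg n = k /\ y = c *: ep w).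
Proof.
have [D DP] := gdel_exists.
have /choice[pr prP] : forall k, exists f : {linear E -> E}, forall n v s, chainb n v s ->
    f (el n v s) = if reg n == k then el n v s else 0.
  by move=> k; apply: el_ext.
have /choice[c0 c0P] : forall u, exists f : {linear E -> K^o}, forall n v s, chainb n v s ->
    f (el n v s) = ((n == 0%N) && (v == u))%:R.
  by move=> u; apply: el_ext.
exists (ext_regraded pr); split; last exact: ext_regraded_sums.
exact: (ext_regraded_koszul DP prP c0P).
Qed.

End Elements.

(** * Application to the Ext algebra of a stacked monomial algebra *)

Unset Implicit Arguments.
Set Strict Implicit.
Set Printing Implicit Defensive.

Theorem theorem5p8 (K : fieldType) (Q : quiver) (I : set (path_alg K Q))
    (L : algType K) (phi : {lrmorphism path_alg K Q -> L})
    (L0 : lmodType L^c) (pi : {linear (L^c)^o -> L0})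
    (P : resolution L0) (H : forall n : nat, int -> set (P n)) (D A : nat)
    (E : algType K) (cls : forall n : nat, {linear P n -> L0} -> E) :
  admissible I -> len_homogeneous_ideal I -> is_quotient I phi ->
  is_degree0_module (len_grading phi) pi ->
  minimal_graded (len_grading phi) H ->
  (2 <= D)%N -> (1 <= A)%N ->
  stacked D A H -> monomial_ideal I ->
  is_ext_algebra cls ->
  ((1 < A)%N -> D <> (2 * A)%N) ->
  exists Ehat : nat -> set E, regrading cls Ehat /\ koszul Ehat.
Proof.
move=> admI _ quoI piP mH D2 A1 stP monI extE nDA.
have [del ax] := monomial_axioms admI monI quoI piP.
(* Without 3-chains the given [A] carries no information and may exceed [D]. It is replaced by some
   [A' < D] that differs from [A] only if it is 1, so the condition on [D] and [A] passes to
   [A']. *)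
have [A' [A'1 A'D lenP A'A]] :=
  exponent_normalize D2 A1 (word_length monI ax mH stP).
have nDA' : (1 < A')%N -> D <> (2 * A')%N by move=> h; rewrite A'A //; apply: nDA; rewrite -A'A.
have [F cF] := chain_map_exists (lres ax) P; have [G cG] := chain_map_exists P (lres ax).
have mP : minimal_resolution (pos_part (len_grading phi)) P by case: mH => _ _ _; apply.
have [Ehat [kE sumE]] := based_algebra_koszul D2 A'1 A'D nDA' (overlap_chain ax D2 A'1 lenP)
  (word_eq ax lenP) (fun n w => conj (wwalk ax w) (word_chain ax D2 A'1 lenP A'D w))
  (chain_word ax D2 A'1 lenP A'D) (eps_basis monI piP mP cF cG extE)
  (eps_mul piP D2 A'1 A'D lenP mP cF cG extE).
exists Ehat; split=> //; split; first by case: kE.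
move=> k; exists (fun i => reg D A' i = k); rewrite sumE.
apply/seteqP; split=> y; apply: sums_of_ind; try exact: sums_of0; try exact: sums_ofD.
  move=> _ [n [w [c [nk ->]]]]; apply: sums_of_in; exists n => //.
  (* A multiple of a basis class is the class of a rescaled map, so it lies in a single Ext
     space. *)
  exists (kscale c (chiG G w)); first exact: (all_cocycles admI quoI piP mP).
  by rewrite -(ext_clsZ extE (h := kscale c (chiG G w))) //; exact: (all_cocycles admI quoI piP mP).
move=> _ [n nk [f _ <-]].
have [c ->] := cls_span piP mP cF cG extE f.
by apply: sums_of_sum => w _; apply: sums_of_in; exists n, w, (c w).
Qed.
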